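(* For all $m\in\mathbb Z$: 1. We have $t_{s_0}\star\bar\varphi_m=\bar\varphi_m$ and $t_{s_0}\star\bar\psi_m=0$. Thus $t_{s_0}$ acts by a projector $C_c^\infty(F^2)^I\twoheadrightarrow C_c^\infty(F^2)^K$. 2. We have $t_{s_1}\star\bar\psi_m=\bar\psi_m$ and $t_{s_1}\star\bar\varphi_m=0$. Therefore $t_{s_1}$ acts on $C_c^\infty(F^2)^I$ as $\mathrm{id}-t_{s_0}$.
   Context: $\tilde W=\langle s_0,s_1\mid s_0^2=s_1^2=1\rangle$ is the affine Weyl group of $\mathrm{SL}_2$ (the infinite dihedral group), with length function $\ell$, strong Bruhat order $\le$ and identity $1$. With $q^{1/2}$ first viewed as an indeterminate, let $\mathcal A=\mathbb Z[q^{1/2},q^{-1/2}]$. $H$ is the $\mathcal A$-algebra with $\mathcal A$-basis $\{T_w\}_{w\in\tilde W}$ and relations $T_wT_{w'}=T_{ww'}$ if $\ell(ww')=\ell(w)+\ell(w')$, and $(T_s+1)(T_s-q)=0$ for $s\in\{s_0,s_1\}$. The Kazhdan–Lusztig bases (all Kazhdan–Lusztig polynomials equal $1$ here) are $$C_w=\sum_{y\le w}(-1)^{\ell(w)-\ell(y)}q^{\frac{\ell(w)-\ell(y)}{2}}q^{-\frac{\ell(y)}{2}}T_y,\qquad C'_w=q^{-\frac{\ell(w)}{2}}\sum_{y\le w}T_y.$$ Let $\overline{(\,\cdot\,)}$ be the involution of $\mathcal A$ with $\overline{q^{1/2}}=q^{-1/2}$, and let $j$ be the ring involution $j(\sum a_wT_w)=\sum\overline{a_w}(-1)^{\ell(w)}q^{-\ell(w)}T_w$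 of $H$; then $C'_w=(-1)^{\ell(w)}j(C_w)$. Define $h_{x,y,z}\in\mathcal A$ by $C_xC_y=\sum_z h_{x,y,z}C_z$. The set of distinguished involutions is $\mathcal D=\{1,s_0,s_1\}$, and Lusztig's $a$-function has values $a(1)=0$, $a(w)=1$ for $w\ne1$. $J$ is Lusztig's asymptotic Hecke algebra, with $\mathbb Z$-basis $\{t_w\}_{w\in\tilde W}$, and the $\mathcal A$-algebra map $\phi\colon H\to J\otimes_{\mathbb Z}\mathcal A$ is $\phi(C_x)=\sum_{z\in\tilde W,\,d\in\mathcal D,\,a(d)=a(z)}h_{x,d,z}t_z$. Completions: $\mathcal H$ is the set of formal sums $\sum b_xC_x$ with $b_x\in\mathbb Z((q^{1/2}))$ such that for every $N>0$, $b_x\in q^{N/2}\mathbb Z[[q^{1/2}]]$ for $\ell(x)$ large; $\mathcal J$ is the same with $t_x$ in place of $C_x$. $\phi$ extends coefficientwise to an isomorphism $\mathcal H\to\mathcal J$. $\mathcal H'$ is the set of formal sums $\sum b_xC'_x$ with $b_x\in\mathbb Z((q^{-1/2}))$ satisfying the same condition with $q^{-1/2}$ in place of $q^{1/2}$, and $j$ gives mutually inverse bijections between $\mathcal H'$ and $\mathcal H$, $j(\sum b_xC'_x)=\sum(-1)^{\ell(x)}\overline{b_x}C_x$. Expanding each $C'_x$, one writes $(\phi\circ j)^{-1}(t_w)=j(\phi^{-1}(t_w))\in\mathcal H'$ as $\sum_x b_{w,x}T_x$; the $b_{w,x}$ are rational functions of $q^{1/2}$ with denominators of the form $q^{m/2}(q+1)$.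 Now let $F$ be a non-archimedean local field with ring of integers $\mathcal O$, uniformizer $\pi$, and let $q$ be the cardinality of $\mathcal O/\pi\mathcal O$. Let $G=\mathrm{SL}_2(F)$, $K=\mathrm{SL}_2(\mathcal O)$, and let $I\subset K$ be the Iwahori subgroup of matrices that are upper triangular modulo $\pi$. Elements of $\tilde W$ are lifted to $G$ via $s_0\mapsto\begin{pmatrix}0&-1\\1&0\end{pmatrix}$, $s_1\mapsto\begin{pmatrix}0&\pi^{-1}\\-\pi&0\end{pmatrix}$, and $T_x$ is identified with the characteristic function of $IxI$. From here on, $t_w$ denotes the function $\sum_x b_{w,x}T_x$ on $G$, with $q$ specialized to its numerical value, and it acts by convolution. On $F^2\setminus\{0\}$ (column vectors), let $\psi_n$ be the characteristic function of the $I$-orbit $\begin{pmatrix}\pi^n\mathcal O^\times\\ \pi^{n+1}\mathcal O\end{pmatrix}$ and $\varphi_n$ that of the $I$-orbit $\begin{pmatrix}\pi^n\mathcal O\\ \pi^n\mathcal O^\times\end{pmatrix}$, $n\in\mathbb Z$, and put $$\bar\varphi_n=\sum_{k=n}^\infty(\varphi_k+\psi_k),\qquad\bar\psi_n=\sum_{k=n}^\infty(\psi_k+\varphi_{k+1}).$$ $C_c^\infty(F^2)^I$ (resp. $C_c^\infty(F^2)^K$) is the complex vector space of locally constant, compactly supported, $I$-invariant (resp. $K$-invariant) functions on $F^2$, viewed by restriction as functions on $F^2\setminus\{0\}$; the $\bar\varphi_n,\bar\psi_n$ form a basis of the former and the $\bar\varphi_n$ a basis of the latter. Convolution is $(f\star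 h)(x)=\int_Gf(u)h(u^{-1}x)\,du$ for $x\in F^2\setminus\{0\}$, with Haar measure normalized by $\mathrm{vol}(I)=1$ (so $f\star h$ is the sum over cosets $uI\in G/I$). *)

(* Defs.v *)
From HB Require Import structures.
From Stdlib Require Import Relations.Relation_Operators.
From mathcomp Require Import all_boot all_order all_algebra.
From mathcomp Require Import finmap complex.
From mathcomp Require Import all_classical all_reals all_analysis.

Set Implicit Arguments.
Unset Strict Implicit.
Unset Printing Implicit Defensive.

Import Order.TTheory GRing.Theory Num.Theory.

Local Open Scope classical_set_scope.
Local Open Scope ring_scope.
Local Open Scope complex_scope.

Local Notation "x %:F" := (@FracField.tofrac _ x).

(** * The infinite dihedral group *)

(* Elements of <s0, s1 | s0^2 = s1^2 = 1> are represented by their reduced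
   words, i.e. the words in which consecutive letters differ; the letter
   [false] stands for s0 and [true] for s1. *)
Definition reduced (w : seq bool) : bool := sorted (fun a b => a != b) w.

Record affW := AffW { word : seq bool; word_reduced : reduced word }.
HB.instance Definition _ := [isSub for word].
HB.instance Definition _ := [Countable of affW by <:].

Definition push (a : bool) (w : seq bool) : seq bool :=
  if w is b :: w' then (if a == b then w' else a :: w) else [:: a].

Lemma push_reduced a w : reduced w -> reduced (push a w).
Proof.
case: w => //= b w; case: eqVneq => [_|ab] wP; last by rewrite /= ab.
exact: path_sorted wP.
Qed.

Lemma pushK a w : reduced w -> push a (push a w) = w.
Proof.
case: w => [|b w] /=; first by rewrite eqxx.
case: eqVneq => [->|ab] wP; last by rewrite /= eqxx.
by case: w wP => //= c w /andP[bc _]; rewrite (negPf bc).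
Qed.

Lemma foldr_push_reduced u w : reduced w -> reduced (foldr push w u).
Proof. by move=> wP; elim: u => //= a u; apply: push_reduced. Qed.

Lemma foldr_push_id w : reduced w -> foldr push [::] w = w.
Proof.
elim: w => //= a w IHw wP; rewrite (IHw (path_sorted wP)).
by case: w wP {IHw} => //= b w /andP[/negPf->].
Qed.

Lemma foldr_pushA u v w : reduced w -> reduced v ->
  foldr push (foldr push w v) u = foldr push w (foldr push v u).
Proof.
move=> wP vP; elim: u => //= a u ->.
have : reduced (foldr push v u) by exact: foldr_push_reduced.
case: (foldr push v u) => //= b x xP; case: eqVneq => // ->.
by rewrite pushK// foldr_push_reduced.
Qed.

Lemma rev_reduced w : reduced w -> reduced (rev w).
Proof. by rewrite /reduced rev_sorted; under eq_sorted do rewrite eq_sym. Qed.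

Lemma foldr_push_rev w : reduced w -> foldr push w (rev w) = [::].
Proof.
elim: w => //= a w IHw wP; rewrite rev_cons -cats1 foldr_cat /= eqxx.
exact: IHw (path_sorted wP).
Qed.

Definition affW_one : affW := @AffW [::] isT.
Definition affW_mul (x y : affW) : affW :=
  AffW (foldr_push_reduced (word x) (word_reduced y)).
Definition affW_inv (x : affW) : affW := AffW (rev_reduced (word_reduced x)).

Lemma affW_mulA : associative affW_mul.
Proof.
move=> x y z; apply: val_inj; rewrite /= foldr_pushA ?word_reduced//.
Qed.
Lemma affW_mul1 : left_id affW_one affW_mul.
Proof. by move=> x; apply: val_inj. Qed.
Lemma affW_mulr1 : right_id affW_one affW_mul.
Proof. by move=> x; apply: val_inj; rewrite /= foldr_push_id ?word_reduced. Qed.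
Lemma affW_mulV : left_inverse affW_one affW_inv affW_mul.
Proof. by move=> x; apply: val_inj; rewrite /= foldr_push_rev ?word_reduced. Qed.
Lemma affW_mulrV : right_inverse affW_one affW_inv affW_mul.
Proof.
move=> x; apply: val_inj; rewrite /= -[X in foldr _ _ X]revK foldr_push_rev//.
exact/rev_reduced/word_reduced.
Qed.

HB.instance Definition _ := isGroup.Build affW
  affW_mulA affW_mul1 affW_mulr1 affW_mulV affW_mulrV.

Definition s0 : affW := @AffW [:: false] isT.
Definition s1 : affW := @AffW [:: true] isT.
Definition ell (w : affW) : nat := size (word w).

Definition reflection (t : affW) : Prop :=
  exists u s : affW, (s = s0 \/ s = s1) /\ t = (u * s * u^-1)%g.

Definition bruhat_step (y w : affW) : Prop :=
  exists t, [/\ reflection t, w = (y * t)%g & (ell y < ell w)%N].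

Definition bruhat : affW -> affW -> Prop := clos_refl_trans affW bruhat_step.

(** * Laurent polynomials and formal series in q^(1/2) *)

Definition laurent_pred : {pred {fraction {poly int}}} :=
  fun a => `[< exists (n : nat) (p : {poly int}), a * 'X%:F ^+ n = p%:F >].

Lemma laurent_subring : subring_closed laurent_pred.
Proof.
split.
- by apply/asboolP; exists 0%N, 1; rewrite expr0 mulr1 rmorph1.
- move=> a b /asboolP[n [p ap]] /asboolP[m [r br]]; apply/asboolP.
  exists (n + m)%N, (p * 'X ^+ m - r * 'X ^+ n).
  rewrite rmorphB !rmorphM !rmorphXn /= -ap -br mulrBl exprD !mulrA.
  by congr (_ - _); rewrite mulrAC.
- move=> a b /asboolP[n [p ap]] /asboolP[m [r br]]; apply/asboolP.
  by exists (n + m)%N, (p * r); rewrite rmorphM /= -ap -br exprD mulrACA.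
Qed.
HB.instance Definition _ :=
  GRing.isSubringClosed.Build {fraction {poly int}} laurent_pred laurent_subring.

(* The ring Z[q^(1/2), q^(-1/2)], with q^(1/2) = 'X. *)
Record laurent := Laurent {
  laurent_val : {fraction {poly int}};
  laurent_valP : laurent_val \in laurent_pred }.
HB.instance Definition _ := [isSub for laurent_val].
HB.instance Definition _ := [Choice of laurent by <:].
HB.instance Definition _ := [SubChoice_isSubComNzRing of laurent by <:].

Lemma qpow_subproof (n : int) : 'X%:F ^ n \in laurent_pred.
Proof.
apply/asboolP; case: n => n.
  by exists 0%N, ('X ^+ n); rewrite mulr1 rmorphXn.
exists n.+1, 1; rewrite NegzE -exprnN mulVf ?rmorph1//.
by rewrite expf_neq0// tofrac_eq0 polyX_eq0.
Qed.

(* [qpow n] is q^(n/2). *)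
Definition qpow (n : int) : laurent := Laurent (qpow_subproof n).

Definition finsupp {I : Type} {V : nmodType} (c : I -> V) : Prop :=
  finite_set [set i | c i != 0].

(* A formal sum f of integer multiples of the q^(n/2), n in Z, is represented
   by its coefficients, f n being that of q^(n/2).  Such an f lies in
   Z((q^(1/2))) (resp. Z((q^(-1/2)))) when f n = 0 for n << 0 (resp. n >> 0). *)
Definition fseries := int -> int.

Definition coefs (a : laurent) : fseries :=
  xget (fun=> 0) [set c : fseries | finsupp c /\
    a = \sum_(k \in [set: int]) qpow k *~ c k].

Definition coefs_poly (p : {poly int}) : fseries :=
  fun n => if n is Posz k then p`_k else 0.

(* As \sum_(k \in _) is 0 on an infinite support, this is used only when one
   factor has finite support. *)
Definition fmul (f g : fseries) : fseries :=
  fun n => \sum_(k \in [set: int]) f k * g (n - k).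

Definition fsum {I : choiceType} (F : I -> fseries) : fseries :=
  fun n => \sum_(i \in [set: I]) F i n.

Definition fbar (f : fseries) : fseries := fun n => f (- n).

(** * The Hecke algebra and the map to the asymptotic Hecke algebra *)

Record is_hecke_algebra (H : algType laurent) (T : affW -> H) : Prop := {
  hecke_span : forall h : H, exists2 c : affW -> laurent,
    finsupp c & h = \sum_(w \in [set: affW]) c w *: T w;
  hecke_free : forall c : affW -> laurent, finsupp c ->
    \sum_(w \in [set: affW]) c w *: T w = 0 -> c = fun=> 0;
  hecke_mul : forall w w' : affW,
    ell (w * w')%g = (ell w + ell w')%N -> T w * T w' = T (w * w')%g;
  hecke_quadratic : forall s : affW, s = s0 \/ s = s1 ->
    (T s + 1) * (T s - qpow 2 *: 1) = 0 }.

Section Hecke.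
Variables (H : algType laurent) (T : affW -> H).

Definition klC (w : affW) : H :=
  \sum_(y \in [set y | bruhat y w])
    ((-1) ^+ (ell w - ell y) * qpow (ell w - ell y)%N%:Z * qpow (- (ell y)%:Z))
      *: T y.

(* The coefficient of T_y in C'_x = q^(-ell(x)/2) \sum_(y <= x) T_y. *)
Definition klC'_coef (x y : affW) : laurent :=
  if `[< bruhat y x >] then qpow (- (ell x)%:Z) else 0.

(* C_x C_y = \sum_z hcoef x y z C_z *)
Definition hcoef (x y : affW) : affW -> laurent :=
  xget (fun=> 0) [set c : affW -> laurent | finsupp c /\
    klC x * klC y = \sum_(z \in [set: affW]) c z *: klC z].

Definition distinguished : seq affW := [:: 1%g; s0; s1].
Definition afun (w : affW) : nat := if w == 1%g then 0 else 1.

(* The coefficient of t_z in phi(C_x). *)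
Definition phi_coef (x z : affW) : laurent :=
  \sum_(d <- distinguished | afun d == afun z) hcoef x d z.

(* The completions of H and of J are both represented by the families of
   coefficients of their elements, b standing for \sum_x b_x C_x and for
   \sum_x b_x t_x respectively. *)
Definition completed (b : affW -> fseries) : Prop :=
  (forall x, exists N : int, forall n : int, n < N -> b x n = 0) /\
  (forall N : nat, (0 < N)%N -> exists L : nat, forall x, (L <= ell x)%N ->
     forall n : int, n < N%:Z -> b x n = 0).

Definition phi_hat (b : affW -> fseries) (z : affW) : fseries :=
  fsum (fun x => fmul (coefs (phi_coef x z)) (b x)).

Definition t_elt (w : affW) : affW -> fseries :=
  fun z n => ((z == w) && (n == 0))%:R.

Definition phi_inv_t (w : affW) : affW -> fseries :=
  xget (fun=> fun=> 0) [set b | completed b /\ phi_hat b = t_elt w].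

(* The coefficient of C'_x in j(phi^-1(t_w)). *)
Definition j_phi_inv_t (w x : affW) : fseries :=
  fun n => (-1) ^+ ell x * fbar (phi_inv_t w x) n.

(* The coefficient b_{w,x} of T_x in j(phi^-1(t_w)), in Z((q^(-1/2))). *)
Definition bseries (w x : affW) : fseries :=
  fsum (fun y => fmul (coefs (klC'_coef y x)) (j_phi_inv_t w y)).

End Hecke.

(* The value at q^(1/2) = v of the rational function whose expansion is b. *)
Definition rational_value (R : realType) (b : fseries) (v : R) : R :=
  xget 0 [set r | exists P Q : {poly int},
    [/\ (map_poly intr Q).[v] != 0,
        fmul (coefs_poly Q) b = coefs_poly P
      & r = (map_poly intr P).[v] / (map_poly intr Q).[v]]].

(** * Local fields and SL_2 *)

(* The field F with the topology defined by val. *)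
Definition valued (F : fieldType) (val : F -> int) : Type := F.

Section Valued.
Variables (F : fieldType) (val : F -> int).

HB.instance Definition _ := GRing.Field.on (valued val).
HB.instance Definition _ := isPointed.Build (valued val) 0.

Definition val_open (A : set (valued val)) : Prop :=
  forall x, A x -> exists n : int,
    forall y, y - x = 0 \/ n <= val (y - x) -> A y.

Lemma val_openT : val_open setT.
Proof. by move=> x _; exists 0. Qed.

Lemma val_openI A B : val_open A -> val_open B -> val_open (A `&` B).
Proof.
move=> oA oB x [/oA[n An] /oB[m Bm]]; exists (Num.max n m) => y [yx|].
  by split; [apply: An|apply: Bm]; left.
by rewrite ge_max => /andP[ny my]; split; [apply: An|apply: Bm]; right.
Qed.

Lemma val_open_bigU (I : Type) (A : I -> set (valued val)) :
  (forall i, val_open (A i)) -> val_open (\bigcup_i A i).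
Proof.
move=> oA x [i _ /oA[n An]]; exists n => y yx; exists i => //; exact: An.
Qed.

HB.instance Definition _ :=
  isOpenTopological.Build (valued val) val_openT val_openI val_open_bigU.

End Valued.

Section LocalField.
Variables (F0 : fieldType) (val : F0 -> int).
Local Notation F := (valued val).

(* The valuation is normalized; its value at 0 is irrelevant.  A field with a
   discrete valuation is complete with finite residue field if and only if it
   is locally compact. *)
Record nonarchimedean_local_field : Prop := {
  valM : forall x y : F, x != 0 -> y != 0 -> val (x * y) = val x + val y;
  valD : forall x y : F, x != 0 -> y != 0 -> x + y != 0 ->
    Num.min (val x) (val y) <= val (x + y);
  val_onto : exists2 x : F, x != 0 & val x = 1;
  val_locally_compact : locally_compact [set: F] }.

Definition ringO : set F := [set x | x = 0 \/ 0 <= val x].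
Definition unitsO : set F := [set x | x != 0 /\ val x = 0].

Definition uniformizer (pi : F) : Prop := pi != 0 /\ val pi = 1.

Variable pi : F.

Definition piO (n : int) : set F := [set pi ^ n * a | a in ringO].
Definition piOunits (n : int) : set F := [set pi ^ n * a | a in unitsO].

Definition residue_card : nat :=
  #|` fset_set [set [set x + y | y in piO 1] | x in ringO]|.

Definition SL2 : set 'M[F]_2 := [set g | \det g = 1].
Definition groupK : set 'M[F]_2 :=
  [set g | SL2 g /\ forall i j, ringO (g i j)].
Definition iwahori : set 'M[F]_2 := [set g | groupK g /\ piO 1 (g 1 0)].

Definition mx2 (a b c d : F) : 'M[F]_2 :=
  \matrix_(i, j) if i == 0 then (if j == 0 then a else b)
                 else (if j == 0 then c else d).

Definition lift_gen (s : bool) : 'M[F]_2 :=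
  if s then mx2 0 pi^-1 (- pi) 0 else mx2 0 (-1) 1 0.

Definition lift_affW (w : affW) : 'M[F]_2 :=
  foldr (fun s g => lift_gen s *m g) 1%:M (word w).

Definition double_coset (w : affW) : set 'M[F]_2 :=
  [set g | exists k k', [/\ iwahori k, iwahori k' & g = k *m lift_affW w *m k']].

(* The Borel sigma-algebra of M_2(F); as SL_2(F) is closed in M_2(F), its
   members contained in SL_2(F) are the Borel subsets of SL_2(F). *)
Definition borelM2 := g_sigma_algebraType (@open 'M[F]_2).

Variable R : realType.

(* The Haar measure of SL_2(F) with vol(I) = 1; only its values on Borel
   subsets of SL_2(F) matter. *)
Definition normalized_haar (mu : {measure set borelM2 -> \bar R}) : Prop :=
  (forall (g : 'M[F]_2) (A : set borelM2), SL2 g -> measurable A -> A `<=` SL2 ->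
     mu [set g *m a | a in A] = mu A) /\
  mu iwahori = 1%E.

(* The function t_w on SL_2(F); each g lies in at most one I x I. *)
Definition t_fun (H : algType laurent) (T : affW -> H) (w : affW)
    (g : 'M[F]_2) : R :=
  \sum_(x \in [set: affW])
    rational_value (R := R) (bseries T w x) (Num.sqrt residue_card%:R)
      * \1_(double_coset x) g.

(** ** Functions on F^2 \ {0} *)

(* A function on F^2 \ {0} is represented by its extension by 0 to F^2. *)
Definition punctured := 'cV[F]_2 -> R[i].

Definition restrict0 (h : 'cV[F]_2 -> R[i]) : punctured :=
  fun x => if x == 0 then 0 else h x.

Definition convol_integrand (f : 'M[F]_2 -> R) (h : punctured) (x : 'cV[F]_2)
    (u : borelM2) : R[i] :=
  (f u)%:C * h (invmx u *m x).

Definition convol_integrable (mu : {measure set borelM2 -> \bar R})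
    (f : 'M[F]_2 -> R) (h : punctured) : Prop :=
  forall x : 'cV[F]_2, x != 0 ->
    mu.-integrable SL2 (EFin \o (fun u => complex.Re (convol_integrand f h x u))) /\
    mu.-integrable SL2 (EFin \o (fun u => complex.Im (convol_integrand f h x u))).

Definition convol (mu : {measure set borelM2 -> \bar R})
    (f : 'M[F]_2 -> R) (h : punctured) : punctured :=
  restrict0 (fun x =>
    Rintegral mu SL2 (fun u => complex.Re (convol_integrand f h x u)) +i*
    Rintegral mu SL2 (fun u => complex.Im (convol_integrand f h x u))).

Definition psi (n : int) : punctured :=
  \1_[set x : 'cV[F]_2 | piOunits n (x 0 0) /\ piO (n + 1) (x 1 0)].
Definition varphi (n : int) : punctured :=
  \1_[set x : 'cV[F]_2 | piO n (x 0 0) /\ piOunits n (x 1 0)].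

(* At each point of F^2 \ {0} the sums below have at most one nonzero term. *)
Definition varphi_bar (n : int) : punctured :=
  fun x => \sum_(k \in [set k : int | n <= k]) (varphi k x + psi k x).
Definition psi_bar (n : int) : punctured :=
  fun x => \sum_(k \in [set k : int | n <= k]) (psi k x + varphi (k + 1) x).

(* C_c^oo(F^2)^U, as a space of functions on F^2 \ {0}. *)
Definition Ccoo_inv (U : set 'M[F]_2) : set punctured :=
  restrict0 @` [set h : 'cV[F]_2 -> R[i] |
    [/\ forall x, \forall y \near x, h y = h x,
        compact (closure [set x | h x != 0])
      & forall k x, U k -> h (k *m x) = h x]].

Definition projector_onto (P : punctured -> punctured) (V W : set punctured) :
    Prop :=
  [/\ W `<=` V,
      forall (a : R[i]) (f g : punctured), V f -> V g ->
        P (fun x => a * f x + g x) = (fun x => a * P f x + P g x),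
      P @` V = W
    & forall f, W f -> P f = f].

End LocalField.

(* Main.v *)
Require Import Defs.
From Stdlib Require Import Relations.Relation_Operators.
From mathcomp Require Import all_boot all_order all_algebra.
From mathcomp Require Import finmap complex.
From mathcomp Require Import all_classical all_reals all_analysis.
From mathcomp Require Import measurable_realfun.
From mathcomp Require Import zify ring lra.

(** Write q for the residue cardinality. An I-invariant function h on F^2 minus the origin amounts to a
function g on the set of I-orbits, which form a chain indexed by the integers: phi_n is supported on
the orbit 2 n and psi_n on the orbit 2 n + 1 ([oidx]). The theorem follows from a formula for the
action of t_(s_0) and t_(s_1) in terms of g. If h has bounded support, let s be the alternating sum
s e = g e - g (e - 1) + g (e - 2) - ..., characterized by s e + s (e - 1) = g e and s e = 0 for e far below
([altsum]). Then

  (t_(s_0) * h) at the orbit e is s e for e even and s (e - 1) for e odd,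
  (t_(s_1) * h) at the orbit e is s e for e odd and s (e - 1) for e even

([project], [convol_profile]). The two values add up to g e, so that t_(s_1) acts as id - t_(s_0). The
first one takes the same value on the orbits 2 n and 2 n + 1, which K exchanges, and it is g e when g
already has this property; so t_(s_0) projects onto the K-invariant functions. Finally phi_bar_m and
psi_bar_m are the indicator functions of e >= 2 m and e >= 2 m + 1 ([varphi_barE], [psi_barE]), for
which s is the indicator function of the e >= n of the same parity as n ([altsum_lattice_ind]).

The formula comes from two computations.

On the algebraic side, the products C_x C_s ([klC_gen_last], [klC_gen_other]) show that phi is a
three-term recursion in the length ([phi_coef_alt]). The completion leaves only one solution, and
phi^-1(t_s) = - \sum_x q^(ell(x)/2) C_x over the x starting with s ([phi_inv_t_gen]). Applying j and
expanding the C'_x leads to geometric series: the coefficient of T_y in t_s is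
(- 1/q)^(ell(y)) / (q + 1), times - q if y starts with s ([bseries_gen], [bseries_value], [tcoefE]).

On the geometric side, the double coset of y = s_a ... of length m is the disjoint union of q^m cosets
w I, where w is a product of matrices n_b(r) s_b with r running over the residues ([double_cosetE],
[reps_disjoint]). Each factor acts on the chain of orbits in a simple way. If the parity of e is
unmatched with b, all the r move the orbit e to e - 1 ([oidx_unmatched]); if it is matched, one r moves
it to e + 1 and the others fix it ([oidx_matched]). In the unmatched case T_y * h is therefore
q^m g (e - m) at e; in the matched case it is a sum J_m e with the recursion
J_(m+1) e = J_m (e + 1) + (q - 1) q^m g (e - m) ([matched_sum], [reps_sum]).

It remains to sum over y. The unmatched y contribute a multiple of \sum_m (-1)^m g (e - m) = s e. For
the matched ones, the recursion bounds the partial sums of (- 1/q)^m J_m e absolutely by a linear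
function of e ([sum_scaled_le]), which gives integrability; and it shows that
Q e = \sum_m (- 1/q)^m J_m e satisfies Q e = g e - Q (e + 1) / q - (1 - 1/q) s e ([lim_scaledS]). The
function s (e - 1) satisfies the same equation, and two solutions of at most linear growth are equal
([lim_scaled]). The Haar measure enters only through the fact that each coset w I has measure 1
([mu_lcoset], [integral_pieces]). *)

Set Implicit Arguments.
Unset Strict Implicit.
Unset Printing Implicit Defensive.

Import Order.TTheory GRing.Theory Num.Theory.

Local Open Scope classical_set_scope.
Local Open Scope ring_scope.

(** * The infinite dihedral group *)

Fixpoint altw (a : bool) (m : nat) : seq bool :=
  if m is n.+1 then a :: altw (~~ a) n else [::].

Lemma altw_reduced a m : reduced (altw a m).
Proof.
rewrite /reduced; elim: m a => // -[|m] // IHm a.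
by move: (IHm (~~ a)); rewrite /= => ->; case: a.
Qed.

Lemma size_altw a m : size (altw a m) = m.
Proof. by elim: m a => //= m IHm a; rewrite IHm. Qed.

(** Every element other than 1 is [alt a m] for exactly one letter a and one m > 0; both letters give
1 when m = 0. *)
Definition alt (a : bool) (m : nat) : affW := AffW (altw_reduced a m).

Definition gen (a : bool) : affW := alt a 1.

Lemma gen_s0 : s0 = gen false. Proof. exact: val_inj. Qed.
Lemma gen_s1 : s1 = gen true. Proof. exact: val_inj. Qed.

Lemma ell_alt a m : ell (alt a m) = m.
Proof. exact: size_altw. Qed.

Lemma alt0 a : alt a 0 = 1%g. Proof. exact: val_inj. Qed.

Lemma reduced_altw w : reduced w -> w = altw (head false w) (size w).
Proof.
elim: w => //= a w IHw aw; congr cons; rewrite {1}(IHw (path_sorted aw)).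
by case: w aw {IHw} => //= b w /andP[+ _]; case: a; case: b.
Qed.

Lemma altE (x : affW) : x = alt (head false (word x)) (ell x).
Proof. by apply: val_inj; rewrite /= -reduced_altw ?word_reduced. Qed.

Lemma affW_case (P : affW -> Prop) :
  P 1%g -> (forall a m, P (alt a m.+1)) -> forall x, P x.
Proof. by move=> P1 Pa x; rewrite (altE x); case: (ell x) => [|m]; rewrite ?alt0. Qed.

Lemma alt_eq a b m n : (alt a m.+1 == alt b n) = (a == b) && (m.+1 == n).
Proof.
apply/eqP/andP => [/(congr1 word)/= E|[/eqP-> /eqP<-]//].
have := congr1 size E; rewrite /= !size_altw => <-.
by split => //; move: E; case: n => //= n [->].
Qed.

Lemma alt_neq1 a m : (alt a m.+1 == 1%g) = false.
Proof. by rewrite -(alt0 a) alt_eq andbF. Qed.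

Lemma one_neq_alt a m : (1%g == alt a m.+1) = false.
Proof. by rewrite eq_sym alt_neq1. Qed.

Lemma mul_altS a m : (alt a m.+1 = gen a * alt (~~ a) m)%g.
Proof. by apply: val_inj => /=; case: m => //= m; case: a. Qed.

Lemma mul_alt_gen a m : (alt a m * gen (a (+) odd m) = alt a m.+1)%g.
Proof.
elim: m a => [|m IHm] a; first by rewrite alt0 mul1g addbF.
rewrite (mul_altS a m) (mul_altS a m.+1) -mulgA -IHm /=.
by congr (_ * (_ * gen _))%g; case: a; case: (odd m).
Qed.

Lemma gen_inv a : ((gen a)^-1 = gen a)%g. Proof. exact: val_inj. Qed.

Lemma ell_eq0 x : ell x = 0 -> x = 1%g.
Proof. by move=> x0; rewrite (altE x) x0 alt0. Qed.

Lemma odd_push a w : odd (size (push a w)) = ~~ odd (size w).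
Proof. by case: w => //= b w; case: eqP; rewrite /= ?negbK. Qed.

Lemma odd_ellM x y : odd (ell (x * y)%g) = odd (ell x) (+) odd (ell y).
Proof.
rewrite /ell /=; elim: (word x) => //= a w IHw.
by rewrite odd_push IHw addNb.
Qed.

Lemma ell_inv x : ell (x^-1)%g = ell x.
Proof. by rewrite /ell /= size_rev. Qed.

Lemma reflectionJ t s : reflection t -> reflection (s * t * s^-1)%g.
Proof.
move=> [u [r [rr ->]]]; exists (s * u)%g, r; split=> //.
by rewrite invgM !mulgA.
Qed.

(** A reduced word of odd length is a palindrome, hence a conjugate of its middle letter. *)
Lemma odd_reflection t : odd (ell t) -> reflection t.
Proof.
rewrite (altE t) ell_alt; move: (head _ _) => a; case: (ell t) => //= n.
move=> n2; rewrite -(odd_double_half n) (negPf n2) add0n.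
elim: {n2} n./2 a => [|k IHk] a.
  exists 1%g, (gen a); rewrite invg1 mulg1 mul1g; split=> //.
  by rewrite gen_s0 gen_s1; case: a; [right|left].
suff -> : alt a (k.+1).*2.+1 = (gen a * alt (~~ a) k.*2.+1 * (gen a)^-1)%g.
  exact: reflectionJ.
rewrite gen_inv -mul_altS -mul_alt_gen; congr (_ * gen _)%g.
by rewrite /= odd_double addbF.
Qed.

Lemma bruhat_step_odd y w :
  (ell y < ell w)%N -> odd (ell y) != odd (ell w) -> bruhat_step y w.
Proof.
move=> yw par; exists (y^-1 * w)%g; split; rewrite ?mulVKg//.
apply: odd_reflection; rewrite odd_ellM ell_inv.
by move: par; case: odd; case: odd.
Qed.

(** Elements whose lengths have different parities differ by a reflection, so the shorter one is
below the longer one; when the parities agree, any element one longer than y lies in between. *)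
Lemma bruhatE y w : bruhat y w <-> y = w \/ (ell y < ell w)%N.
Proof.
split.
  elim=> [a b [t [_ _ ab]]|a|a b c _ [->|ab] _ bc]; [by right|by left|by []|].
  by right; case: bc => [<- //|]; exact: ltn_trans.
move=> [->|yw]; first exact: rt_refl.
have [par|par] := eqVneq (odd (ell y)) (odd (ell w)); last first.
  exact/rt_step/bruhat_step_odd.
apply: (@rt_trans _ _ _ (alt false (ell y).+1)); apply: rt_step.
  by apply: bruhat_step_odd; rewrite ell_alt //=; case: odd.
apply: bruhat_step_odd; rewrite ell_alt /= ?par; last by case: odd.
rewrite ltn_neqAle yw andbT; apply: contraPneq par => <- /=.
by case: odd.
Qed.

Lemma bruhat_alt y a m :
  bruhat y (alt a m) <-> y = alt a m \/ (ell y < m)%N.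
Proof. by rewrite bruhatE ell_alt. Qed.

(** * Coefficients of Laurent polynomials *)

Lemma laurent_val0 : laurent_val 0 = 0. Proof. exact: (raddf0 (\val : laurent -> _)). Qed.
Lemma laurent_val1 : laurent_val 1 = 1. Proof. exact: (rmorph1 (\val : laurent -> _)). Qed.

Lemma laurent_valM a b : laurent_val (a * b) = laurent_val a * laurent_val b.
Proof. exact: (rmorphM (\val : laurent -> _)). Qed.
Lemma laurent_val_int (n : int) : laurent_val n%:~R = n%:~R.
Proof. exact: (rmorph_int (\val : laurent -> _)). Qed.
Lemma laurent_val_sum (I : Type) (r : seq I) (f : I -> laurent) :
  laurent_val (\sum_(i <- r) f i) = \sum_(i <- r) laurent_val (f i).
Proof. exact: (raddf_sum (\val : laurent -> _)). Qed.

Lemma tofracX_neq0 : FracField.tofrac ('X : {poly int}) != 0.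
Proof. by rewrite tofrac_eq0 polyX_eq0. Qed.

Lemma qpow0 : qpow 0 = 1.
Proof. by apply: val_inj; rewrite [RHS]laurent_val1 /= expr0z. Qed.

Lemma qpowD m n : qpow (m + n) = qpow m * qpow n.
Proof.
apply: val_inj; rewrite [RHS]laurent_valM /=.
by rewrite expfzDr// tofracX_neq0.
Qed.

Lemma qpowNK n : qpow (- n) * qpow n = 1.
Proof. by rewrite -qpowD addNr qpow0. Qed.

Definition window (N : nat) : seq int := [seq i%:Z - N%:Z | i <- iota 0 N.*2.+1].

Lemma window_uniq N : uniq (window N).
Proof. by rewrite map_inj_uniq ?iota_uniq// => i j; lia. Qed.

Lemma mem_window N k : (k \in window N) = (`|k| <= N)%N.
Proof.
apply/mapP/idP => [[j]|kN]; first by rewrite mem_iota; lia.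
by exists (absz (k + N%:Z)); rewrite ?mem_iota; lia.
Qed.

Lemma fsbigT_seq (I : choiceType) (V : nmodType) (r : seq I) (f : I -> V) :
  uniq r -> (forall i, i \notin r -> f i = 0) ->
  \sum_(i \in [set: I]) f i = \sum_(i <- r) f i.
Proof.
move=> ur fr; rewrite (fsbigE r)//; last by move=> i _; exact: fr.
by apply: eq_bigl => i; rewrite in_setT.
Qed.

Lemma fsbig_window (V : nmodType) (f : int -> V) (N : nat) :
  (forall k, (N < `|k|)%N -> f k = 0) ->
  \sum_(k \in [set: int]) f k = \sum_(k <- window N) f k.
Proof.
move=> fN; apply: fsbigT_seq; first exact: window_uniq.
by move=> k; rewrite mem_window -ltnNge => /fN.
Qed.

Lemma finsupp_window (V : nmodType) (c : int -> V) : Defs.finsupp c ->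
  exists N, forall k, (N < `|k|)%N -> c k = 0.
Proof.
move=> /finite_fsetP[A cA]; exists (\max_(k <- A) `|k|)%N => k kN.
apply: contraTeq kN => ck; rewrite -leqNgt.
have kA : k \in A by have : [set` A] k by rewrite -cA.
by rewrite (big_rem k)//= leq_maxl.
Qed.

(** Multiplying by a large power of q^(1/2) turns the sum into a polynomial. *)
Lemma laurent_sum_eq0 (c : fseries) : Defs.finsupp c ->
  \sum_(k \in [set: int]) qpow k *~ c k = 0 -> c = fun=> 0.
Proof.
move=> /finsupp_window[N cN]; rewrite (@fsbig_window _ _ N); last first.
  by move=> k /cN->; rewrite mulr0z.
rewrite big_map -[iota _ _]/(index_iota 0 N.*2.+1) big_mkord.
move=> /(congr1 (fun a => laurent_val (qpow N%:Z * a))).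
rewrite mulr0 laurent_val0 mulr_sumr laurent_val_sum.
rewrite (eq_bigr (fun i : 'I_N.*2.+1 =>
   FracField.tofrac ((c (i%:Z - N%:Z))%:P * 'X^i))); last first.
  move=> i _; rewrite -mulrzr mulrA -qpowD addrC subrK.
  rewrite laurent_valM laurent_val_int /=.
  rewrite mulrC [RHS]rmorphM rmorphXn /=; congr (_ * _).
  by rewrite -[in RHS](intz (c _)) !rmorph_int.
rewrite -raddf_sum /= => /eqP; rewrite tofrac_eq0.
under eq_bigr do rewrite mul_polyC.
rewrite -(@poly_def _ _ (fun i : nat => c (i%:Z - N%:Z))) => /eqP p0.
apply/funext => k; have [/cN//|kN] := ltnP N `|k|%N.
have := congr1 (fun p : {poly int} => p`_((absz (k + N%:Z)))) p0.
rewrite coef_poly coef0 ifT; last lia.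
by rewrite (_ : _ - _ = k) //; lia.
Qed.

Lemma coefsE (c : fseries) (a : laurent) : Defs.finsupp c ->
  a = \sum_(k \in [set: int]) qpow k *~ c k -> coefs a = c.
Proof.
move=> cfin ac; apply: xget_unique => // d [dfin ad].
have [N cN] := finsupp_window cfin; have [M dM] := finsupp_window dfin.
have dc k : (maxn N M < `|k|)%N -> d k - c k = 0.
  by rewrite gtn_max => /andP[/cN-> /dM->]; rewrite subrr.
suff /(congr1 (fun h => h _)) dc0 : (fun k => d k - c k) = fun=> 0.
  by apply/funext => k; apply/eqP; rewrite -subr_eq0 dc0.
apply: laurent_sum_eq0.
  apply: (@sub_finite_set _ _ [set` window (maxn N M)]); last exact: finite_seq.
  move=> k /= kdc; rewrite mem_window leqNgt.
  by apply: contraNN kdc => /dc->.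
rewrite (@fsbig_window _ _ (maxn N M)); last by move=> k /dc->; rewrite mulr0z.
under eq_bigr do rewrite mulrzBr.
rewrite sumrB; move: ad; rewrite {1}ac.
rewrite (@fsbig_window _ _ (maxn N M)); last first.
  by move=> k; rewrite gtn_max => /andP[/cN-> _]; rewrite mulr0z.
rewrite (@fsbig_window _ _ (maxn N M)); last first.
  by move=> k; rewrite gtn_max => /andP[_ /dM->]; rewrite mulr0z.
by move=> ->; rewrite subrr.
Qed.

Definition monomial (n : int) : fseries := fun k => (k == n)%:R.

Lemma finsupp_seq (I : choiceType) (V : nmodType) (c : I -> V) (r : seq I) :
  (forall i, i \notin r -> c i = 0) -> Defs.finsupp c.
Proof.
move=> cr; apply: (@sub_finite_set _ _ [set` r]); last exact: finite_seq.
by move=> i /= ci; apply: contraNT ci => /cr->.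
Qed.

Lemma coefs_qpow n : coefs (qpow n) = monomial n.
Proof.
apply: coefsE.
  by apply: (@finsupp_seq _ _ _ [:: n]) => i; rewrite inE /monomial => /negPf->.
rewrite (@fsbigT_seq _ _ [:: n])//= ?big_seq1 /monomial ?eqxx//.
by move=> k; rewrite inE => /negPf->.
Qed.

Lemma coefs0 : coefs 0 = fun=> 0.
Proof.
apply: coefsE; first exact: (@finsupp_seq _ _ _ [::]).
by rewrite fsbig1// => k _; rewrite mulr0z.
Qed.

Lemma coefs1 : coefs 1 = monomial 0.
Proof. by rewrite -qpow0 coefs_qpow. Qed.

Lemma coefs_qnumber :
  coefs (- (qpow 1 + qpow (- 1))) = fun k => - (monomial 1 k + monomial (- 1) k).
Proof.
apply: coefsE.
  apply: (@finsupp_seq int int _ [:: 1; -1]) => i.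
  rewrite !inE negb_or /monomial => /andP[/negPf-> /negPf->].
  by rewrite addr0 oppr0.
rewrite (@fsbigT_seq int _ [:: 1; -1])//=.
  by rewrite !big_cons big_nil /monomial !eqxx /= !addr0 add0r opprD !mulrNz mulr1z.
move=> k; rewrite !inE negb_or /monomial => /andP[/negPf-> /negPf->].
by rewrite addr0 oppr0 mulr0z.
Qed.

Lemma fmul0 f : fmul (fun=> 0) f = fun=> 0.
Proof. by apply/funext => n; rewrite /fmul fsbig1// => k _; rewrite mul0r. Qed.

Lemma fmul_monomial m f n : fmul (monomial m) f n = f (n - m).
Proof.
rewrite /fmul (@fsbigT_seq _ _ [:: m])//= ?big_seq1 /monomial ?eqxx ?mul1r//.
by move=> k; rewrite inE => /negPf->; rewrite mul0r.
Qed.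

Lemma fmul_qnumber f n :
  fmul (fun k => - (monomial 1 k + monomial (- 1) k)) f n
  = - (f (n - 1) + f (n + 1)).
Proof.
rewrite /fmul (@fsbigT_seq int _ [:: 1; -1])//=.
  rewrite !big_cons big_nil /monomial !eqxx /= !addr0 add0r !mulN1r opprK opprD.
  by [].
move=> k; rewrite !inE negb_or /monomial => /andP[/negPf-> /negPf->].
by rewrite addr0 oppr0 mul0r.
Qed.

(** * Identities between linear combinations *)

(** Identities between linear combinations of vectors in a module are reduced by reflection to
equalities of coefficients, which are left to [ring]. *)
Inductive lexp (A : Type) :=
  | LVar of nat | LZero | LOpp of lexp A | LAdd of lexp A & lexp A
  | LScale of A & lexp A.
Arguments LVar {A}.
Arguments LZero {A}.

Section LinearCombinations.
Variables (A : pzRingType) (V : lmodType A).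
Implicit Types (x y : lexp A) (env : seq V).

Fixpoint lden env x : V :=
  match x with
  | LVar i => env`_i | LZero => 0 | LOpp x => - lden env x
  | LAdd x y => lden env x + lden env y | LScale a x => a *: lden env x
  end.

Fixpoint lcoef x (i : nat) : A :=
  match x with
  | LVar j => if Nat.eqb i j then 1 else 0 | LZero => 0 | LOpp x => - lcoef x i
  | LAdd x y => lcoef x i + lcoef y i | LScale a x => a * lcoef x i
  end.

Lemma lden_sum env x : lden env x = \sum_(i < size env) lcoef x i *: env`_i.
Proof.
elim: x => [j||x IHx|x IHx y IHy|a x IHx] /=.
- have [jn|nj] := ltnP j (size env).
    rewrite (bigD1 (Ordinal jn)) //= big1 => [|i].
      by rewrite PeanoNat.Nat.eqb_refl scale1r addr0.
    rewrite -val_eqE /= => ij.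
    case: PeanoNat.Nat.eqb_spec ij => [->|_]; first by rewrite eqxx.
    by rewrite scale0r.
  rewrite nth_default // big1 // => i _.
  case: PeanoNat.Nat.eqb_spec (ltn_ord i) => [->|_]; first by rewrite ltnNge nj.
  by rewrite scale0r.
- by rewrite big1 // => i _; rewrite scale0r.
- by rewrite IHx -sumrN; apply: eq_bigr => i _; rewrite scaleNr.
- by rewrite IHx IHy -big_split; apply: eq_bigr => i _; rewrite scalerDl.
- by rewrite IHx scaler_sumr; apply: eq_bigr => i _; rewrite scalerA.
Qed.

Fixpoint same_coefs n x y : Prop :=
  if n is m.+1 then lcoef x m = lcoef y m /\ same_coefs m x y else True.

Lemma lden_eq env x y : same_coefs (size env) x y -> lden env x = lden env y.
Proof.
rewrite !lden_sum => xy; apply: eq_bigr => i _; congr (_ *: _).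
elim: (size env) xy i => [|n IHn] /=; first by move=> _ [].
move=> [xyn /IHn{}IHn] i; have := ltn_ord i; rewrite ltnS leq_eqVlt.
by case/orP=> [/eqP->//|im]; exact: (IHn (Ordinal im)).
Qed.

End LinearCombinations.

(* Atoms are compared up to conversion, as the same vector occurs under several algebraic structures. *)
Ltac lfind x env :=
  match env with
  | cons ?y _ => let _ := match constr:(Set) with _ => unify x y end in constr:(O)
  | cons _ ?e => let n := lfind x e in constr:(S n)
  end.
Ltac lreify A env t :=
  lazymatch t with
  | (?a + ?b)%R => let x := lreify A env a in let y := lreify A env b in
                   constr:(@LAdd A x y)
  | (- ?a)%R => let x := lreify A env a in constr:(@LOpp A x)
  | (?a *: ?b)%R => let x := lreify A env b in constr:(@LScale A a x)
  | 0%R => constr:(@LZero A)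
  | _ => let n := lfind t env in constr:(@LVar A n)
  end.
Ltac lmodule A V env :=
  lazymatch goal with |- ?l = ?r =>
    let x := lreify A env l in let y := lreify A env r in
    change (@lden A V env x = @lden A V env y); apply: lden_eq; cbn -[GRing.add GRing.mul GRing.opp GRing.zero GRing.one]
  end.

(** * Products of Kazhdan-Lusztig basis elements *)

Section Hecke.
Variables (H : algType laurent) (T : affW -> H) (HT : is_hecke_algebra T).

Local Notation C := (klC T).

(** T_1 acts as a left identity on the T_w, which span. *)
Lemma hecke_T1 : T 1%g = 1.
Proof.
have T1T w : T 1%g * T w = T w by rewrite (hecke_mul HT) !mul1g.
have [c _ E] := hecke_span HT 1.
rewrite -[LHS]mulr1 {1}E [RHS]E mulr_sumr; apply: eq_bigr => w _.
by rewrite -scalerAr T1T.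
Qed.

(** Fixing the letter c on the right, [alt (starter c k) k] is the element of length k that does not
end in c, and [alt (starter c k) k.+1] is its product by c. *)
Definition starter (c : bool) k := c (+) odd k.

Lemma T_mul_asc c k :
  T (alt (starter c k) k) * T (gen c) = T (alt (starter c k) k.+1).
Proof.
have E : (alt (starter c k) k * gen c)%g = alt (starter c k) k.+1.
  by rewrite -mul_alt_gen /starter -addbA addbb addbF.
by rewrite (hecke_mul HT) E // !ell_alt addn1.
Qed.

Lemma T_sqr c : T (gen c) * T (gen c) = (qpow 2 - 1) *: T (gen c) + qpow 2 *: 1.
Proof.
have := hecke_quadratic HT (s := gen c).
rewrite gen_s0 gen_s1 => /(_ (if c as b return gen b = _ \/ gen b = _ then or_intror erefl else or_introl erefl)).
rewrite mulrDl mul1r mulrBr -scalerAr mulr1 => E.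
apply/eqP; rewrite -subr_eq0 -E; apply/eqP.
lmodule laurent H [:: T (gen c) * T (gen c); T (gen c); 1].
by repeat split; ring.
Qed.

Lemma T_mul_desc c k :
  T (alt (starter c k) k.+1) * T (gen c)
  = (qpow 2 - 1) *: T (alt (starter c k) k.+1) + qpow 2 *: T (alt (starter c k) k).
Proof.
by rewrite -{1}T_mul_asc -mulrA T_sqr mulrDr -!scalerAr mulr1 T_mul_asc.
Qed.

(** The part of C_w coming from the elements shorter than w, which depends only on the length n of w:
passing from n to n + 1 multiplies it by - q^(1/2) and adds the two elements of length n. *)
Fixpoint klX (n : nat) : H :=
  match n with
  | 0 => 0
  | 1 => - (qpow 1 *: 1)
  | (k.+1 as n').+1 => - (qpow 1 *: klX n')
      - qpow (- k%:Z) *: (T (alt false n') + T (alt true n'))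
  end.

Fixpoint shorter (n : nat) : seq affW :=
  match n with
  | 0 => [::] | 1 => [:: 1%g]
  | (_.+1 as n').+1 => [:: alt false n', alt true n' & shorter n']
  end.

Lemma mem_shorter n y : (y \in shorter n) = (ell y < n)%N.
Proof.
elim: n => [//|[|n] IHn].
  by rewrite inE; apply/eqP/idP => [->//|]; rewrite ltnS leqn0 => /eqP/ell_eq0.
rewrite /= !inE -/(shorter n.+1) IHn [RHS]ltnS [RHS]leq_eqVlt orbA; congr (_ || _).
apply/idP/idP => [/orP[]/eqP->|/eqP yn]; rewrite ?ell_alt //.
by rewrite (altE y) yn; case: head; rewrite eqxx ?orbT.
Qed.

Lemma shorter_uniq n : uniq (shorter n).
Proof.
elim: n => [|[|n] IHn] //=; rewrite -/(shorter n.+1) IHn !inE !mem_shorter.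
by rewrite !ell_alt !ltnn alt_eq.
Qed.

Definition klterm (n : nat) (y : affW) : H :=
  ((-1) ^+ (n - ell y) * qpow (n - ell y)%N%:Z * qpow (- (ell y)%:Z)) *: T y.

Lemma sum_klterm n : \sum_(y <- shorter n) klterm n y = klX n.
Proof.
elim: n => [|[|n] IHn]; first by rewrite big_nil.
  rewrite big_seq1 /klterm hecke_T1 /= expr1 oppr0 qpow0 mulr1 mulN1r.
  by rewrite scaleNr.
rewrite [shorter _]/= !big_cons -/(shorter n.+1) [RHS]/= -/(klX n.+1) -IHn.
have layer b : klterm n.+2 (alt b n.+1) = - (qpow (- n%:Z) *: T (alt b n.+1)).
  rewrite /klterm ell_alt subSnn expr1 mulN1r mulNr scaleNr -qpowD.
  by congr (- (qpow _ *: _)); lia.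
have -> : \sum_(y <- shorter n.+1) klterm n.+2 y
    = - (qpow 1 *: \sum_(y <- shorter n.+1) klterm n.+1 y).
  rewrite scaler_sumr -sumrN big_seq [RHS]big_seq; apply: eq_bigr => y.
  rewrite mem_shorter => yn; rewrite /klterm scalerA -scaleNr; congr (_ *: _).
  rewrite subSn; last lia.
  have -> : (n.+1 - ell y).+1%:Z = (n.+1 - ell y)%N%:Z + 1 by lia.
  by rewrite exprS qpowD; ring.
rewrite !layer; set S := \sum_(y <- _) _.
lmodule laurent H [:: T (alt false n.+1); T (alt true n.+1); S].
by repeat split; ring.
Qed.

Lemma klC_alt a n : C (alt a n.+1) = qpow (- n.+1%:Z) *: T (alt a n.+1) + klX n.+1.
Proof.
rewrite /klC; transitivity (\sum_(y <- alt a n.+1 :: shorter n.+1) klterm n.+1 y).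
  rewrite [RHS]fsbig_seq; last by rewrite cons_uniq shorter_uniq mem_shorter ell_alt ltnn.
  rewrite ell_alt; apply: eq_fsbigl; apply/seteqP; split=> y; rewrite -[[set` _] y]/(is_true (y \in _ :: _)).
    by move/bruhat_alt; rewrite inE mem_shorter => -[->|->]; rewrite ?eqxx ?orbT.
  by rewrite inE mem_shorter => /orP[/eqP->|?]; apply/bruhat_alt; [left|right].
rewrite big_cons sum_klterm; congr (_ + _).
by rewrite /klterm ell_alt subnn expr0 mul1r qpow0 mul1r.
Qed.

Lemma klC1 : C 1%g = 1.
Proof.
rewrite /klC (_ : [set y | _] = [set` [:: 1%g]]).
  by rewrite -fsbig_seq// big_seq1 hecke_T1 expr0 mul1r !oppr0 !qpow0 mulr1 scale1r.
apply/seteqP; split=> y /=; first by case/bruhatE=> [->|//]; rewrite inE.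
by rewrite inE => /eqP->; apply/bruhatE; left.
Qed.

Lemma klC_gen c : C (gen c) = qpow (- 1) *: T (gen c) - qpow 1 *: 1.
Proof. by rewrite klC_alt. Qed.

Let q_inv : qpow (- 1) * qpow 1 = 1 := qpowNK 1.

Lemma qpow2 : qpow 2 = qpow 1 * qpow 1.
Proof. by rewrite -qpowD. Qed.

Lemma T_C_asc c k : T (alt (starter c k) k) * C (gen c)
  = qpow (- 1) *: T (alt (starter c k) k.+1) - qpow 1 *: T (alt (starter c k) k).
Proof. by rewrite klC_gen mulrBr -!scalerAr mulr1 T_mul_asc. Qed.

Lemma T_C_desc c k : T (alt (starter c k) k.+1) * C (gen c)
  = - (qpow (- 1) *: T (alt (starter c k) k.+1)) + qpow 1 *: T (alt (starter c k) k).
Proof.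
rewrite klC_gen mulrBr -!scalerAr mulr1 T_mul_desc qpow2.
lmodule laurent H [:: T (alt (starter c k) k.+1); T (alt (starter c k) k)].
by repeat split; ring: q_inv.
Qed.

Lemma klXS c k : klX k.+2 = - (qpow 1 *: klX k.+1) - qpow (- k%:Z) *:
  (T (alt (starter c k) k.+1) + T (alt (starter c k.+1) k.+1)).
Proof.
transitivity (- (qpow 1 *: klX k.+1) - qpow (- k%:Z) *:
  (T (alt false k.+1) + T (alt true k.+1))) => //.
rewrite /starter; congr (_ - _ *: _).
by rewrite [odd k.+1]/=; case: c; case: (odd k) => //; rewrite addrC.
Qed.

Lemma klX1_C c : klX 1 * C (gen c) = - (qpow 1 *: klX 1) - T (gen c).
Proof.
rewrite /= mulNr -scalerAl mul1r klC_gen.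
lmodule laurent H [:: T (gen c); 1].
by repeat split; ring: q_inv.
Qed.

Lemma qpowS k : qpow (- k.+1%:Z) = qpow (- 1) * qpow (- k%:Z).
Proof. by rewrite -qpowD; congr qpow; lia. Qed.

(** The recursion for [klX] propagates this formula from one length to the next; with the formulas for
the products T_w C_s it gives all the products C_w C_s. *)
Lemma klX_C c k : klX k.+2 * C (gen c) = - (qpow 1 *: klX k.+2)
  - qpow (- k.+1%:Z) *: T (alt (starter c k.+1) k.+2)
  + qpow (- k.+1%:Z) *: T (alt (starter c k) k.+1) + klX k.+1.
Proof.
elim: k => [|k IHk].
  rewrite (klXS c) mulrBl mulNr -!scalerAl klX1_C mulrDl T_C_asc T_C_desc.
  rewrite qpowS oppr0 qpow0 mulr1 alt0 hecke_T1.
  have -> : alt (starter c 0) 1 = gen c by rewrite /starter addbF.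
  have -> : klX 1 = - (qpow 1 *: 1) by [].
  lmodule laurent H [:: T (gen c); T (alt (starter c 1) 1); T (alt (starter c 1) 2); 1].
  by repeat split; ring: q_inv.
rewrite (klXS c k.+1) mulrBl mulNr -!scalerAl IHk mulrDl T_C_asc T_C_desc.
rewrite [in X in _ = _ + X](klXS c k).
rewrite (qpowS k.+1) (qpowS k).
lmodule laurent H [:: T (alt (starter c k.+2) k.+3); T (alt (starter c k.+2) k.+2);
  T (alt (starter c k.+1) k.+2); T (alt (starter c k.+1) k.+1);
  T (alt (starter c k) k.+1); klX k.+2; klX k.+1].
repeat split; ring: q_inv.
Qed.

Lemma klC_C_desc c n : C (alt (starter c n) n.+1) * C (gen c)
  = - (qpow 1 + qpow (- 1)) *: C (alt (starter c n) n.+1).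
Proof.
rewrite klC_alt mulrDl -scalerAl T_C_desc; case: n => [|k].
  have -> : alt (starter c 0) 1 = gen c by rewrite /starter addbF.
  rewrite klX1_C alt0 hecke_T1 [klX 1]/=.
  lmodule laurent H [:: T (gen c); 1].
  by repeat split; ring: q_inv.
rewrite klX_C (klXS c) (qpowS k.+1) (qpowS k).
lmodule laurent H [:: T (alt (starter c k.+1) k.+2); T (alt (starter c k) k.+1);
  T (alt (starter c k.+1) k.+1); klX k.+1].
by repeat split; ring: q_inv.
Qed.

Lemma klC_C_asc c n : C (alt (starter c n.+1) n.+1) * C (gen c)
  = C (alt (starter c n.+1) n.+2) + (n != 0)%:R *: C (alt (starter c n.+1) n).
Proof.
rewrite klC_alt mulrDl -scalerAl T_C_asc; case: n => [|k].
  rewrite scale0r addr0 klX1_C klC_alt (klXS c) (qpowS 1) oppr0 qpow0.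
  have -> : alt (starter c 0) 1 = gen c by rewrite /starter addbF.
  lmodule laurent H [:: T (alt (starter c 1) 2); T (alt (starter c 1) 1); T (gen c); klX 1].
  by repeat split; ring: q_inv.
rewrite scale1r klX_C !klC_alt (klXS c k.+1) (qpowS k.+2) (qpowS k.+1) (qpowS k).
have -> : starter c k.+2 = starter c k by rewrite /starter /= negbK.
lmodule laurent H [:: T (alt (starter c k) k.+3); T (alt (starter c k) k.+2);
  T (alt (starter c k.+1) k.+2); T (alt (starter c k) k.+1); klX k.+2; klX k.+1].
by repeat split; ring: q_inv.
Qed.

Lemma klC_gen_last a n : C (alt a n.+1) * C (gen (a (+) odd n))
  = - (qpow 1 + qpow (- 1)) *: C (alt a n.+1).
Proof.
have := klC_C_desc (a (+) odd n) n.
by rewrite /starter -addbA addbb addbF.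
Qed.

Lemma klC_gen_other a n : C (alt a n.+1) * C (gen (~~ (a (+) odd n)))
  = C (alt a n.+2) + (n != 0)%:R *: C (alt a n).
Proof.
have := klC_C_asc (~~ (a (+) odd n)) n.
by rewrite /starter /= addNb addbN negbK -addbA addbb addbF.
Qed.

Lemma klC_shorter N z : (ell z < N)%N -> C z = \sum_(y <- shorter N)
  (if `[< bruhat y z >] then (-1) ^+ (ell z - ell y) * qpow (ell z - ell y)%N%:Z
     * qpow (- (ell y)%:Z) else 0) *: T y.
Proof.
move=> zN; rewrite /klC fsbig_mkcond (fsbigT_seq (shorter_uniq N)) /patch.
  apply: eq_bigr => y _; have [yz|yz] := asboolP (bruhat y z).
    by rewrite mem_set.
  by rewrite memNset // scale0r.
move=> y; rewrite mem_shorter -leqNgt => Ny.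
rewrite memNset // => /bruhatE[yz|yz]; first by rewrite yz leqNgt zN in Ny.
by have := leq_trans zN (leq_trans Ny (ltnW yz)); rewrite ltnn.
Qed.

Lemma qpow_lreg n a : a * qpow n = 0 -> a = 0.
Proof.
move=> /(congr1 (fun b => b * qpow (- n))).
by rewrite mul0r -mulrA -qpowD subrr qpow0 mulr1.
Qed.

(** The C_z are triangular in the T_y with invertible diagonal coefficients. *)
Lemma klC_free (c : affW -> laurent) : Defs.finsupp c ->
  \sum_(z \in [set: affW]) c z *: C z = 0 -> c = fun=> 0.
Proof.
move=> /finite_fsetP[A cA].
pose N := (\max_(z <- A) ell z).+1.
have cN z : (N <= ell z)%N -> c z = 0.
  move=> Nz; apply: contraTeq Nz => cz; rewrite -ltnNge ltnS.
  have zA : z \in A by have : [set` A] z by rewrite -cA.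
  by rewrite (big_rem z)//= leq_maxl.
rewrite (fsbigT_seq (shorter_uniq N)); last first.
  by move=> z; rewrite mem_shorter -leqNgt => /cN->; rewrite scale0r.
pose k z y := if `[< bruhat y z >] then (-1) ^+ (ell z - ell y)
  * qpow (ell z - ell y)%N%:Z * qpow (- (ell y)%:Z) else 0.
pose d y := if y \in shorter N then \sum_(z <- shorter N) c z * k z y else 0.
move=> E; have d0 : d = fun=> 0.
  apply: (hecke_free HT).
    by apply: (@finsupp_seq _ _ _ (shorter N)) => y; rewrite /d => /negPf->.
  rewrite (fsbigT_seq (shorter_uniq N)); last first.
    by move=> y; rewrite /d => /negPf->; rewrite scale0r.
  rewrite -[RHS]E big_seq [RHS]big_seq.
  under eq_bigr => y yN do rewrite /d yN scaler_suml big_seq.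
  rewrite exchange_big /=; apply: eq_bigr => z zN.
  rewrite (@klC_shorter N) ?mem_shorter -?mem_shorter // scaler_sumr [RHS]big_seq.
  by apply: eq_bigr => y _; rewrite scalerA.
apply/funext => z; have [m Nm] := ubnP (N - ell z).
elim: m z Nm => // m IHm z Nm.
have [zN|/cN//] := ltnP (ell z) N.
have := congr1 (fun f => f z) d0; rewrite /d mem_shorter zN.
rewrite (bigD1_seq z) ?mem_shorter ?shorter_uniq //= big1_seq => [|y /andP[yz _]].
  rewrite addr0 /k ifT; last by apply/asboolP/bruhatE; left.
  by rewrite subnn expr0 mul1r qpow0 mul1r => /qpow_lreg.
rewrite /k; case: asboolP => [/bruhatE[zy|zy]|]; last by rewrite mulr0.
  by rewrite zy eqxx in yz.
have [yN|Ny] := ltnP (ell y) N; last by rewrite cN ?mul0r.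
by rewrite IHm ?mul0r //; lia.
Qed.

Lemma hcoefE x y (c : affW -> laurent) : Defs.finsupp c ->
  C x * C y = \sum_(z \in [set: affW]) c z *: C z -> hcoef T x y = c.
Proof.
move=> cf E; apply: xget_unique => // d [df E'].
apply/funext => z; apply/eqP; rewrite -subr_eq0; apply/eqP.
have [A dA] := finite_fsetP.1 df; have [B cB] := finite_fsetP.1 cf.
pose r := undup (A ++ B).
have d0 i : i \notin r -> d i = 0.
  rewrite mem_undup mem_cat negb_or => /andP[iA _]; apply: contraNeq iA => di.
  by have : [set` A] i by rewrite -dA.
have c0 i : i \notin r -> c i = 0.
  rewrite mem_undup mem_cat negb_or => /andP[_ iA]; apply: contraNeq iA => di.
  by have : [set` B] i by rewrite -cB.
suff /(congr1 (fun f => f z)) : (fun i => d i - c i) = fun=> 0 by [].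
apply: klC_free.
  by apply: (@finsupp_seq _ _ _ r) => i ir; rewrite d0 // c0 // subr0.
have ur : uniq r by exact: undup_uniq.
rewrite (fsbigT_seq ur); last by move=> i ir; rewrite d0 // c0 // subr0 scale0r.
under eq_bigr do rewrite scalerBl; rewrite sumrB.
move: E'; rewrite E (fsbigT_seq ur); last by move=> i ir; rewrite c0 // scale0r.
rewrite (fsbigT_seq ur); last by move=> i ir; rewrite d0 // scale0r.
by move=> ->; rewrite subrr.
Qed.

Lemma hcoef2 x y (a b : laurent) (z w : affW) :
  C x * C y = a *: C z + b *: C w ->
  hcoef T x y = fun u => (u == z)%:R * a + (u == w)%:R * b.
Proof.
move=> E; apply: hcoefE.
  apply: (@finsupp_seq _ _ _ [:: z; w]) => u.
  by rewrite !inE negb_or => /andP[/negPf-> /negPf->]; rewrite !mul0r addr0.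
rewrite (fsbigT_seq (undup_uniq [:: z; w])); last first.
  move=> u; rewrite mem_undup !inE negb_or => /andP[/negPf-> /negPf->].
  by rewrite !mul0r addr0 scale0r.
rewrite E /= inE; case: eqVneq => [->|zw].
  by rewrite big_seq1 eqxx !mul1r scalerDl.
rewrite !big_cons big_nil addr0 !eqxx (negPf zw) eq_sym (negPf zw).
by rewrite !mul0r !mul1r add0r addr0.
Qed.

Lemma hcoef_1l y : hcoef T 1%g y = fun u => (u == y)%:R.
Proof.
rewrite (@hcoef2 _ _ 1 0 y y); first by apply/funext => u; rewrite mulr0 mulr1 addr0.
by rewrite klC1 mul1r scale1r scale0r addr0.
Qed.

Lemma hcoef_1r x : hcoef T x 1%g = fun u => (u == x)%:R.
Proof.
rewrite (@hcoef2 _ _ 1 0 x x); first by apply/funext => u; rewrite mulr0 mulr1 addr0.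
by rewrite klC1 mulr1 scale1r scale0r addr0.
Qed.

Lemma phi_coef1 x : phi_coef T x 1%g = (x == 1%g)%:R.
Proof.
rewrite /phi_coef /distinguished gen_s0 gen_s1 !big_cons big_nil /afun !alt_neq1.
by rewrite eqxx /= addr0 hcoef_1r eq_sym.
Qed.

(** For each first letter a, the matrix of phi is tridiagonal in the length. *)
Lemma phi_coef_alt x a k : phi_coef T x (alt a k.+1) =
  (x == alt a k)%:R + (x == alt a k.+2)%:R
  - (x == alt a k.+1)%:R * (qpow 1 + qpow (- 1)).
Proof.
rewrite /phi_coef /distinguished gen_s0 gen_s1 !big_cons big_nil /afun !alt_neq1.
rewrite eqxx /= addr0.
elim/affW_case: x => [|b n].
  rewrite !hcoef_1l !alt_eq !one_neq_alt.
  case: k => [|k]; last by rewrite one_neq_alt !andbF addr0 mul0r oppr0 !addr0.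
  by rewrite alt0 eqxx; case: a; rewrite /= mul0r !addr0 ?add0r subr0.
set l := b (+) odd n.
have -> : hcoef T (alt b n.+1) (gen false) (alt a k.+1)
    + hcoef T (alt b n.+1) (gen true) (alt a k.+1)
    = hcoef T (alt b n.+1) (gen l) (alt a k.+1)
    + hcoef T (alt b n.+1) (gen (~~ l)) (alt a k.+1).
  by case: l => //=; rewrite addrC.
rewrite (@hcoef2 _ _ (- (qpow 1 + qpow (- 1))) 0 (alt b n.+1) 1%g); last first.
  by rewrite klC_gen_last scale0r addr0.
rewrite (@hcoef2 _ _ 1 (n != 0)%:R (alt b n.+2) (alt b n)); last first.
  by rewrite klC_gen_other scale1r.
rewrite mulr0 addr0 mulr1 !alt_eq !eqSS [b == a]eq_sym [n == k]eq_sym.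
rewrite [n == k.+1]eq_sym.
rewrite [n.+1 == k]eq_sym.
have -> : ((a == b) && (k.+1 == n))%:R * (n != 0)%:R
  = ((a == b) && (k.+1 == n))%:R :> laurent.
  by case: n {l} => [|n]; rewrite ?andbF ?mul0r // mulr1.
by ring.
Qed.

End Hecke.

(** * The preimages of t_(s_0) and t_(s_1) *)

Definition starts (a : bool) (x : affW) : bool :=
  if word x is b :: _ then b == a else false.

Lemma starts1 a : starts a 1%g = false. Proof. by []. Qed.

Lemma starts_alt a b m : starts a (alt b m.+1) = (b == a).
Proof. by []. Qed.

Section PhiInverse.
Variables (H : algType laurent) (T : affW -> H) (HT : is_hecke_algebra T).

Lemma phi_hat1 b : phi_hat T b 1%g = b 1%g.
Proof.
apply/funext => n; rewrite /phi_hat /fsum.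
rewrite (@fsbigT_seq _ _ [:: 1%g])//.
  by rewrite big_seq1 (phi_coef1 HT) eqxx coefs1 fmul_monomial subr0.
by move=> x; rewrite inE (phi_coef1 HT) => /negPf->; rewrite coefs0 fmul0.
Qed.

Lemma phi_hat_alt b a k n : phi_hat T b (alt a k.+1) n =
  b (alt a k) n + b (alt a k.+2) n
  - (b (alt a k.+1) (n - 1) + b (alt a k.+1) (n + 1)).
Proof.
have neq1 : (alt a k == alt a k.+1) = false.
  by rewrite eq_sym alt_eq eqxx /=; apply/eqP; lia.
have neq2 : (alt a k == alt a k.+2) = false.
  by rewrite eq_sym alt_eq eqxx /=; apply/eqP; lia.
have neq3 : (alt a k.+1 == alt a k.+2) = false.
  by rewrite alt_eq eqxx /=; apply/eqP; lia.
rewrite /phi_hat /fsum (@fsbigT_seq _ _ [:: alt a k; alt a k.+2; alt a k.+1]).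
- rewrite !big_cons big_nil !(phi_coef_alt HT) !eqxx neq1 neq2 neq3.
  rewrite ![alt a k.+1 == alt a k]eq_sym ![alt a k.+2 == _]eq_sym neq1 neq2 neq3.
  rewrite !mul0r !subr0 !addr0 !add0r mul1r coefs1 coefs_qnumber fmul_qnumber.
  by rewrite !fmul_monomial !subr0 addrA.
- by rewrite /= !inE neq1 neq2 eq_sym neq3.
move=> x; rewrite !inE !negb_or (phi_coef_alt HT) => /and3P[/negPf-> /negPf-> /negPf->].
by rewrite mul0r subr0 addr0 coefs0 fmul0.
Qed.

(** The tridiagonal recursion has the solutions q^(n/2) and q^(-n/2); the completion selects the first
one, so that phi^-1(t_s) = - \sum_x q^(ell(x)/2) C_x over the x starting with s. *)
Definition phi_inv_sol (a : bool) : affW -> fseries :=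
  fun x n => - (starts a x && (n == ell x))%:R.

Lemma phi_inv_solP a : phi_hat T (phi_inv_sol a) = t_elt (gen a).
Proof.
apply/funext; elim/affW_case => [|c k]; apply/funext => n.
  by rewrite phi_hat1 /phi_inv_sol /t_elt starts1 one_neq_alt oppr0.
rewrite phi_hat_alt /phi_inv_sol /t_elt !starts_alt !ell_alt alt_eq.
have [->|ca] := eqVneq c a; last first.
  by case: k => [|k]; rewrite ?alt0 ?starts1 ?starts_alt ?(negPf ca) /= ?mulr0n !(oppr0, addr0).
have -> : starts a (alt a k) = (k != 0) by case: k => [|k]; rewrite ?alt0 ?starts1 ?starts_alt ?eqxx.
case: k => [|k] /=.
  by rewrite oppr0 add0r; do 4 case: eqP => ? //=; lia.
by rewrite /= ; do 4 case: eqP => ? //=; lia.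
Qed.

Lemma phi_inv_sol_completed a : completed (phi_inv_sol a).
Proof.
split=> [x|N N0].
  exists 0 => n n0; rewrite /phi_inv_sol; case: eqP => [nx|]; last by rewrite andbF oppr0.
  by rewrite nx in n0.
exists N => x Nx n nN; rewrite /phi_inv_sol; case: eqP => [nx|]; last by rewrite andbF oppr0.
by rewrite nx in nN; lia.
Qed.

(** If d is the difference of two preimages, d_(k+1) - q^(1/2) d_k is multiplied by q^(-1/2) when k
increases by 1; as it must tend to 0, it vanishes, and then so does d since d_0 = 0. *)
Lemma phi_inv_t_gen a : phi_inv_t T (gen a) = phi_inv_sol a.
Proof.
apply: xget_unique => [|b [[_ bc] bt]].
  by split; [exact: phi_inv_sol_completed|exact: phi_inv_solP].
pose d x n := b x n - phi_inv_sol a x n.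
have d1 n : d 1%g n = 0.
  have := congr1 (fun f => f 1%g) bt; rewrite -phi_inv_solP !phi_hat1 => E.
  by rewrite /d E subrr.
have rec c k n : d (alt c k) n + d (alt c k.+2) n
    = d (alt c k.+1) (n - 1) + d (alt c k.+1) (n + 1).
  have := congr1 (fun f => f (alt c k.+1) n) bt; rewrite -phi_inv_solP !phi_hat_alt.
  by rewrite /d; lia.
have [L dL] : exists L, forall x, (L <= ell x)%N -> forall n, n < 1 -> d x n = 0.
  have [L1 bL] := bc 1%N isT.
  have [L2 sL] := (phi_inv_sol_completed a).2 1%N isT.
  exists (maxn L1 L2) => x; rewrite geq_max => /andP[x1 x2] n n1.
  by rewrite /d bL // sL // subrr.
suff d0 c k n : d (alt c k) n = 0.
  apply/funext => x; apply/funext => n; apply/eqP; rewrite -subr_eq0.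
  by rewrite (altE x) -/(d _ _) d0.
have eS i n' : d (alt c i.+2) n' - d (alt c i.+1) (n' - 1)
    = d (alt c i.+1) (n' + 1) - d (alt c i) n'.
  by move: (rec c i n'); lia.
have e0 i n' : d (alt c i.+1) n' = d (alt c i) (n' - 1).
  have shift j : d (alt c i.+1) n' - d (alt c i) (n' - 1)
      = d (alt c (i + j).+1) (n' - j%:Z) - d (alt c (i + j)) (n' - j%:Z - 1).
    elim: j => [|j ->]; first by rewrite addn0 subr0.
    rewrite addnS eS; congr (_ - _); congr d; lia.
  apply/eqP; rewrite -subr_eq0; apply/eqP.
  by rewrite (shift (L + `|n'|)%N) !dL ?ell_alt ?subrr //; lia.
elim: k n => [|k IHk] n; first by rewrite alt0.
by rewrite e0.
Qed.

(** C'_y contains T_x if and only if x <= y; among the y starting with a, these are the ones of length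
at least [order_of a x]. *)
Definition order_of (a : bool) (x : affW) : nat :=
  if starts a x then ell x else (ell x).+1.

(** \sum_(m >= M) (-1)^(m+1) q^(-m) *)
Definition alternating_geometric (M : nat) : fseries := fun n =>
  if [&& n <= 0, ~~ odd `|n| & (M <= `|n|./2)%N] then (-1) ^+ (`|n|./2).+1 else 0.

Lemma bseries_gen a x : bseries T (gen a) x = alternating_geometric (order_of a x).
Proof.
apply/funext => n; rewrite /bseries /fsum.
pose t y := fmul (coefs (klC'_coef y x)) (j_phi_inv_t T (gen a) y) n.
have tE y : t y = if `[< bruhat x y >] then
    - ((-1) ^+ ell y * (starts a y && (n == - (ell y).*2%:Z))%:R) else 0.
  rewrite /t /klC'_coef; case: ifP => _; last by rewrite coefs0 fmul0.
  rewrite coefs_qpow fmul_monomial opprK /j_phi_inv_t /fbar phi_inv_t_gen.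
  rewrite /phi_inv_sol mulrN; congr (- (_ * (_ && _)%:R)).
  by apply/eqP/eqP; lia.
rewrite -[LHS]/(\sum_(y \in [set: affW]) t y).
have t0 y : y != alt a `|n|./2 -> t y = 0.
  rewrite tE; case: ifP => // _; elim/affW_case: y => [|b m]; first by rewrite starts1 /= mulr0n mulr0 oppr0.
  rewrite starts_alt; case: (eqVneq b a) => [->|]; last by rewrite ?andbF /= ?mulr0n mulr0 oppr0.
  rewrite ell_alt alt_eq eqxx; have [->|_] := eqVneq n (- m.+1.*2%:Z); last by rewrite ?andbF /= ?mulr0n mulr0 oppr0.
  by rewrite abszN /= doubleK eqxx.
rewrite (@fsbigT_seq _ _ [:: alt a `|n|./2])//; last first.
  by move=> y; rewrite inE => /t0.
rewrite big_seq1 tE ell_alt /alternating_geometric.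
set m := `|n|./2.
have -> : (n == - m.*2%:Z) = (n <= 0) && ~~ odd `|n|.
  by rewrite /m; apply/eqP/andP; lia.
case: (n <= 0); last by rewrite andbF /= ?mulr0n mulr0 oppr0; case: ifP.
case: (odd `|n|); first by rewrite andbF /= ?mulr0n mulr0 oppr0; case: ifP.
rewrite andbT /=.
have -> : `[< bruhat x (alt a m) >] = (x == alt a m) || (ell x < m)%N.
  apply/asboolP/orP; rewrite bruhatE ell_alt.
    by case=> [->|->]; [left|right].
  by case=> [/eqP->|xm]; [left|right].
rewrite /order_of.
case: m => [|m].
  rewrite alt0 starts1 /= ?mulr0n mulr0 oppr0 if_same ifN // -ltnNge.
  by elim/affW_case: x {t tE t0} => // b k; rewrite ell_alt; case: ifP.
rewrite starts_alt eqxx mulr1 -mulN1r -exprS.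
congr (if _ then _ else _).
elim/affW_case: x {t tE t0} => [|b k]; first by rewrite one_neq_alt.
rewrite alt_eq starts_alt ell_alt eqSS; case: eqP => _ //=.
by rewrite [(k < m.+1)%N]leq_eqVlt eqSS.
Qed.

End PhiInverse.

(** * Values of rational functions *)

Section RationalValue.
Implicit Types (p P Q : {poly int}) (f : fseries).

Local Notation "p • f" := (fmul (coefs_poly p) f) (at level 40).

Lemma fmul_polyE p f n (N : nat) : (size p <= N)%N ->
  (p • f) n = \sum_(i < N) p`_i * f (n - i%:Z).
Proof.
move=> pN; rewrite /fmul (@fsbigT_seq _ _ [seq i%:Z | i <- iota 0 N]).
- by rewrite big_map -[N in iota _ N]subn0 big_mkord.
- by rewrite map_inj_uniq ?iota_uniq // => i j [].
move=> [k|k] kN; last by rewrite mul0r.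
rewrite /= nth_default ?mul0r // (leq_trans pN) // leqNgt.
by apply: contraNN kN => kN; apply/mapP; exists k; rewrite // mem_iota.
Qed.

Lemma fmul_polyD p Q f n : ((p + Q) • f) n = (p • f) n + (Q • f) n.
Proof.
set N := maxn (size p) (size Q).
rewrite !(@fmul_polyE _ _ _ N) ?leq_maxl ?leq_maxr ?size_polyD //.
by rewrite -big_split; apply: eq_bigr => i _; rewrite coefD mulrDl.
Qed.

Lemma fmul_polyZ c p f n : ((c *: p) • f) n = c * (p • f) n.
Proof.
rewrite !(@fmul_polyE _ _ _ (size p)) ?size_scale_leq // mulr_sumr.
by apply: eq_bigr => i _; rewrite coefZ mulrA.
Qed.

Lemma fmul_polyMX p f n : ((p * 'X) • f) n = (p • f) (n - 1).
Proof.
rewrite (@fmul_polyE _ _ _ (size p).+1); last first.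
  by rewrite (leq_trans (size_polyMleq _ _)) // size_polyX addn2.
rewrite (@fmul_polyE _ _ _ (size p)) // big_ord_recl coefMX mul0r add0r.
apply: eq_bigr => i _; rewrite coefMX /= add0n; congr (_ * f _).
by rewrite /bump /=; lia.
Qed.

Lemma fmul_polyC c f n : (c%:P • f) n = c * f n.
Proof.
by rewrite (@fmul_polyE _ _ _ 1) ?size_polyC_leq1 // big_ord1 coefC subr0.
Qed.

Lemma fmul_polyM p Q f : (p * Q) • f = p • (Q • f).
Proof.
elim/poly_ind: p => [|p c IHp]; apply/funext => n.
  by rewrite mul0r -polyC0 !fmul_polyC !mul0r.
rewrite mulrDl mulrAC !fmul_polyD !fmul_polyMX IHp mul_polyC fmul_polyZ.
by rewrite fmul_polyC.
Qed.

Lemma coefs_polyM p Q : coefs_poly (p * Q) = p • coefs_poly Q.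
Proof.
elim/poly_ind: p => [|p c IHp]; apply/funext => n.
  by rewrite mul0r -polyC0 fmul_polyC mul0r; case: n => n //; rewrite /= coef0.
rewrite mulrDl mulrAC fmul_polyD fmul_polyMX fmul_polyC -IHp mul_polyC.
case: n => [[|n]|n]; rewrite /coefs_poly /= ?mulr0 ?addr0 //.
  by rewrite coefD coefMX coefZ.
by rewrite coefD coefMX coefZ; congr (_ + _); rewrite /= ?subn0 ?subn1.
Qed.

Lemma coefs_poly_inj p Q : coefs_poly p = coefs_poly Q -> p = Q.
Proof.
move=> pQ; apply/polyP => i.
exact: (congr1 (fun f : fseries => f i%:Z) pQ).
Qed.

(** Two fractions representing the same series have proportional numerators and denominators, hence
the same value. *)
Lemma rational_valueE (R : realType) (f : fseries) (v : R) P Q :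
  (map_poly intr Q).[v] != 0 -> Q • f = coefs_poly P ->
  rational_value f v = (map_poly intr P).[v] / (map_poly intr Q).[v].
Proof.
move=> Qv QfP; apply: xget_unique => [|r [P' [Q' [Q'v Q'fP' ->]]]].
  by exists P, Q.
have PQ : Q * P' = Q' * P.
  by apply: coefs_poly_inj; rewrite !coefs_polyM -QfP -Q'fP' -!fmul_polyM mulrC.
have := congr1 (fun p => (map_poly intr p : {poly R}).[v]) PQ.
rewrite !rmorphM !hornerM => E.
by apply/eqP; rewrite eqr_div // [_ * _.[v]]mulrC E mulrC.
Qed.

Lemma alternating_geometric_rational (R : realType) (M : nat) (q : R) : 0 < q ->
  rational_value (alternating_geometric M) (Num.sqrt q)
  = (-1) ^+ M.+1 * q / (q ^+ M * (q + 1)).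
Proof.
move=> q0; have v2 : Num.sqrt q ^+ 2 = q by rewrite sqr_sqrtr // ltW.
have Qv : (map_poly intr (('X^2 + 1) * 'X^2 ^+ M)).[Num.sqrt q] = q ^+ M * (q + 1).
  rewrite rmorphM rmorphD !rmorphXn /= map_polyX rmorph1 !hornerE v2.
  by rewrite mulrC.
rewrite (@rational_valueE _ _ _ ((-1) ^+ M.+1 *: 'X^2) (('X^2 + 1) * 'X^2 ^+ M)) ?Qv.
- congr (_ / _); rewrite map_polyZ /= map_polyXn hornerZ hornerXn v2.
  by rewrite rmorphXn rmorphN1.
- by rewrite mulf_neq0 // ?expf_neq0 // lt0r_neq0 // addr_gt0.
have fX2 p f n : ((p * 'X^2) • f) n = (p • f) (n - 2).
  rewrite -['X^2]/('X * 'X) mulrA !fmul_polyMX; congr (_ _); lia.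
have fX2M p f n k : ((p * 'X^2 ^+ k) • f) n = (p • f) (n - k.*2%:Z).
  elim: k n => [|k IHk] n; first by rewrite expr0 mulr1 subr0.
  rewrite exprSr mulrA fX2 IHk; congr (_ _); lia.
apply/funext => n; rewrite fX2M -{1}['X^2]mul1r fmul_polyD fX2 -polyC1.
rewrite !fmul_polyC !mul1r.
have -> : coefs_poly ((-1) ^+ M.+1 *: 'X^2) n = (n == 2)%:R * (-1) ^+ M.+1.
  by case: n => n; rewrite /= ?mul0r // coefZ coefXn mulrC.
rewrite /alternating_geometric.
set m1 := `|_|./2; set m2 := `|_|./2.
have [par|par] := boolP (odd `|n|).
  rewrite ifN; last by apply/and3P=> -[]; lia.
  rewrite ifN; last by apply/and3P=> -[]; lia.
  by case: eqP => n2; [move: par; rewrite n2|rewrite mul0r].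
have [n0|n0] := lerP n 0.
  rewrite !ifT; try (apply/and3P; split; rewrite /m1 /m2; lia).
  rewrite (_ : m1 = m2.+1); last by rewrite /m1 /m2; lia.
  have -> : (n == 2) = false by lia.
  by rewrite exprS mulN1r addNr mul0r.
rewrite [X in _ + X]ifN; last by apply/and3P=> -[]; rewrite /m2; lia.
rewrite addr0; case: eqP => n2.
  rewrite ifT; last by apply/and3P; split; rewrite /m1; lia.
  by rewrite mul1r; congr (_ ^+ _); rewrite /m1; lia.
by rewrite ifN ?mul0r //; apply/and3P=> -[]; rewrite /m1; lia.
Qed.

Lemma bseries_value (R : realType) (H : algType laurent) (T : affW -> H) (q : R) a x :
  is_hecke_algebra T -> 0 < q ->
  rational_value (bseries T (gen a) x) (Num.sqrt q)
  = (-1) ^+ (order_of a x).+1 * q / (q ^+ order_of a x * (q + 1)).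
Proof. by move=> HT q0; rewrite (bseries_gen HT) alternating_geometric_rational. Qed.

End RationalValue.

(** * Valuations and orbits of the Iwahori subgroup *)

Section Valuation.
Variables (F0 : fieldType) (val : F0 -> int).
Local Notation F := (valued val).
Hypothesis HF : nonarchimedean_local_field val.
Implicit Types (x y : F) (n m : int).

(** Membership in pi^n O *)
Definition vge (n : int) (x : F) : Prop := x = 0 \/ n <= val x.

Lemma val1 : val (1 : F) = 0.
Proof.
have := Defs.valM HF (oner_neq0 F) (oner_neq0 F); rewrite mulr1 => E.
by apply: (addrI (val (1 : F))); rewrite addr0 -E.
Qed.

Lemma valN1 : val (-1 : F) = 0.
Proof.
have n0 : (-1 : F) != 0 by rewrite oppr_eq0 oner_eq0.
by have := Defs.valM HF n0 n0; rewrite mulrNN mulr1 val1; lia.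
Qed.

Lemma valN x : val (- x : F) = val x.
Proof.
have [->|x0] := eqVneq x 0; first by rewrite oppr0.
have n0 : (-1 : F) != 0 by rewrite oppr_eq0 oner_eq0.
by rewrite -mulN1r (Defs.valM HF) // valN1 add0r.
Qed.

Lemma valV x : x != 0 -> val (x^-1 : F) = - val x.
Proof.
move=> x0; have := Defs.valM HF x0 (invr_neq0 x0).
by rewrite divff // val1; lia.
Qed.

Lemma vge0 n : vge n 0. Proof. by left. Qed.

Lemma vgeE n x : x != 0 -> vge n x <-> n <= val x.
Proof. by move=> /negP x0; split=> [[/eqP//|//]|]; right. Qed.

Lemma vge_le n m x : m <= n -> vge n x -> vge m x.
Proof. by move=> mn [->|nx]; [left|right; lia]. Qed.

Lemma vgeN n x : vge n x -> vge n (- x).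
Proof. by case=> [->|nx]; [left; rewrite oppr0|right; rewrite valN]. Qed.

Lemma vgeD n x y : vge n x -> vge n y -> vge n (x + y).
Proof.
have [->|x0] := eqVneq x 0; first by rewrite add0r.
have [->|y0] := eqVneq y 0; first by rewrite addr0.
have [->|xy0] := eqVneq (x + y) 0; first by left.
rewrite !vgeE // => nx ny; apply: le_trans (Defs.valD HF x0 y0 xy0).
by rewrite le_min nx ny.
Qed.

Lemma vgeB n x y : vge n x -> vge n y -> vge n (x - y).
Proof. by move=> nx ny; apply: vgeD => //; apply: vgeN. Qed.

Lemma vgeM n m k x y : vge n x -> vge m y -> k <= n + m -> vge k (x * y).
Proof.
have [->|x0] := eqVneq x 0; first by rewrite mul0r; left.
have [->|y0] := eqVneq y 0; first by rewrite mulr0; left.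
by rewrite !vgeE ?mulf_neq0 // (Defs.valM HF) //; lia.
Qed.

Lemma vge_val n x : val x = n -> vge n x.
Proof. by move=> <-; right. Qed.

Lemma vge1 : vge 0 1. Proof. by right; rewrite val1. Qed.

(** Membership in pi^n O^* *)
Definition vis (n : int) (x : F) : Prop := x != 0 /\ val x = n.

Lemma vis_vge n x : vis n x -> vge n x.
Proof. by move=> [_ /vge_val]. Qed.

Lemma vge_notS n x : vge n x -> ~ vge (n + 1) x -> vis n x.
Proof.
move=> nx /not_orP[/eqP x0 nxS]; split=> //.
by case: nx => [x00|]; [rewrite x00 eqxx in x0|lia].
Qed.

Lemma vis_notS n x : vis n x -> ~ vge (n + 1) x.
Proof. by move=> [x0 xn] [/eqP x00|]; [rewrite x00 in x0|lia]. Qed.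

Lemma visN n x : vis n x -> vis n (- x).
Proof. by move=> [x0 xn]; split; rewrite ?oppr_eq0 ?valN. Qed.

(** The ultrametric inequality is an equality when the two valuations differ. *)
Lemma visDr n x y : vis n x -> vge (n + 1) y -> vis n (x + y).
Proof.
move=> xn yn; apply: vge_notS.
  by apply: vgeD; [exact: vis_vge|apply: vge_le yn; lia].
move=> xyn; apply: (vis_notS xn).
by rewrite -(addrK y x); apply: vgeB.
Qed.

Lemma visDl n x y : vge (n + 1) x -> vis n y -> vis n (x + y).
Proof. by move=> xn yn; rewrite addrC; apply: visDr. Qed.

Lemma visM n m k x y : vis n x -> vis m y -> k = n + m -> vis k (x * y).
Proof. by move=> [x0 <-] [y0 <-] ->; split; rewrite ?mulf_neq0 // (Defs.valM HF). Qed.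

Lemma visV n x : vis n x -> vis (- n) x^-1.
Proof. by move=> [x0 <-]; split; rewrite ?invr_neq0 // valV. Qed.

Lemma vis1 : vis 0 1. Proof. by split; rewrite ?oner_neq0 // val1. Qed.

Lemma vis_neq0 n x : vis n x -> x != 0. Proof. by case. Qed.

Definition in_phi (n : int) (x : 'cV[F]_2) : Prop := vge n (x 0 0) /\ vis n (x 1 0).
Definition in_psi (n : int) (x : 'cV[F]_2) : Prop := vis n (x 0 0) /\ vge (n + 1) (x 1 0).

(** The nonzero orbits of the Iwahori subgroup form a chain, ordered by the smallest of the lattices
pi^n O + pi^n O and pi^n O + pi^(n+1) O containing them; [oidx x] is the position in this chain of the
orbit of x, the support of phi_n being at 2 n and that of psi_n at 2 n + 1. *)
Definition oidx (x : 'cV[F]_2) : int :=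
  if (x 1 0 != 0) && ((x 0 0 == 0) || (val (x 1 0) <= val (x 0 0)))
  then 2 * val (x 1 0) else 2 * val (x 0 0) + 1.

Lemma in_phi_oidx n (x : 'cV[F]_2) : in_phi n x -> oidx x = 2 * n.
Proof.
move=> [x0n [x1 x1n]]; rewrite /oidx x1 /= x1n ifT //.
by case: x0n => [->|nx0]; rewrite ?eqxx ?nx0 ?orbT.
Qed.

Lemma in_psi_oidx n (x : 'cV[F]_2) : in_psi n x -> oidx x = 2 * n + 1.
Proof.
move=> [[x0 x0n] x1n]; rewrite /oidx x0n ifN // (negPf x0) /=.
by case: x1n => [->|nx1]; rewrite ?eqxx // negb_and -ltNge; apply/orP; right; lia.
Qed.

Lemma cV2_neq0 (x : 'cV[F]_2) : x != 0 -> x 0 0 != 0 \/ x 1 0 != 0.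
Proof.
move=> x0; have [x00|] := eqVneq (x 0 0) 0; [right|by left].
apply: contraNN x0 => /eqP x10; apply/eqP/matrixP => i j; rewrite !mxE ord1.
by case: (unliftP 0 i) => [k ->|->]; rewrite ?x00 // -x10 (ord1 k); congr (x _ _); exact: val_inj.
Qed.

Lemma orbitP (x : 'cV[F]_2) : x != 0 ->
  (exists n, in_phi n x /\ oidx x = 2 * n) \/ (exists n, in_psi n x /\ oidx x = 2 * n + 1).
Proof.
move=> /cV2_neq0 xN0.
have [x10|x1] := eqVneq (x 1 0) 0.
  right; exists (val (x 0 0)); case: xN0 => [x0|]; last by rewrite x10 eqxx.
  suff xp : in_psi (val (x 0 0)) x by split=> //; exact: in_psi_oidx.
  by split=> //; left.
have [x00|x0] := eqVneq (x 0 0) 0.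
  left; exists (val (x 1 0)); suff xp : in_phi (val (x 1 0)) x by split=> //; exact: in_phi_oidx.
  by split=> //; left.
have [le10|lt01] := lerP (val (x 1 0)) (val (x 0 0)).
  left; exists (val (x 1 0)); suff xp : in_phi (val (x 1 0)) x by split=> //; exact: in_phi_oidx.
  by split=> //; right.
right; exists (val (x 0 0)); suff xp : in_psi (val (x 0 0)) x by split=> //; exact: in_psi_oidx.
by split=> //; right; lia.
Qed.

Lemma oidx_even n (x : 'cV[F]_2) : x != 0 -> oidx x = 2 * n -> in_phi n x.
Proof.
by case/orbitP=> -[m [xm ->]] E; [have -> : n = m by lia|lia].
Qed.

Lemma oidx_odd n (x : 'cV[F]_2) : x != 0 -> oidx x = 2 * n + 1 -> in_psi n x.
Proof.
by case/orbitP=> -[m [xm ->]] E; [lia|have -> : n = m by lia].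
Qed.

Lemma in_phi_neq0 n (x : 'cV[F]_2) : in_phi n x -> x != 0.
Proof. by move=> [_ [x1 _]]; apply: contraNN x1 => /eqP->; rewrite mxE. Qed.

Lemma in_psi_neq0 n (x : 'cV[F]_2) : in_psi n x -> x != 0.
Proof. by move=> [[x1 _] _]; apply: contraNN x1 => /eqP->; rewrite mxE. Qed.

Implicit Types (g u k w : 'M[F]_2).

Lemma ord2P (P : 'I_2 -> Prop) : P 0 -> P 1 -> forall i, P i.
Proof.
move=> P0 P1 i; case: (unliftP 0 i) => [j ->|->//].
by rewrite (ord1 j); have -> : lift 0 0 = 1 :> 'I_2 by exact: val_inj.
Qed.

Lemma sum_ord2 (V : nmodType) (f : 'I_2 -> V) : \sum_i f i = f 0 + f 1.
Proof.
by rewrite big_ord_recl big_ord1; congr (_ + f _); exact: val_inj.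
Qed.

Lemma mx2_00 (a b c d : F) : mx2 a b c d 0 0 = a. Proof. by rewrite mxE. Qed.
Lemma mx2_01 (a b c d : F) : mx2 a b c d 0 1 = b. Proof. by rewrite mxE. Qed.
Lemma mx2_10 (a b c d : F) : mx2 a b c d 1 0 = c. Proof. by rewrite mxE. Qed.
Lemma mx2_11 (a b c d : F) : mx2 a b c d 1 1 = d. Proof. by rewrite mxE. Qed.
Definition mx2_entries := (mx2_00, mx2_01, mx2_10, mx2_11).

Lemma mx2_eta g : g = mx2 (g 0 0) (g 0 1) (g 1 0) (g 1 1).
Proof. by apply/matrixP => i j; elim/ord2P: i; elim/ord2P: j; rewrite mxE. Qed.

Lemma mulmx2E g u i j : (g *m u) i j = g i 0 * u 0 j + g i 1 * u 1 j.
Proof. by rewrite mxE sum_ord2. Qed.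

Lemma mulcv2E g (x : 'cV[F]_2) i : (g *m x) i 0 = g i 0 * x 0 0 + g i 1 * x 1 0.
Proof. by rewrite mxE sum_ord2. Qed.

Lemma mulmx2 (a b c d a' b' c' d' : F) : mx2 a b c d *m mx2 a' b' c' d' =
  mx2 (a * a' + b * c') (a * b' + b * d') (c * a' + d * c') (c * b' + d * d').
Proof. by rewrite [LHS]mx2_eta !mulmx2E !mx2_entries. Qed.

Lemma mx2_1 : (1%:M : 'M[F]_2) = mx2 1 0 0 1.
Proof. by rewrite [LHS]mx2_eta !mxE. Qed.

Lemma cV2P (x y : 'cV[F]_2) : x 0 0 = y 0 0 -> x 1 0 = y 1 0 -> x = y.
Proof. by move=> x0 x1; apply/matrixP => i j; rewrite ord1; elim/ord2P: i. Qed.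

Definition cv2 (a b : F) : 'cV[F]_2 := \col_i if i == 0 then a else b.
Lemma cv2_0 a b : cv2 a b 0 0 = a. Proof. by rewrite mxE. Qed.
Lemma cv2_1 a b : cv2 a b 1 0 = b. Proof. by rewrite mxE. Qed.

Lemma SL2E g : SL2 g <-> g 0 0 * g 1 1 - g 0 1 * g 1 0 = 1.
Proof.
rewrite /SL2 /= (expand_det_row g 0) sum_ord2 /cofactor !det_mx11 !mxE /=.
rewrite expr0 mul1r expr1 mulN1r mulrN.
have -> : lift 0 0 = 1 :> 'I_2 by exact: val_inj.
have -> : lift 1 0 = 0 :> 'I_2 by exact: val_inj.
by split.
Qed.

Lemma SL2_unit g : SL2 g -> g \in unitmx.
Proof. by rewrite /SL2 /= unitmxE => ->; rewrite unitr1. Qed.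

Lemma SL2M g u : SL2 g -> SL2 u -> SL2 (g *m u).
Proof. by rewrite /SL2 /= det_mulmx => -> ->; rewrite mulr1. Qed.

Lemma SL2V g : SL2 g -> SL2 (invmx g).
Proof. by rewrite /SL2 /= det_inv => ->; rewrite invr1. Qed.

Lemma SL2_1 : SL2 (1%:M : 'M[F]_2).
Proof. by rewrite /SL2 /= det1. Qed.

Lemma SL2_inv g : SL2 g -> invmx g = mx2 (g 1 1) (- g 0 1) (- g 1 0) (g 0 0).
Proof.
move=> Sg; have gu := SL2_unit Sg.
rewrite -[RHS]mulmx1 -(mulmxV gu) mulmxA.
suff -> : mx2 (g 1 1) (- g 0 1) (- g 1 0) (g 0 0) *m g = 1%:M by rewrite mul1mx.
rewrite {5}[g]mx2_eta mulmx2 mx2_1; move/SL2E: Sg => <-; congr mx2; ring.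
Qed.

Lemma invmx_mulmx g u (x : 'cV[F]_2) : SL2 g -> SL2 u ->
  invmx (g *m u) *m x = invmx u *m (invmx g *m x).
Proof.
move=> Sg Su; have gu := SL2_unit Sg; have uu := SL2_unit Su.
apply: (can_inj (mulKmx (SL2_unit (SL2M Sg Su)))).
by rewrite mulKVmx ?(SL2_unit (SL2M Sg Su)) // -mulmxA !mulKVmx.
Qed.

Lemma invmx_neq0 g (x : 'cV[F]_2) : SL2 g -> x != 0 -> invmx g *m x != 0.
Proof.
move=> Sg; apply: contraNN => /eqP gx.
by rewrite -(mulKVmx (SL2_unit Sg) x) gx mulmx0.
Qed.

Variable pi : F.
Hypothesis Hpi : uniformizer pi.

Lemma pi_neq0 : pi != 0. Proof. by case: Hpi. Qed.

Lemma vis_pi : vis 1 pi. Proof. exact: Hpi. Qed.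

Lemma vis_piX n : vis n (pi ^ n).
Proof.
have visX (i : nat) : vis i%:Z (pi ^+ i).
  elim: i => [|i IHi]; first by rewrite expr0; exact: vis1.
  by rewrite exprS; apply: visM vis_pi IHi _; lia.
case: n => n; first exact: visX.
by rewrite NegzE -exprnN; apply: visV; exact: visX.
Qed.

Lemma piOE n x : piO pi n x <-> vge n x.
Proof.
split=> [[a aO <-]|xn].
  by apply: vgeM (vis_vge (vis_piX n)) aO _; lia.
have [pn0 _] := vis_piX n.
exists (pi ^ (- n) * x); last by rewrite mulrA -expfzDr ?pi_neq0 // subrr expr0z mul1r.
by apply: vgeM (vis_vge (vis_piX (- n))) xn _; lia.
Qed.

Lemma piOunitsE n x : piOunits pi n x <-> vis n x.
Proof.
split=> [[a aO <-]|xn].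
  by apply: visM (vis_piX n) aO _; lia.
exists (pi ^ (- n) * x); last by rewrite mulrA -expfzDr ?pi_neq0 // subrr expr0z mul1r.
by apply: visM (vis_piX (- n)) xn _; lia.
Qed.

Lemma iwahoriE k : iwahori pi k <-> [/\ SL2 k, vge 0 (k 0 0), vge 0 (k 0 1),
  vge 1 (k 1 0) & vge 0 (k 1 1)].
Proof.
split=> [[[Sk kO] /piOE k10]|[Sk k00 k01 k10 k11]]; first by split=> //; exact: kO.
split; last exact/piOE.
split=> // i j; rewrite -[ringO _]/(vge 0 _).
by elim/ord2P: i; elim/ord2P: j => //; exact: (@vge_le 1 0).
Qed.

Lemma iwahori_mx2 (a b c d : F) : a * d - b * c = 1 -> vge 0 a -> vge 0 b ->
  vge 1 c -> vge 0 d -> iwahori pi (mx2 a b c d).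
Proof.
by move=> det *; apply/iwahoriE; split; rewrite ?mx2_entries //; apply/SL2E; rewrite !mx2_entries.
Qed.

Lemma iwahori_diag k : iwahori pi k -> vis 0 (k 0 0) /\ vis 0 (k 1 1).
Proof.
case/iwahoriE=> /SL2E det k00 k01 k10 k11.
have k0110 : vge 1 (k 0 1 * k 1 0) by apply: vgeM k01 k10 _.
have kd : vis 0 (k 0 0 * k 1 1).
  have -> : k 0 0 * k 1 1 = 1 + k 0 1 * k 1 0 by rewrite -det subrK.
  exact: visDr vis1 k0110.
split; apply: vge_notS => // kS; apply: (vis_notS kd).
  by apply: vgeM kS k11 _.
by apply: vgeM k00 kS _.
Qed.

Lemma iwahori_SL2 k : iwahori pi k -> SL2 k. Proof. by case=> [[]]. Qed.

Lemma iwahori1 : iwahori pi 1%:M.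
Proof.
by apply/iwahoriE; rewrite mx2_1 !mx2_entries -mx2_1; split;
  [exact: SL2_1|exact: vge1|exact: vge0|exact: vge0|exact: vge1].
Qed.

Lemma iwahoriM k w : iwahori pi k -> iwahori pi w -> iwahori pi (k *m w).
Proof.
move=> /iwahoriE[Sk k00 k01 k10 k11] /iwahoriE[Sw w00 w01 w10 w11].
apply/iwahoriE; split; [exact: SL2M|..]; rewrite mulmx2E; apply: vgeD.
all: by [apply: vgeM k00 w00 _|apply: vgeM k01 w10 _|apply: vgeM k00 w01 _|apply: vgeM k01 w11 _
        |apply: vgeM k10 w00 _|apply: vgeM k11 w10 _|apply: vgeM k10 w01 _|apply: vgeM k11 w11 _].
Qed.

Lemma iwahoriV k : iwahori pi k -> iwahori pi (invmx k).
Proof.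
move=> /iwahoriE[Sk k00 k01 k10 k11]; apply/iwahoriE; split; first exact: SL2V.
all: by rewrite SL2_inv // !mx2_entries //; apply: vgeN.
Qed.

Lemma oidx_iwahori k (x : 'cV[F]_2) : iwahori pi k -> x != 0 -> oidx (k *m x) = oidx x.
Proof.
move=> kI x0; have [v00 v11] := iwahori_diag kI.
case/iwahoriE: kI => Sk k00 k01 k10 k11.
case: (orbitP x0) => -[n [[x0n x1n] ->]].
  apply: in_phi_oidx; split; rewrite mulcv2E.
    by apply: vgeD; [apply: vgeM k00 x0n _|apply: vgeM k01 (vis_vge x1n) _]; lia.
  by apply: visDl; [apply: vgeM k10 x0n _; lia|apply: visM v11 x1n _; lia].
apply: in_psi_oidx; split; rewrite mulcv2E.
  by apply: visDr; [apply: visM v00 x0n _; lia|apply: vgeM k01 x1n _; lia].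
by apply: vgeD; [apply: vgeM k10 (vis_vge x0n) _|apply: vgeM k11 x1n _]; lia.
Qed.

Lemma oidx_invmx_iwahori k (x : 'cV[F]_2) : iwahori pi k -> x != 0 -> oidx (invmx k *m x) = oidx x.
Proof. by move=> kI; apply: oidx_iwahori; apply: iwahoriV. Qed.

Lemma in_phi_orbit n (x : 'cV[F]_2) : in_phi n x ->
  exists2 k, iwahori pi k & x = k *m cv2 0 (pi ^ n).
Proof.
move=> [x0n x1n]; have vn := vis_piX n; have [pn0 _] := vn; have [x10 _] := x1n.
exists (mx2 (pi ^ n / x 1 0) (x 0 0 / pi ^ n) 0 (x 1 0 / pi ^ n)).
  apply: iwahori_mx2.
  - by field; rewrite pn0 x10.
  - by apply: vgeM (vis_vge vn) (vis_vge (visV x1n)) _; lia.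
  - by apply: vgeM x0n (vis_vge (visV vn)) _; lia.
  - exact: vge0.
  - by apply: vgeM (vis_vge x1n) (vis_vge (visV vn)) _; lia.
by apply: cV2P; rewrite mulcv2E !mx2_entries cv2_0 cv2_1; field; rewrite ?pn0 ?x10.
Qed.

Lemma in_psi_orbit n (x : 'cV[F]_2) : in_psi n x ->
  exists2 k, iwahori pi k & x = k *m cv2 (pi ^ n) 0.
Proof.
move=> [x0n x1n]; have vn := vis_piX n; have [pn0 _] := vn; have [x00 _] := x0n.
exists (mx2 (x 0 0 / pi ^ n) 0 (x 1 0 / pi ^ n) (pi ^ n / x 0 0)).
  apply: iwahori_mx2.
  - by field; rewrite pn0 x00.
  - by apply: vgeM (vis_vge x0n) (vis_vge (visV vn)) _; lia.
  - exact: vge0.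
  - by apply: vgeM x1n (vis_vge (visV vn)) _; lia.
  - by apply: vgeM (vis_vge vn) (vis_vge (visV x0n)) _; lia.
by apply: cV2P; rewrite mulcv2E !mx2_entries cv2_0 cv2_1; field; rewrite ?pn0 ?x00.
Qed.

End Valuation.

(** * Double cosets of the Iwahori subgroup *)

(** The root subgroup of s_a acts nontrivially on the vectors whose index has this parity; on the other
ones, s_a moves the orbit e to e - 1 whatever the root element in front of it. *)
Definition matched (a : bool) (e : int) : bool := odd `|e| == a.

Lemma matched_opp a e : matched (~~ a) e = ~~ matched a e.
Proof. by rewrite /matched; case: a; case: (odd _). Qed.

Lemma matchedB1 a e : matched a (e - 1) = ~~ matched a e.
Proof. by rewrite -matched_opp /matched; case: a; apply/eqP/eqP; lia. Qed.

Lemma matchedD1 a e : matched a (e + 1) = ~~ matched a e.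
Proof. by rewrite -[in RHS](addrK 1 e) matchedB1 negbK. Qed.

Section Cells.
Variables (F0 : fieldType) (val : F0 -> int).
Local Notation F := (valued val).
Hypothesis HF : nonarchimedean_local_field val.
Variable pi : F.
Hypothesis Hpi : uniformizer pi.
Implicit Types (r b : F) (x : 'cV[F]_2) (g u k w : 'M[F]_2).

(** [root_mx a] is the root subgroup of s_a inside the Iwahori subgroup, and [root_gen a r] is the
product of [root_mx a r] by the lift of s_a. *)
Definition root_gen (a : bool) (r : F) : 'M[F]_2 :=
  if a then mx2 0 pi^-1 (- pi) r else mx2 r (-1) 1 0.

Definition root_mx (a : bool) (b : F) : 'M[F]_2 :=
  if a then mx2 1 0 (pi * b) 1 else mx2 1 b 0 1.

Let pi0 : pi != 0 := pi_neq0 Hpi.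

Lemma lift_genE a : lift_gen pi a = root_gen a 0.
Proof. by case: a. Qed.

Lemma root_gen_SL2 a r : SL2 (root_gen a r).
Proof. by apply/SL2E; case: a; rewrite !mx2_entries; field. Qed.

Lemma root_mx_iwahori a b : vge 0 b -> iwahori pi (root_mx a b).
Proof.
move=> b0; have v1 := vge1 HF; have v0 := @vge0 _ val.
case: a; apply: (iwahori_mx2 HF Hpi) => //; try by ring.
by apply: (vgeM HF (vis_vge (vis_pi Hpi)) b0).
Qed.

Lemma root_mx_gen a b r : root_mx a b *m root_gen a r = root_gen a (b + r).
Proof. by case: a; rewrite mulmx2; congr mx2; field. Qed.

Lemma root_gen_mx a r b : root_gen a r *m root_mx (~~ a) b = root_gen a (r - pi * b).
Proof. by case: a; rewrite mulmx2; congr mx2; field. Qed.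

Lemma root_genV a r : invmx (root_gen a r) =
  if a then mx2 r (- pi^-1) pi 0 else mx2 0 1 (-1) r.
Proof.
rewrite (SL2_inv (root_gen_SL2 a r)).
by case: a; rewrite !mx2_entries ?opprK.
Qed.

(** The only root element, modulo pi, that moves x to the next orbit after application of s_a^-1. *)
Definition slope (a : bool) x : F := if a then x 1 0 / (pi * x 0 0) else x 0 0 / x 1 0.

Lemma slope_int a x : x != 0 -> matched a (oidx x) -> vge 0 (slope a x).
Proof.
rewrite /matched /slope => x0 ax; case: (orbitP x0) => -[n [[x0n x1n] E]]; move: ax; rewrite E.
  case: a => /eqP; first by lia.
  by move=> _; apply: (vgeM HF x0n (vis_vge (visV HF x1n))); lia.
case: a => /eqP; last by lia.
move=> _; have px0 : vis (n + 1) (pi * x 0 0) by apply: (visM HF (vis_pi Hpi) x0n); lia.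
by apply: (vgeM HF x1n (vis_vge (visV HF px0))); lia.
Qed.

Lemma oidx_unmatched a r x : x != 0 -> vge 0 r -> ~~ matched a (oidx x) ->
  oidx (invmx (root_gen a r) *m x) = oidx x - 1.
Proof.
rewrite /matched root_genV => x0 r0 ax.
case: (orbitP x0) => -[n [[x0n x1n] E]]; move: ax; rewrite E.
  case: a => /eqP; last by lia.
  move=> _; transitivity (2 * (n - 1) + 1); last lia.
  apply: in_psi_oidx; split; rewrite mulcv2E !mx2_entries.
    apply: (visDl HF); first by apply: (vgeM HF r0 x0n); lia.
    rewrite mulNr; apply: (visN HF).
    by apply: (visM HF (visV HF (vis_pi Hpi)) x1n); lia.
  by rewrite mul0r addr0; apply: (vgeM HF (vis_vge (vis_pi Hpi)) x0n); lia.
case: a => /eqP; first by lia.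
move=> _; transitivity (2 * n); last lia.
apply: in_phi_oidx; split; rewrite mulcv2E !mx2_entries.
  by rewrite mul0r add0r mul1r; apply: vge_le x1n; lia.
apply: (visDr HF); first by rewrite mulN1r; exact: visN.
by apply: (vgeM HF r0 x1n); lia.
Qed.

Lemma oidx_matched a r x : x != 0 -> vge 0 r -> matched a (oidx x) ->
  (vge 1 (r - slope a x) -> oidx (invmx (root_gen a r) *m x) = oidx x + 1) /\
  (~ vge 1 (r - slope a x) -> oidx (invmx (root_gen a r) *m x) = oidx x).
Proof.
move=> x0 r0 ax; have s0 := slope_int x0 ax; move: ax s0.
rewrite /matched /slope root_genV.
case: (orbitP x0) => -[n [[x0n x1n] ->]].
  case: a => /eqP par s0; first by lia.
  have [x10 _] := x1n.
  have E : (mx2 0 1 (-1) r *m x) 1 0 = x 1 0 * (r - x 0 0 / x 1 0).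
    by rewrite mulcv2E !mx2_entries; field.
  have E0 : vis n ((mx2 0 1 (-1) r *m x) 0 0).
    by rewrite mulcv2E !mx2_entries mul0r add0r mul1r.
  split=> sl.
    apply: in_psi_oidx; split=> //; rewrite E.
    by apply: (vgeM HF (vis_vge x1n) sl); lia.
  apply: in_phi_oidx; split; first exact: vis_vge.
  rewrite E; apply: (visM HF x1n (n := n) (m := 0)); last lia.
  by apply: vge_notS => //; apply: vgeB.
case: a => /eqP par s0; last by lia.
have [x00 _] := x0n.
have E : (mx2 r (- pi^-1) pi 0 *m x) 0 0 = x 0 0 * (r - x 1 0 / (pi * x 0 0)).
  by rewrite mulcv2E !mx2_entries; field; rewrite x00 pi0.
have E1 : vis (n + 1) ((mx2 r (- pi^-1) pi 0 *m x) 1 0).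
  rewrite mulcv2E !mx2_entries mul0r addr0.
  by apply: (visM HF (vis_pi Hpi) x0n); lia.
split=> sl.
  transitivity (2 * (n + 1)); last lia.
  apply: in_phi_oidx; split=> //; rewrite E.
  by apply: (vgeM HF (vis_vge x0n) sl); lia.
apply: in_psi_oidx; split; last exact: vis_vge.
rewrite E; apply: (visM HF x0n (n := n) (m := 0)); last lia.
by apply: vge_notS => //; apply: vgeB.
Qed.

(* A system of representatives of O / pi O *)
Variable rs : seq F.
Hypothesis rs_int : forall r, r \in rs -> vge 0 r.
Hypothesis rs_ex : forall x : F, vge 0 x -> exists2 r, r \in rs & vge 1 (r - x).
Hypothesis rs_inj : forall r r', r \in rs -> r' \in rs -> vge 1 (r - r') -> r = r'.

(** Representatives of the left cosets contained in the double coset of [alt a m]. *)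
Fixpoint reps (a : bool) (m : nat) : seq 'M[F]_2 :=
  if m is m'.+1 then [seq root_gen a r *m w | r <- rs, w <- reps (~~ a) m']
  else [:: 1%:M].

Lemma reps_SL2 a m w : w \in reps a m -> SL2 w.
Proof.
elim: m a w => [|m IHm] a w; first by rewrite inE => /eqP->; exact: SL2_1.
by case/allpairsP => -[r u] [_ /IHm Su ->]; apply: SL2M => //; exact: root_gen_SL2.
Qed.

Definition cell a m : set 'M[F]_2 :=
  [set u | exists w k, [/\ w \in reps a m, iwahori pi k & u = w *m k]].

(** The representatives n_a(r) s_a exhaust I s_a I: r' is the residue that makes the lower left entry
of k' divisible by pi. *)
Lemma root_gen_iwahori a r k : vge 0 r -> iwahori pi k ->
  exists r' k', [/\ r' \in rs, iwahori pi k' & k *m root_gen a r = root_gen a r' *m k'].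
Proof.
move=> r0 kI; have [v00 v11] := iwahori_diag HF Hpi kI.
have Sk := iwahori_SL2 kI; have := iwahoriM HF Hpi kI.
case/(iwahoriE HF Hpi): kI => _ k00 k01 k10 k11 _.
have SG r' : SL2 (invmx (root_gen a r') *m (k *m root_gen a r)).
  by apply: SL2M; [apply: SL2V; exact: root_gen_SL2|apply: SL2M => //; exact: root_gen_SL2].
suff [r' r'rs kI'] : exists2 r', r' \in rs &
    iwahori pi (invmx (root_gen a r') *m (k *m root_gen a r)).
  exists r', (invmx (root_gen a r') *m (k *m root_gen a r)); split=> //.
  by rewrite mulKVmx // SL2_unit //; exact: root_gen_SL2.
have vp := vis_pi Hpi; have vp' := visV HF vp.
case: a SG => SG.
  pose t := (k 1 0 / pi + k 1 1 * r) / (k 0 0 + pi * k 0 1 * r).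
  have k10p : vge 0 (k 1 0 / pi) by apply: (vgeM HF k10 (vis_vge vp')).
  have k01p : vge 1 (pi * k 0 1) by apply: (vgeM HF (vis_vge vp) k01).
  have den : vis 0 (k 0 0 + pi * k 0 1 * r).
    by apply: (visDr HF) => //; apply: (vgeM HF k01p r0).
  have num : vge 0 (k 1 0 / pi + k 1 1 * r).
    by apply: (vgeD HF) => //; apply: (vgeM HF k11 r0).
  have [r' r'rs r't] : exists2 r', r' \in rs & vge 1 (r' - t).
    by apply: rs_ex; apply: (vgeM HF num (vis_vge (visV HF den))).
  have r'0 := rs_int r'rs; have [den0 _] := den.
  exists r' => //; move: (SG r'); rewrite root_genV {1 2}[k]mx2_eta !mulmx2.
  move=> /SL2E; rewrite !mx2_entries => SG'; apply: (iwahori_mx2 HF Hpi) => //.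
  - rewrite (_ : _ + _ = k 1 1 - pi * k 0 1 * r'); last by field.
    by apply: (vgeB HF) => //; apply: vge_le (vgeM HF k01p r'0 (lexx _)).
  - rewrite (_ : _ + _ = pi^-1 * ((r' - t) * (k 0 0 + pi * k 0 1 * r))); last first.
      by rewrite /t; field; rewrite pi0 den0.
    by apply: (vgeM HF (vis_vge vp') (vgeM HF r't (vis_vge den) (lexx _))).
  - rewrite (_ : _ + _ = - (pi * (pi * k 0 1))); last by field.
    by apply: (vgeN HF); apply: (vgeM HF (vis_vge vp) k01p).
  - rewrite (_ : _ + _ = k 0 0 + pi * k 0 1 * r); last by field.
    exact: vis_vge.
pose t := (k 0 0 * r + k 0 1) / (k 1 0 * r + k 1 1).
have den : vis 0 (k 1 0 * r + k 1 1).
  by apply: (visDl HF) => //; apply: (vgeM HF k10 r0).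
have num : vge 0 (k 0 0 * r + k 0 1).
  by apply: (vgeD HF) => //; apply: (vgeM HF k00 r0).
have [r' r'rs r't] : exists2 r', r' \in rs & vge 1 (r' - t).
  by apply: rs_ex; apply: (vgeM HF num (vis_vge (visV HF den))).
have r'0 := rs_int r'rs; have [den0 _] := den.
exists r' => //; move: (SG r'); rewrite root_genV {1 2}[k]mx2_eta !mulmx2.
move=> /SL2E; rewrite !mx2_entries => SG'; apply: (iwahori_mx2 HF Hpi) => //.
- rewrite (_ : _ + _ = k 1 0 * r + k 1 1); last by ring.
  exact: vis_vge.
- rewrite (_ : _ + _ = - k 1 0); last by ring.
  by apply: (vgeN HF); apply: vge_le k10.
- rewrite (_ : _ + _ = (r' - t) * (k 1 0 * r + k 1 1)); last by rewrite /t; field.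
  by apply: (vgeM HF r't (vis_vge den)).
- rewrite (_ : _ + _ = k 0 0 - r' * k 1 0); last by ring.
  by apply: (vgeB HF) => //; apply: (vgeM HF r'0 k10).
Qed.

Lemma cell_mull a m k u : iwahori pi k -> cell a m u -> cell a m (k *m u).
Proof.
move=> kI [w [k' [wr k'I ->]]]; elim: m a w wr k kI => [|m IHm] a w wr k kI.
  move: wr; rewrite inE => /eqP->; exists 1%:M, (k *m k'); rewrite !mul1mx inE.
  by split=> //; exact: iwahoriM.
case/allpairsP: wr => -[r w'] [/= rrs w'r ->].
have [r' [k2 [r'rs k2I E]]] := root_gen_iwahori a (rs_int rrs) kI.
have [w2 [k3 [w2r k3I E2]]] := IHm _ _ w'r _ k2I.
exists (root_gen a r' *m w2), k3; split=> //; first by apply: allpairs_f.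
by rewrite !mulmxA E -!mulmxA; congr (_ *m _); rewrite mulmxA -mulmxA E2.
Qed.

Lemma cell_mulr a m k u : iwahori pi k -> cell a m u -> cell a m (u *m k).
Proof.
move=> kI [w [k' [wr k'I ->]]]; exists w, (k' *m k); rewrite mulmxA; split=> //.
exact: iwahoriM.
Qed.

Lemma lift_affW_alt a m : lift_affW pi (alt a m.+1) = root_gen a 0 *m lift_affW pi (alt (~~ a) m).
Proof. by rewrite -lift_genE. Qed.

Lemma cell_lift a m : cell a m (lift_affW pi (alt a m)).
Proof.
elim: m a => [|m IHm] a.
  by exists 1%:M, 1%:M; rewrite inE mulmx1; split=> //; exact: iwahori1.
rewrite lift_affW_alt; have [r rrs _] := rs_ex (vge0 val 0).
have r0 := rs_int rrs.
have -> : root_gen a 0 = root_mx a (- r) *m root_gen a r by rewrite root_mx_gen addNr.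
rewrite -mulmxA; apply: cell_mull; first by apply: root_mx_iwahori; exact: vgeN.
have [w [k [wr kI ->]]] := IHm (~~ a).
exists (root_gen a r *m w), k; split=> //; last by rewrite mulmxA.
exact: allpairs_f.
Qed.

(** Moving the root elements to the left, across the generators, multiplies their argument by - pi. *)
Lemma cell_root a m u : cell a m u ->
  exists b k, [/\ vge 0 b, iwahori pi k & u = root_mx a b *m lift_affW pi (alt a m) *m k].
Proof.
move=> [w [k [wr kI ->]]]; elim: m a w wr => [|m IHm] a w wr.
  move: wr; rewrite inE => /eqP->; exists 0, k; split=> //; first exact: vge0.
  have -> : root_mx a 0 = 1%:M by rewrite mx2_1; case: a; rewrite /root_mx ?mulr0.
  by rewrite !mul1mx.
case/allpairsP: wr => -[r w'] [/= rrs w'r ->].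
have [c [k' [c0 k'I E]]] := IHm _ _ w'r.
exists (r - pi * c), k'; split=> //.
  apply: (vgeB HF); first exact: rs_int.
  by apply: (vgeM HF (vis_vge (vis_pi Hpi)) c0).
rewrite lift_affW_alt [root_mx _ _ *m (_ *m _)]mulmxA root_mx_gen addr0.
by rewrite -root_gen_mx -!mulmxA; congr (_ *m _); rewrite [in RHS]mulmxA -E.
Qed.

Lemma double_cosetE a m : double_coset pi (alt a m) = cell a m.
Proof.
apply/seteqP; split=> [_ [k [k' [kI k'I ->]]]|u /cell_root[b [k [b0 kI ->]]]].
  by apply: cell_mulr => //; apply: cell_mull => //; exact: cell_lift.
by exists (root_mx a b), k; split=> //; exact: root_mx_iwahori.
Qed.

(** On the vectors of unmatched index, all representatives act by the same shift; on the matched ones,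
they shift the index strictly less. Both facts serve to tell cosets and double cosets apart. *)
Lemma reps_unmatched a m w x : w \in reps a m -> x != 0 -> ~~ matched a (oidx x) ->
  oidx (invmx w *m x) = oidx x - m%:Z.
Proof.
elim: m a w x => [|m IHm] a w x wr x0 ax.
  by move: wr; rewrite inE => /eqP->; rewrite invmx1 mul1mx subr0.
case/allpairsP: wr => -[r w'] [/= rrs w'r ->] /=; have Sg := root_gen_SL2 a r.
rewrite (invmx_mulmx _ Sg (reps_SL2 w'r)).
have E := oidx_unmatched x0 (rs_int rrs) ax.
rewrite (IHm _ _ _ w'r (invmx_neq0 Sg x0)) E; first lia.
by rewrite matchedB1 matched_opp negbK.
Qed.

Lemma reps_matched a m w x : w \in reps a m -> x != 0 -> matched a (oidx x) ->
  oidx x - m%:Z + (m != 0)%:Z <= oidx (invmx w *m x).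
Proof.
elim: m a w x => [|m IHm] a w x wr x0 ax.
  by move: wr; rewrite inE => /eqP->; rewrite invmx1 mul1mx subr0 addr0.
case/allpairsP: wr => -[r w'] [/= rrs w'r ->] /=; have Sg := root_gen_SL2 a r.
rewrite (invmx_mulmx _ Sg (reps_SL2 w'r)); have y0 := invmx_neq0 Sg x0.
have [E1 E2] := oidx_matched x0 (rs_int rrs) ax.
have [/E1 E|/E2 E] := pselect (vge 1 (r - slope a x)).
  have := IHm _ _ _ w'r y0; rewrite E matchedD1 matched_opp negbK => /(_ ax).
  by case: (m) => [|n] /=; lia.
by rewrite (reps_unmatched w'r y0) E ?matched_opp ?negbK //; lia.
Qed.

Lemma oidx_cosetE w k x : SL2 w -> iwahori pi k -> x != 0 ->
  oidx (invmx (w *m k) *m x) = oidx (invmx w *m x).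
Proof.
move=> Sw kI x0; rewrite (invmx_mulmx _ Sw (iwahori_SL2 kI)).
by rewrite (oidx_invmx_iwahori HF Hpi) //; exact: invmx_neq0.
Qed.

Lemma slope_vector a r : vge 0 r ->
  exists x, [/\ x != 0, matched a (oidx x) & slope a x = r].
Proof.
move=> r0; have vp := vis_pi Hpi; case: a.
  have E : in_psi 0 (cv2 1 (pi * r)).
    by split; rewrite ?cv2_0 ?cv2_1; [exact: vis1|apply: (vgeM HF (vis_vge vp) r0)].
  exists (cv2 1 (pi * r)); split; first exact: in_psi_neq0 E.
    by rewrite /matched (in_psi_oidx E).
  by rewrite /slope cv2_0 cv2_1; field.
have E : in_phi 0 (cv2 r 1) by split; rewrite ?cv2_0 ?cv2_1 //; exact: vis1.
exists (cv2 r 1); split; first exact: in_phi_neq0 E.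
  by rewrite /matched (in_phi_oidx E).
by rewrite /slope cv2_0 cv2_1 divr1.
Qed.

(** A vector of slope r goes to the next orbit under (n_a(r) s_a)^-1, but not under (n_a(r') s_a)^-1,
and the shifts that the elements of length m can add to this do not compensate the difference. *)
Lemma root_gen_disjoint a m r r' v v' k k' : r \in rs -> r' \in rs ->
  v \in reps (~~ a) m -> v' \in reps (~~ a) m -> iwahori pi k -> iwahori pi k' ->
  root_gen a r *m v *m k = root_gen a r' *m v' *m k' -> r = r'.
Proof.
move=> rrs r'rs vr v'r kI k'I E.
have Sg := root_gen_SL2 a r; have Sg' := root_gen_SL2 a r'.
have [Sv Sv'] := (reps_SL2 vr, reps_SL2 v'r).
have [x [x0 ax xr]] := slope_vector a (rs_int rrs).
have Ex : oidx (invmx v *m (invmx (root_gen a r) *m x))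
    = oidx (invmx v' *m (invmx (root_gen a r') *m x)).
  rewrite -(invmx_mulmx _ Sg Sv) -(invmx_mulmx _ Sg' Sv').
  by rewrite -(oidx_cosetE (SL2M Sg Sv) kI x0) E oidx_cosetE //; exact: SL2M.
have [E1 _] := oidx_matched x0 (rs_int rrs) ax.
have [_ E2] := oidx_matched x0 (rs_int r'rs) ax.
rewrite xr in E1 E2.
have {}E1 : oidx (invmx (root_gen a r) *m x) = oidx x + 1.
  by apply: E1; rewrite subrr; exact: vge0.
apply/esym/rs_inj => //; apply: contrapT => /E2{}E2.
have := reps_matched vr (invmx_neq0 Sg x0).
rewrite E1 matchedD1 matched_opp negbK ax => /(_ isT).
rewrite Ex (reps_unmatched v'r (invmx_neq0 Sg' x0)) E2 ?matched_opp ?ax //; lia.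
Qed.

Lemma reps_disjoint a m w w' k k' : w \in reps a m -> w' \in reps a m ->
  iwahori pi k -> iwahori pi k' -> w *m k = w' *m k' -> w = w'.
Proof.
elim: m a w w' => [|m IHm] a w w' wr w'r kI k'I.
  by move: wr w'r; rewrite !inE => /eqP-> /eqP->.
case/allpairsP: wr => -[r v] [/= rrs vr ->].
case/allpairsP: w'r => -[r' v'] [/= r'rs v'r ->] E.
have rr' := root_gen_disjoint rrs r'rs vr v'r kI k'I E; rewrite -{}rr' in E *.
move: E; rewrite -!mulmxA => /(can_inj (mulKmx (SL2_unit (root_gen_SL2 a r)))) E.
by rewrite (IHm _ _ _ vr v'r kI k'I E).
Qed.

(** The shifts of two test vectors, one of each parity, determine m, and the parity for which the shift
is the largest determines the first letter. *)
Lemma cell_inj a (b : bool) m (n : nat) u : cell a m u -> cell b n u -> alt a m = alt b n.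
Proof.
move=> [w [k [wr kI ->]]] [w' [k' [w'r k'I E]]].
have Sw := reps_SL2 wr; have Sw' := reps_SL2 w'r.
have Eo x : x != 0 -> oidx (invmx w *m x) = oidx (invmx w' *m x).
  by move=> x0; rewrite -(oidx_cosetE Sw kI x0) E oidx_cosetE.
have [x [x0 ax _]] := slope_vector a (vge0 val 0).
have [y [y0 ay _]] := slope_vector (~~ a) (vge0 val 0).
rewrite matched_opp in ay.
have := Eo _ x0; have := Eo _ y0; rewrite (reps_unmatched wr y0 ay).
have := reps_matched wr x0 ax.
have [ba|ba] := eqVneq b a.
  rewrite ba in w'r *; rewrite (reps_unmatched w'r y0 ay) => _ + _.
  by move=> /addrI/oppr_inj[->].
have {}ba : b = ~~ a by case: (a) (b) ba => -[].
rewrite ba in w'r *.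
have bx : ~~ matched (~~ a) (oidx x) by rewrite matched_opp negbK.
have bY : matched (~~ a) (oidx y) by rewrite matched_opp.
rewrite (reps_unmatched w'r x0 bx); have := reps_matched w'r y0 bY.
move: (oidx x) (oidx y) (oidx (invmx w *m x)) (oidx (invmx w' *m y)) => ex ey ewx ewy.
by case: (m) (n) => [|m'] [|n'] /=; rewrite ?alt0 //; clear => *; exfalso; lia.
Qed.

Hypothesis rs_uniq : uniq rs.

Lemma reps_uniq a m : uniq (reps a m).
Proof.
elim: m a => [//|m IHm] a; apply: allpairs_uniq => // -[r v] [r' v'].
case/allpairsP=> -[r1 v1] [/= rrs vr [-> ->]] {r v}.
case/allpairsP=> -[r2 v2] [/= r2s v2r [-> ->]] {r' v'} E.
have I1 := iwahori1 HF Hpi.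
have rr : r1 = r2.
  by apply: (root_gen_disjoint rrs r2s vr v2r I1 I1); rewrite !mulmx1.
rewrite -rr in E *; congr pair.
exact: (can_inj (mulKmx (SL2_unit (root_gen_SL2 a r1)))) E.
Qed.

End Cells.

(** * Topology and measure *)

Section Topology.
Variables (F0 : fieldType) (val : F0 -> int).
Local Notation F := (valued val).
Hypothesis HF : nonarchimedean_local_field val.

Lemma nbhs_valP (x : F) (A : set F) :
  nbhs x A <-> exists n, forall y, vge n (y - x) -> A y.
Proof.
split=> [[B [oB Bx BA]]|[n nA]].
  by have [n Bn] := oB x Bx; exists n => y yx; apply/BA/Bn.
exists [set y | vge n (y - x)]; split=> [z zx|/=|//]; last by rewrite subrr; exact: vge0.
exists n => y yz /=; rewrite -(subrK z y) -addrA; exact: (vgeD HF).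
Qed.

Lemma nbhs_mxP m n (x : 'M[F]_(m, n)) (A : set 'M[F]_(m, n)) :
  nbhs x A <-> exists N, forall y : 'M[F]_(m, n), (forall i j, vge N (y i j - x i j)) -> A y.
Proof.
split=> [[P Px PA]|[N NA]]; last first.
  exists (fun i j => [set y | vge N (y - x i j)]) => [i j|y xy]; last exact: NA.
  by apply/nbhs_valP; exists N.
have /choice[f fP] : forall ij : 'I_m * 'I_n, exists k,
    forall y, vge k (y - x ij.1 ij.2) -> P ij.1 ij.2 y.
  by move=> [i j]; apply/nbhs_valP; exact: Px.
exists (\big[Num.max/0]_ij f ij) => y yx; apply: PA => i j; apply: (fP (i, j)).
by apply: vge_le (yx i j); exact: (le_bigmax _ f (i, j)).
Qed.

Lemma closed_vge n : closed [set x : F | vge n x].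
Proof.
move=> x clx; apply: contrapT => nx.
have [|y /= [ny xy]] := clx [set y | vge n (y - x)]; first by apply/nbhs_valP; exists n.
by apply: nx; rewrite -[x](subKr y); apply: (vgeB HF).
Qed.

Variable pi : F.
Hypothesis Hpi : uniformizer pi.

(** Some ball around 0 is contained in a compact set, and all the balls are homothetic. *)
Lemma compact_vge n : compact [set x : F | vge n x].
Proof.
have [U + [cU clU]] := val_locally_compact HF (x := 0) I.
rewrite /within /= => /nbhs_valP[k Uk].
have ck : compact [set x : F | vge k x].
  apply: (subclosed_compact (@closed_vge k) cU) => x kx.
  by apply: (Uk x) => //; rewrite subr0.
have -> : [set x : F | vge n x] = (fun x => pi ^ (n - k) * x) @` [set x : F | vge k x].
  apply/seteqP; split=> [x nx|_ [y yk <-]] /=.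
    exists (pi ^ (k - n) * x).
      by apply: (vgeM HF (vis_vge (vis_piX HF Hpi _)) nx); lia.
    rewrite mulrA -expfzDr ?(pi_neq0 Hpi) // (_ : _ - _ + _ = 0) ?expr0z ?mul1r //; lia.
  by apply: (vgeM HF (vis_vge (vis_piX HF Hpi _)) yk); lia.
apply: continuous_compact ck; apply: continuous_subspaceT => x A /nbhs_valP[N AN].
apply/nbhs_valP; exists (N - (n - k)) => y yx; apply: AN; rewrite -mulrBr.
by apply: (vgeM HF (vis_vge (vis_piX HF Hpi _)) yx); lia.
Qed.

(** O is compact and is the disjoint union of its open cosets modulo pi. *)
Lemma residues_exist : exists rs : seq F,
  [/\ uniq rs, forall r, r \in rs -> vge 0 r,
      forall x : F, vge 0 x -> exists2 r, r \in rs & vge 1 (r - x),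
      forall r r', r \in rs -> r' \in rs -> vge 1 (r - r') -> r = r'
    & residue_card pi = size rs].
Proof.
have := @compact_vge 0; rewrite compact_cover.
move=> /(_ F [set x | vge 0 x] (fun x => [set y | vge 1 (y - x)])) [|x x0|D' D'O D'c].
- move=> x _; rewrite openE => y yx; apply/nbhs_valP; exists 1 => z zy.
  by rewrite -[z](subrK y) /= -addrA; apply: (vgeD HF).
- by exists x => //=; rewrite subrr; exact: vge0.
(* the same choice for all the elements of a coset *)
pose rep (r : F) : F := xget 0 [set s | vge 1 (s - r)].
have repP r : vge 1 (rep r - r).
  by rewrite /rep; case: xgetP => // /(_ r) /=; rewrite subrr; case; exact: vge0.
have rep_eq r r' : vge 1 (r - r') -> rep r = rep r'.
  move=> rr'; congr xget; apply/seteqP; split=> s /= sr.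
    by rewrite -(subrK r s) -addrA; apply: (vgeD HF).
  by rewrite -(subrK r' s) -addrA; apply: (vgeD HF) => //; rewrite -opprB; apply: (vgeN HF).
have vge10 (x : F) : vge 1 x -> vge 0 x by exact: vge_le.
pose rs : seq F := undup [seq rep r | r <- D'].
have rs_int r : r \in rs -> vge 0 r.
  rewrite mem_undup => /mapP[s /D'O/set_mem s0 ->].
  by rewrite -(subrK s (rep s)); apply: (vgeD HF) => //; exact/vge10/repP.
have rs_ex (x : F) : vge 0 x -> exists2 r, r \in rs & vge 1 (r - x).
  move=> /D'c[s sD' /= xs]; exists (rep s); first by rewrite mem_undup map_f.
  by rewrite -(subrK s (rep s)) -addrA; apply: (vgeD HF) (repP s) _; rewrite -opprB; apply: (vgeN HF).
have rs_inj r r' : r \in rs -> r' \in rs -> vge 1 (r - r') -> r = r'.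
  rewrite !mem_undup => /mapP[s _ ->] /mapP[s' _ ->] ss'; apply: rep_eq.
  rewrite -(subrK (rep s) s) -addrA; apply: (vgeD HF).
    by rewrite -opprB; apply: (vgeN HF).
  rewrite -(subrK (rep s') (rep s)) -addrA; apply: (vgeD HF) => //; exact: repP.
exists rs; split=> //; first exact: undup_uniq.
pose coset (x : F) : set F := [set x + y | y in piO pi 1].
have cosetE x x' : vge 1 (x - x') -> coset x = coset x'.
  move=> xx'; apply/seteqP; split=> _ [y /(piOE HF Hpi) y1 <-] /=.
    exists (x - x' + y); last by rewrite addrA addrCA subrr addr0.
    by apply/(piOE HF Hpi); apply: (vgeD HF).
  exists (x' - x + y); last by rewrite addrA addrCA subrr addr0.
  by apply/(piOE HF Hpi); apply: (vgeD HF) => //; rewrite -opprB; apply: (vgeN HF).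
rewrite /residue_card.
have -> : [set coset x | x in @ringO F0 val] = [set` [fset z in [seq coset r | r <- rs]]%fset].
  apply/seteqP; split=> [_ [x x0 <-]|z] /=.
    by have [r rrs rx] := rs_ex x x0; rewrite inE -(cosetE _ _ rx) map_f.
  by rewrite inE => /mapP[r /rs_int r0 ->]; exists r.
rewrite set_fsetK card_fseq undup_id ?size_map // map_inj_in_uniq ?undup_uniq //.
move=> r r' rrs r'rs E; apply: rs_inj => //.
have : coset r' r by rewrite -E; exists 0; rewrite ?addr0 //; apply/(piOE HF Hpi); exact: vge0.
by case=> y /(piOE HF Hpi) y1 <-; rewrite addrC addKr.
Qed.

Lemma residue_card_gt1 (rs : seq F) :
  (forall r, r \in rs -> vge 0 r) ->
  (forall x : F, vge 0 x -> exists2 r, r \in rs & vge 1 (r - x)) ->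
  (1 < size rs)%N.
Proof.
move=> rs_int rs_ex.
have [r r_rs r0] := rs_ex 0 (vge0 val 0); have [s s_rs s1] := rs_ex 1 (vge1 HF).
case: rs r_rs s_rs {rs_int rs_ex} => [//|t [|//]]; rewrite !inE => /eqP rt /eqP st.
exfalso; apply: (vis_notS (vis1 HF)); rewrite add0r.
by have := vgeB HF r0 s1; rewrite rt st subr0 subKr.
Qed.

Implicit Types (g u k w : 'M[F]_2).

Definition lcoset w : set (borelM2 val) := [set u | exists2 k, iwahori pi k & u = w *m k].

Lemma open_measurableM2 (A : set 'M[F]_2) : open A -> measurable (A : set (borelM2 val)).
Proof. exact: sub_sigma_algebra. Qed.

Lemma mx_vge_bound m n (g : 'M[F]_(m, n)) : exists M : nat, forall i j, vge (- M%:Z) (g i j).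
Proof.
exists (\sum_i \sum_j `|val (g i j)|)%N => i j; right.
have : (`|val (g i j)| <= \sum_i \sum_j `|val (g i j)|)%N.
  by rewrite (bigD1 i) //= (bigD1 j) //= -addnA leq_addr.
by lia.
Qed.

Lemma measurable_SL2 : measurable (@SL2 F0 val : set (borelM2 val)).
Proof.
rewrite -[X in measurable X]setCK; apply: measurableC; apply: open_measurableM2.
rewrite openE => u /= /SL2E Su; apply/nbhs_mxP.
set d := (X in X = 1) in Su.
have [M uM] := mx_vge_bound u.
exists (Num.max 0 (val (d - 1) + M%:Z + 1)) => y yu.
have yu0 i j : vge 0 (y i j - u i j) by apply: vge_le (yu i j); rewrite le_max lexx.
have {}yu i j : vge (val (d - 1) + M%:Z + 1) (y i j - u i j).
  by apply: vge_le (yu i j); rewrite le_max lexx orbT.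
have d1 : vis (val (d - 1)) (d - 1) by split=> //; rewrite subr_eq0; apply/eqP.
have small i j i' j' : vge (val (d - 1) + 1)
    (u i' j' * (y i j - u i j) + (y i' j' - u i' j') * (y i j - u i j)
     + (y i' j' - u i' j') * u i j).
  apply: (vgeD HF); first apply: (vgeD HF).
  - by apply: (vgeM HF (uM i' j') (yu i j)); lia.
  - by apply: (vgeM HF (yu0 i' j') (yu i j)); lia.
  - by apply: (vgeM HF (yu i' j') (uM i j)); lia.
have := visDr HF d1 (vgeB HF (small 1 1 0 0) (small 1 0 0 1)).
case=> dy _ /SL2E Sy; move/negP: dy; apply; apply/eqP.
by rewrite -[in d - 1]Sy /d; ring.
Qed.

Lemma lcosetE w : SL2 w -> lcoset w = @SL2 F0 val `&` [set u | iwahori pi (invmx w *m u)].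
Proof.
move=> Sw; have wu := SL2_unit Sw; apply/seteqP; split=> [_ [k kI ->]|u [Su uI]] /=.
  by rewrite mulKmx //; split=> //; apply: SL2M => //; exact: iwahori_SL2 kI.
by exists (invmx w *m u) => //; rewrite mulKVmx.
Qed.

(** The defining inequalities of w I are stable under perturbations that are small with respect to the
entries of w^-1. *)
Lemma lcoset_open w : SL2 w -> open [set u : 'M[F]_2 |
  [/\ vge 0 ((invmx w *m u) 0 0), vge 0 ((invmx w *m u) 0 1),
      vge 1 ((invmx w *m u) 1 0) & vge 0 ((invmx w *m u) 1 1)]].
Proof.
move=> Sw; rewrite openE => u [u00 u01 u10 u11]; apply/nbhs_mxP.
have [M wM] := mx_vge_bound (invmx w).
exists (1 + M%:Z) => y yu.
have E n i j : n <= 1 -> vge n ((invmx w *m u) i j) -> vge n ((invmx w *m y) i j).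
  move=> n1 un; rewrite -[y](subrK u) mulmxDr mxE; apply: (vgeD HF) => //.
  rewrite mulmx2E; apply: (vgeD HF).
    by apply: (vgeM HF (wM i 0) (m := 1 + M%:Z)); rewrite ?mxE; [exact: yu|lia].
  by apply: (vgeM HF (wM i 1) (m := 1 + M%:Z)); rewrite ?mxE; [exact: yu|lia].
by split; apply: E.
Qed.

Lemma measurable_lcoset w : SL2 w -> measurable (lcoset w).
Proof.
move=> Sw; have mO := open_measurableM2 (lcoset_open Sw).
rewrite lcosetE //.
rewrite (_ : _ `&` _ = @SL2 F0 val `&` [set u : 'M[F]_2 |
  [/\ vge 0 ((invmx w *m u) 0 0), vge 0 ((invmx w *m u) 0 1),
      vge 1 ((invmx w *m u) 1 0) & vge 0 ((invmx w *m u) 1 1)]]).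
  by apply: measurableI => //; exact: measurable_SL2.
apply/seteqP; split=> u [Su] /=.
  by move=> /(iwahoriE HF Hpi)[].
by move=> [u00 u01 u10 u11]; split=> //; apply/(iwahoriE HF Hpi); split=> //; apply: SL2M => //; exact: SL2V.
Qed.

Lemma mu_lcoset (R : realType) (mu : {measure set (borelM2 val) -> \bar R}) w :
  normalized_haar pi mu -> SL2 w -> mu (lcoset w) = 1%E.
Proof.
move=> [inv mu1] Sw; rewrite -mu1.
have I1 : lcoset 1%:M = iwahori pi.
  by apply/seteqP; split=> [_ [k kI ->]|k kI]; rewrite ?mul1mx //; exists k; rewrite ?mul1mx.
rewrite -(inv w (iwahori pi)) //.
- by congr (mu _); apply/seteqP; split=> [_ [k kI ->]|_ [k kI <-]]; exists k.
- by rewrite -I1; apply: measurable_lcoset; exact: SL2_1.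
- by move=> k; exact: iwahori_SL2.
Qed.

End Topology.

(** * Summation over the lengths *)

Lemma linear_bound (R : realFieldType) (C z E E1 : R) :
  0 <= C -> 0 < z -> z <= 2^-1 -> 0 <= E -> E1 <= E + 1 ->
  C + (z * (C * (E1 + 4)) + (1 - z) * (C * (E + 1))) <= C * (E + 4).
Proof.
move=> C0 z0 z2 E0 E1E.
have h1 : z * (C * (E1 + 4)) <= z * (C * (E + 5)).
  by rewrite ler_pM2l // ler_wpM2l //; lra.
have h2 : C * (4 * z) <= C * 2 by rewrite ler_wpM2l //; lra.
by move: h1 h2; nra.
Qed.

Section PastSum.
Variables (R : realType) (g : int -> R) (C : R) (N : int).
Hypothesis gC : forall e, `|g e| <= C.
Hypothesis gN : forall e, e < N -> g e = 0.

Let C0 : 0 <= C. Proof. exact: le_trans (gC 0). Qed.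

Lemma sum_past_le M e : \sum_(m < M) `|g (e - m%:Z)| <= C * (`|e - N| + 1)%:~R.
Proof.
have small e' M' : e' < N -> \sum_(m < M') `|g (e' - m%:Z)| = 0.
  by move=> eN; rewrite big1 // => m _; rewrite gN ?normr0 //; lia.
have sumk k M' : \sum_(m < M') `|g (N + k%:Z - 1 - m%:Z)| <= C * k%:R.
  elim: k M' => [|k IHk] M'; first by rewrite small ?mulr0 //; lia.
  case: M' => [|M']; first by rewrite big_ord0 mulr_ge0.
  rewrite big_ord_recl -[k.+1]add1n natrD mulrDr mulr1; apply: lerD => //.
  apply: le_trans (IHk M'); apply: ler_sum => i _; rewrite le_eqVlt; apply/orP; left; apply/eqP.
  by congr (`|g _|); rewrite lift0; lia.
have [eN|Ne] := ltrP e N; first by rewrite small // mulr_ge0 // ler0z; lia.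
have := sumk (absz (e - N)).+1 M.
rewrite (_ : N + _ - 1 = e); last by lia.
by have -> : (absz (e - N)).+1%:R = (e - N + 1)%:~R :> R by rewrite pmulrn; congr (1 *~ _); lia.
Qed.

End PastSum.

Section MatchedSum.
Variable R : realType.

(** Let x be a vector of index e matched with a, and h a function with value g f on the orbit of index
f. Then [matched_sum q g m e] is the sum of h (w^-1 x) over the cosets w I in the double coset of
[alt a m]: one of the q cosets in the first step moves x to the orbit e + 1, where the letter that
follows is again matched, and the q - 1 other ones leave it in the orbit e, where the remaining m letters
are unmatched. *)
Fixpoint matched_sum (q : R) (g : int -> R) (m : nat) (e : int) : R :=
  if m is m'.+1 then matched_sum q g m' (e + 1) + (q - 1) * q ^+ m' * g (e - m'%:Z)
  else g e.

Variables (q : R) (g : int -> R) (C : R) (N : int).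
Hypothesis q2 : 2 <= q.
Hypothesis gC : forall e, `|g e| <= C.
Hypothesis gN : forall e, e < N -> g e = 0.

Local Notation z := (q^-1).
Let q0 : 0 < q. Proof. exact: lt_le_trans q2. Qed.
Let z0 : 0 < z. Proof. by rewrite invr_gt0. Qed.
Let z2 : z <= 2^-1. Proof. by rewrite lef_pV2 // posrE. Qed.
Let z1 : 0 <= 1 - z.
Proof. by rewrite subr_ge0 (le_trans z2) // invf_le1 // ler1n. Qed.
Let zq : z * q = 1. Proof. by rewrite mulVf // gt_eqF. Qed.
Let C0 : 0 <= C. Proof. exact: le_trans (gC 0). Qed.

Definition scaled_sum (m : nat) (e : int) : R := (- z) ^+ m * matched_sum q g m e.

Lemma scaled_sumS m e : scaled_sum m.+1 e =
  - (z * scaled_sum m (e + 1)) - (1 - z) * ((-1) ^+ m * g (e - m%:Z)).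
Proof.
rewrite /scaled_sum /= exprS (exprNn z m).
have : z ^+ m * q ^+ m = 1 by rewrite -exprMn zq expr1n.
move: (matched_sum _ _ _ _) (z ^+ m) (q ^+ m) ((-1) ^+ m) (g _) => J zm qm s ge E.
have -> : - z * (s * zm) * (J + (q - 1) * qm * ge)
  = - (z * (s * zm * J)) - (z * q - z) * (s * (zm * qm) * ge) by ring.
by rewrite E zq mulr1.
Qed.

(** The recursion for [matched_sum] gives one for the partial sums, which preserves a bound that is
linear in e: the factor 1/q <= 1/2 absorbs the shift from e to e + 1. *)
Lemma sum_scaled_le M e : \sum_(m < M) `|scaled_sum m e| <= C * (`|e - N| + 4)%:~R.
Proof.
elim: M e => [|M IHM] e; first by rewrite big_ord0 mulr_ge0 // ler0z; lia.
rewrite big_ord_recl.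
have -> : `|scaled_sum 0 e| = `|g e| by rewrite /scaled_sum expr0 mul1r.
have step : \sum_(i < M) `|scaled_sum (lift ord0 i) e|
    <= z * (C * (`|e + 1 - N| + 4)%:~R) + (1 - z) * (C * (`|e - N| + 1)%:~R).
  apply: (@le_trans _ _ (z * (\sum_(i < M) `|scaled_sum i (e + 1)|)
     + (1 - z) * \sum_(i < M) `|g (e - i%:Z)|)).
    rewrite !mulr_sumr -big_split /=; apply: ler_sum => i _.
    rewrite ?lift0 ?/bump ?leq0n ?add1n scaled_sumS; apply: le_trans (ler_normB _ _) _.
    rewrite normrN !normrM !normrX normrN1 expr1n mul1r.
    by rewrite (ger0_norm (ltW z0)) (ger0_norm z1).
  by apply: lerD; apply: ler_wpM2l; rewrite ?IHM ?(sum_past_le gC gN) ?(ltW z0).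
apply: le_trans (lerD (gC e) step) _; rewrite !(intrD _ _ 4) !(intrD _ _ 1).
have E0 : 0 <= `|e - N|%:~R :> R by rewrite ler0z.
have E1 : `|e + 1 - N|%:~R <= `|e - N|%:~R + 1 :> R.
  by rewrite -(intrD _ _ 1) ler_int; lia.
exact: linear_bound.
Qed.

Variable s : int -> R.
Hypothesis sg : forall e, s e + s (e - 1) = g e.
Hypothesis sN : forall e, e < N -> s e = 0.

Lemma sum_alternating M e :
  \sum_(m < M) (-1) ^+ m * g (e - m%:Z) = s e - (-1) ^+ M * s (e - M%:Z).
Proof.
elim: M => [|M IHM]; first by rewrite big_ord0 expr0 mul1r subr0 subrr.
rewrite big_ord_recr /= IHM -(sg (e - M%:Z)) exprS.
rewrite (_ : e - M.+1%:Z = e - M%:Z - 1); last by lia.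
ring.
Qed.

Lemma sum_alternating_eq M e : e - M%:Z < N ->
  \sum_(m < M) (-1) ^+ m * g (e - m%:Z) = s e.
Proof. by move=> eM; rewrite sum_alternating (sN eM) mulr0 subr0. Qed.

Lemma alternating_le e : `|s e| <= C * (`|e - N| + 1)%:~R.
Proof.
rewrite -(@sum_alternating_eq (absz (e - N)).+1); last by lia.
apply: le_trans (ler_norm_sum _ _ _) _; apply: le_trans (sum_past_le gC gN _ _).
by apply: ler_sum => i _; rewrite normrM normrX normrN1 expr1n mul1r.
Qed.

Import numFieldNormedType.Exports.

Lemma cvg_alternating e :
  series (fun m => (-1) ^+ m * g (e - m%:Z)) @ \oo --> s e.
Proof.
rewrite seriesEord; apply: cvg_near_cst.
exists (absz (e - N)).+1 => // M /= eM; rewrite sum_alternating_eq //; lia.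
Qed.

Lemma is_cvg_scaled e : cvgn (series (scaled_sum ^~ e)).
Proof.
apply: normed_cvg; apply: nondecreasing_is_cvgn.
  by apply: nondecreasing_series => m _ _; exact: normr_ge0.
exists (C * (`|e - N| + 4)%:~R) => _ [M _ <-].
by have := sum_scaled_le M e; rewrite -(big_mkord xpredT (fun m => `|scaled_sum m e|)).
Qed.

(** The recursion for [matched_sum], summed over all m *)
Lemma lim_scaledS e : limn (series (scaled_sum ^~ e))
  = g e - z * limn (series (scaled_sum ^~ (e + 1))) - (1 - z) * s e.
Proof.
apply: cvg_lim => //; rewrite -cvg_shiftS /=.
rewrite (_ : (fun _ => _) = (fun M => g e - z * series (scaled_sum ^~ (e + 1)) M
    - (1 - z) * series (fun m => (-1) ^+ m * g (e - m%:Z)) M)); last first.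
  apply/funext => M; rewrite seriesEord /= big_ord_recl.
  rewrite {1}/scaled_sum expr0 mul1r -addrA; congr (_ + _).
  rewrite !seriesEord /= !mulr_sumr -opprD -big_split -sumrN.
  by apply: eq_bigr => i _; rewrite ?lift0 ?/bump ?leq0n ?add1n scaled_sumS opprD.
apply: cvgB; last by apply: cvgMl_tmp; exact: cvg_alternating.
by apply: cvgB; [exact: cvg_cst|apply: cvgMl_tmp; exact: is_cvg_scaled].
Qed.

Lemma lim_scaled_le e : `|limn (series (scaled_sum ^~ e))| <= C * (`|e - N| + 4)%:~R.
Proof.
rewrite -lim_norm; last exact: is_cvg_scaled.
apply: limr_le; first by apply: is_cvg_norm; exact: is_cvg_scaled.
near=> M; rewrite seriesEord; apply: le_trans (ler_norm_sum _ _ _) _.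
exact: sum_scaled_le.
Unshelve. all: by end_near. Qed.

(** By [lim_scaledS], the difference D of the two sides satisfies D e = - D (e + 1) / q. As it grows at
most linearly, it vanishes. *)
Lemma lim_scaled e : limn (series (scaled_sum ^~ e)) = s (e - 1).
Proof.
pose D e' := limn (series (scaled_sum ^~ e')) - s (e' - 1).
have DS e' : D e' = - (z * D (e' + 1)).
  rewrite /D lim_scaledS (_ : e' + 1 - 1 = e'); last by lia.
  rewrite -(sg e'); ring.
have D_le e' : `|D e'| <= 2 * C * (`|e' - N| + 4)%:~R.
  apply: le_trans (ler_normB _ _) _.
  apply: le_trans (lerD (lim_scaled_le _) (alternating_le _)) _.
  rewrite -mulrDr [2 * C]mulrC -mulrA ler_wpM2l //.
  by rewrite -[2]/(2%:~R) -intrM -intrD ler_int; lia.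
(* 5/8 = 1/2 * 5/4, and `|e + 1 - N| + 4 <= 5/4 * (`|e - N| + 4) *)
have D_geo k e' : `|D e'| <= (5 / 8) ^+ k * (2 * C * (`|e' - N| + 4)%:~R).
  elim: k e' => [|k IHk] e'; first by rewrite expr0 mul1r.
  rewrite DS normrN normrM (gtr0_norm z0).
  apply: le_trans (ler_wpM2l (ltW z0) (IHk (e' + 1))) _.
  rewrite exprS; set p := _ ^+ k; have p0 : 0 <= p by rewrite exprn_ge0 //; lra.
  have le1 : (`|e' + 1 - N| + 4)%:~R <= 5 / 4 * (`|e' - N| + 4)%:~R :> R.
    rewrite -(@ler_pM2l _ 4) // mulrA (_ : 4 * (5 / 4) = 5 :> R); last by field.
    by rewrite -[4]/(4%:~R) -[5]/(5%:~R) -!intrM ler_int; lia.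
  set A := _%:~R in le1 *; set B := _%:~R in le1 *.
  have A0 : 0 <= A by rewrite ler0z; lia.
  have -> : z * (p * (2 * C * A)) = (p * (2 * C)) * (z * A) by ring.
  have -> : 5 / 8 * p * (2 * C * B) = (p * (2 * C)) * (2^-1 * (5 / 4 * B)) by field.
  apply: ler_wpM2l; first by rewrite !mulr_ge0.
  by apply: ler_pM => //; exact: ltW.
apply/eqP; rewrite -subr_eq0 -normr_le0 -/(D e).
set c := 2 * C * (`|e - N| + 4)%:~R.
have cv : geometric c (5 / 8) @ \oo --> 0.
  by apply: cvg_geometric; rewrite ger0_norm; lra.
rewrite -(cvg_lim _ cv) //; apply: limr_ge; first by apply/cvg_ex; exists 0.
by apply: nearW => k; rewrite /geometric /= mulrC; exact: D_geo.
Qed.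

End MatchedSum.

(** * Integrals of functions that are constant on countably many pieces *)

Section Pieces.
Import numFieldNormedType.Exports.
Context (d : measure_display) (X : measurableType d) (R : realType).
Variable mu : {measure set X -> \bar R}.
Variables (I : choiceType) (A : I -> set X) (L : nat -> seq I) (S : set X).
Variables (f : X -> R) (c : I -> R) (B l : R).
Hypothesis mS : measurable S.
Hypothesis mA : forall m i, i \in L m -> measurable (A i).
Hypothesis AS : forall m i, i \in L m -> A i `<=` S.
Hypothesis muA : forall m i, i \in L m -> mu (A i) = 1%E.
Hypothesis L_uniq : forall m, uniq (L m).
Hypothesis A_disj : forall m n i j u, i \in L m -> j \in L n -> A i u -> A j u ->
  m = n /\ i = j.
Hypothesis fA : forall m i u, i \in L m -> A i u -> f u = c i.
Hypothesis f0 : forall u, S u -> (forall m i, i \in L m -> ~ A i u) -> f u = 0.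
Hypothesis cB : forall M, \sum_(m < M) \sum_(i <- L m) `|c i| <= B.
Hypothesis cl : series (fun m => \sum_(i <- L m) c i) @ \oo --> l.

Let A' m i : set X := if i \in L m then A i else set0.
Let E m : set X := \big[setU/set0]_(i <- L m) A' m i.
Let D := \bigcup_m E m.

Let mA' m i : measurable (A' m i).
Proof. by rewrite /A'; case: ifP => // iL; exact: mA iL. Qed.

Let mE m : measurable (E m).
Proof. by apply: bigsetU_measurable => i _; exact: mA'. Qed.

Let EP m u : E m u <-> exists2 i, i \in L m & A i u.
Proof.
rewrite /E -bigcup_seq; split=> [[i /= iL]|[i iL Ai]].
  by rewrite /A' iL; exists i.
by exists i => //=; rewrite /A' iL.
Qed.

Let trivA' m : trivIset [set` L m] (A' m).
Proof.
move=> i j /= iL jL [u []]; rewrite /A' iL jL => Ai Aj.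
by have [] := A_disj iL jL Ai Aj.
Qed.

Let trivE : trivIset setT E.
Proof.
move=> m n _ _ [u [/EP[i iL Ai] /EP[j jL Aj]]].
by have [] := A_disj iL jL Ai Aj.
Qed.

Let mfE m (h : X -> R) (k : I -> R) : (forall i u, i \in L m -> A i u -> h u = k i) ->
  measurable_fun (E m) (EFin \o h : X -> \bar R).
Proof.
move=> hk; rewrite /E.
suff: forall s : seq I, {subset s <= L m} ->
    measurable_fun (\big[setU/set0]_(i <- s) A' m i) (EFin \o h : X -> \bar R) by apply.
elim=> [|i s IHs] sL; first by rewrite big_nil; exact: measurable_fun_set0.
have iL : i \in L m by apply: sL; rewrite mem_head.
rewrite big_cons; apply/measurable_funU => //.
  by apply: bigsetU_measurable => j _; exact: mA'.
split; last by apply: IHs => j js; apply: sL; rewrite inE js orbT.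
apply: (@eq_measurable_fun _ _ _ _ _ (cst (k i)%:E)); last exact: measurable_cst.
by move=> u; rewrite inE /A' iL => Ai /=; rewrite (hk i).
Qed.

Let int_E m (h : X -> R) (k : I -> R) : (forall i u, i \in L m -> A i u -> h u = k i) ->
  (\int[mu]_(u in E m) (h u)%:E = (\sum_(i <- L m) k i)%:E)%E.
Proof.
move=> hk; rewrite /E integral_bigsetU_EFin //; last exact: mfE hk.
rewrite -sumEFin big_seq [RHS]big_seq; apply: eq_bigr => i iL; rewrite /A' iL.
rewrite (@eq_integral _ _ _ _ _ (cst (k i)%:E)); last first.
  by move=> u; rewrite inE => Ai /=; rewrite (hk i).
by rewrite integral_cst; [rewrite (muA iL) mule1|exact: mA iL].
Qed.

Let mD : measurable D.
Proof. exact: bigcup_measurable. Qed.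

Let DS : D `<=` S.
Proof. by move=> u [m _ /EP[i iL]]; exact: AS iL u. Qed.

Let mf : measurable_fun D (EFin \o f : X -> \bar R).
Proof.
by apply/measurable_fun_bigcup => // m; apply: (mfE (k := c)) => i u; exact: fA.
Qed.

Let intD : mu.-integrable D (EFin \o f).
Proof.
apply/integrableP; split=> //=.
rewrite ge0_integral_bigcup //; last first.
  apply/measurable_fun_bigcup => // m.
  apply: (mfE (h := fun u => `|f u|) (k := fun i => `|c i|)) => i u iL Ai.
  by rewrite (fA iL Ai).
apply: (@le_lt_trans _ _ B%:E); last exact: ltry.
apply: lime_le; first by apply: is_cvg_nneseries => n _ _; exact: integral_ge0.
apply: nearW => M; rewrite big_mkord.
rewrite (eq_bigr (fun m : 'I_M => (\sum_(i <- L m) `|c i|)%:E)).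
  rewrite sumEFin lee_fin; exact: cB.
move=> m _; rewrite -(@int_E m (fun u => `|f u|)); first by [].
by move=> i u iL Ai; rewrite (fA iL Ai).
Qed.

Let f_restrict : {in S, (EFin \o f) \_ D =1 EFin \o f}.
Proof.
move=> u; rewrite inE => Su; rewrite /patch; case: ifPn => // uD.
rewrite /= f0 // => m i iL Ai; move/negP: uD; apply; rewrite inE.
by exists m => //; apply/EP; exists i.
Qed.

Lemma integrable_pieces : mu.-integrable S (EFin \o f).
Proof.
apply: (eq_integrable mS _ _ f_restrict).
apply: (@integrableS _ _ _ _ setT) => //.
exact: ((integrable_mkcond _ mD).1 intD).
Qed.

Lemma integral_pieces : Rintegral mu S f = l.
Proof.
rewrite /Rintegral.
have -> : (\int[mu]_(u in S) (f u)%:E = \int[mu]_(u in D) (f u)%:E)%E.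
  rewrite -(eq_integral _ _ f_restrict) -integral_mkcondr; congr (integral _ _ _).
  by rewrite setIidr.
rewrite integral_bigcup //.
rewrite (@eq_eseriesr _ _ (fun m => (\sum_(i <- L m) c i)%:E)); last first.
  by move=> m _; rewrite (int_E (k := c)) // => i u; exact: fA.
rewrite (_ : (fun _ => _) = EFin \o series (fun m => \sum_(i <- L m) c i)); last first.
  by apply/funext => M; rewrite /series /= sumEFin.
by rewrite EFin_lim ?(cvg_lim _ cl) //; apply/cvg_ex; exists l.
Qed.

End Pieces.

(** * Convolution with t_(s_0) and t_(s_1) *)

Section HeckeAction.
Variables (F0 : fieldType) (val : F0 -> int).
Local Notation F := (valued val).
Hypothesis HF : nonarchimedean_local_field val.
Variable pi : F.
Hypothesis Hpi : uniformizer pi.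
Variable rs : seq F.
Hypothesis rs_uniq : uniq rs.
Hypothesis rs_int : forall r, r \in rs -> vge 0 r.
Hypothesis rs_ex : forall x : F, vge 0 x -> exists2 r, r \in rs & vge 1 (r - x).
Hypothesis rs_inj : forall r r', r \in rs -> r' \in rs -> vge 1 (r - r') -> r = r'.
Variable R : realType.
Local Notation q := ((size rs)%:R : R).
Local Notation reps := (reps pi rs).
Local Notation cell := (cell pi rs).

(** The index of w^-1 x is computed one root element at a time: for unmatched x all the q choices give
the same shift, and for matched x exactly one of them stands out, as in the recursion for
[matched_sum]. *)
Lemma reps_sum (g : int -> R) a m (x : 'cV[F]_2) : x != 0 ->
  \sum_(w <- reps a m) g (oidx (invmx w *m x)) =
  if matched a (oidx x) then matched_sum q g m (oidx x)
  else q ^+ m * g (oidx x - m%:Z).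
Proof.
elim: m a x => [|m IHm] a x x0.
  by rewrite big_seq1 invmx1 mul1mx /= subr0 expr0 mul1r if_same.
pose y r := invmx (root_gen pi a r) *m x.
have y0 r : y r != 0 by apply: invmx_neq0 => //; exact: root_gen_SL2.
transitivity (\sum_(r <- rs) if matched (~~ a) (oidx (y r))
    then matched_sum q g m (oidx (y r)) else q ^+ m * g (oidx (y r) - m%:Z)).
  rewrite /= big_allpairs_dep big_seq [RHS]big_seq; apply: eq_bigr => r rrs.
  rewrite -IHm // big_seq [RHS]big_seq; apply: eq_bigr => w wr.
  by rewrite invmx_mulmx //; [exact: root_gen_SL2|exact: (reps_SL2 Hpi wr)].
have [ax|ax] := boolP (matched a (oidx x)); last first.
  rewrite big_seq (eq_bigr (fun=> q ^+ m * g (oidx x - m.+1%:Z))); last first.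
    move=> r /rs_int r0; rewrite (oidx_unmatched HF Hpi x0 r0 ax).
    rewrite matched_opp matchedB1 (negPf ax) /=; congr (_ * g _); lia.
  by rewrite -big_seq big_const_seq count_predT iter_addr_0 exprS -mulrA mulr_natl.
have [r0 r0rs r0x] := rs_ex (slope_int HF Hpi x0 ax).
set K := q ^+ m * g (oidx x - m%:Z); set J := matched_sum q g m (oidx x + 1).
rewrite big_seq (eq_bigr (fun r => K + (if r == r0 then J - K else 0))); last first.
  move=> r rrs; have [E1 E2] := oidx_matched HF Hpi x0 (rs_int rrs) ax.
  have [rr0|rr0] := eqVneq r r0.
    rewrite rr0 in E1 *; rewrite E1 // matchedD1 matched_opp negbK ax.
    by rewrite [RHS]addrC subrK.
  rewrite E2; first by rewrite matched_opp ax addr0.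
  move=> rx; move/eqP: rr0; apply; apply: rs_inj => //.
  by rewrite -(subrK (slope pi a x) r) -addrA; apply: (vgeD HF) => //;
     rewrite -opprB; exact: (vgeN HF).
rewrite -big_seq big_split /= big_const_seq count_predT iter_addr_0.
rewrite (bigD1_seq r0) //= eqxx big1 ?addr0 => [|r /negPf-> //].
rewrite -[K *+ _]mulr_natl [RHS]/= -/J -[in RHS]mulrA -/K; ring.
Qed.

Variables (H : algType laurent) (T : affW -> H).
Hypothesis HT : is_hecke_algebra T.
Hypothesis rs_card : residue_card pi = size rs.

Let q2 : 2 <= q.
Proof. by rewrite ler_nat; exact: (residue_card_gt1 HF rs_int rs_ex). Qed.

Let q0 : 0 < q. Proof. exact: lt_le_trans q2. Qed.

(** The value on the double coset of [alt b m] of the function t_(s_a) *)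
Definition tcoef (a b : bool) (m : nat) : R :=
  (if (b == a) && (m != 0) then - q else 1) * (- q^-1) ^+ m / (q + 1).

Lemma tcoefE a b m :
  rational_value (bseries T (gen a) (alt b m)) (Num.sqrt (residue_card pi)%:R) = tcoef a b m.
Proof.
rewrite rs_card (bseries_value a (alt b m) HT q0) /tcoef /order_of.
have qN0 : q != 0 by rewrite gt_eqF.
have q1N0 : q + 1 != 0 by rewrite gt_eqF // addr_gt0.
have qmN0 k : q ^+ k != 0 by rewrite expf_neq0.
have zE k : (- q^-1) ^+ k = (-1) ^+ k / q ^+ k by rewrite (exprNn (q^-1)) exprVn.
have S : starts a (alt b m) = (b == a) && (m != 0).
  by case: m => [|m]; rewrite ?alt0 ?starts1 ?andbF ?starts_alt ?andbT.
rewrite S ell_alt zE; case: ifP => _; rewrite !exprS; move: (qmN0 m);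
  move: (q ^+ m) ((-1) ^+ m) => Q s Q0; field; rewrite ?Q0 ?qN0 ?q1N0 //.
Qed.

Lemma t_fun_cell a b m u : cell b m u -> t_fun pi R T (gen a) u = tcoef a b m.
Proof.
move=> ub; rewrite /t_fun (@fsbigT_seq _ _ [:: alt b m]) //.
  rewrite big_seq1 tcoefE indicE mem_set ?mulr1 //.
  by rewrite (double_cosetE HF Hpi rs_int rs_ex).
move=> y; rewrite inE (altE y) => yb; rewrite indicE memNset ?mulr0 //.
rewrite (double_cosetE HF Hpi rs_int rs_ex) => uy; move/eqP: yb; apply.
exact: (cell_inj HF Hpi rs_int uy ub).
Qed.

Lemma t_fun_notcell a u : (forall b m, ~ cell b m u) -> t_fun pi R T (gen a) u = 0.
Proof.
move=> uN; rewrite /t_fun fsbig1 // => y _; rewrite (altE y) indicE memNset ?mulr0 //.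
by rewrite (double_cosetE HF Hpi rs_int rs_ex); exact: uN.
Qed.

(** The summation over W is organized by lengths; the two double cosets of length m > 0 are taken
together, as exactly one of them is matched with a given orbit. *)
Definition reps_length (m : nat) : seq 'M[F]_2 :=
  if m is 0 then reps false 0 else reps false m ++ reps true m.

Lemma mem_reps_length m w : w \in reps_length m -> exists b, w \in reps b m.
Proof.
case: m => [|m]; first by exists false.
by rewrite mem_cat => /orP[wr|wr]; [exists false|exists true].
Qed.

Lemma reps_length_mem b m w : w \in reps b m -> w \in reps_length m.
Proof. by case: m => [|m] // wr; rewrite mem_cat; case: b wr => ->; rewrite ?orbT. Qed.

Lemma reps_cell b m w k : w \in reps b m -> iwahori pi k -> cell b m (w *m k).
Proof. by move=> wr kI; exists w, k. Qed.

Lemma reps_length_disjoint m n w w' u : w \in reps_length m -> w' \in reps_length n ->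
  lcoset pi w u -> lcoset pi w' u -> m = n /\ w = w'.
Proof.
move=> /mem_reps_length[b wr] /mem_reps_length[b' w'r] [k kI uk] [k' k'I uk'].
have E : alt b m = alt b' n.
  apply: (cell_inj HF Hpi rs_int (u := u)); first by rewrite uk; exact: reps_cell.
  by rewrite uk'; exact: reps_cell.
have mn : m = n by rewrite -(ell_alt b m) E ell_alt.
split=> //; rewrite -{}mn in w'r E.
case: m wr w'r E => [|m] wr w'r E; first by move: wr w'r; rewrite !inE => /eqP-> /eqP->.
move/eqP: E; rewrite alt_eq eqxx andbT => /eqP bb; rewrite -{}bb in w'r.
exact: (reps_disjoint HF Hpi rs_int rs_inj wr w'r kI k'I (etrans (esym uk) uk')).
Qed.

Lemma reps_length_uniq m : uniq (reps_length m).
Proof.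
have U b n := reps_uniq HF Hpi rs_int rs_inj rs_uniq b n.
case: m => [|m]; first exact: U.
rewrite -[reps_length _]/(reps false m.+1 ++ reps true m.+1) cat_uniq !U andbT andTb.
apply/hasPn => w wr; apply/negP => w'r.
have wI b : w \in reps b m.+1 -> cell b m.+1 w.
  by rewrite -{2}[w]mulmx1 => ?; apply: reps_cell => //; exact: (iwahori1 HF).
have /eqP := cell_inj HF Hpi rs_int (wI _ wr) (wI _ w'r).
by rewrite alt_eq.
Qed.

Variable mu : {measure set (borelM2 val) -> \bar R}.
Hypothesis Hmu : normalized_haar pi mu.
Variables (g s : int -> R) (C : R) (N : int).
Hypothesis gC : forall e, `|g e| <= C.
Hypothesis gN : forall e, e < N -> g e = 0.
Hypothesis sg : forall e, s e + s (e - 1) = g e.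
Hypothesis sN : forall e, e < N -> s e = 0.
Variables (a : bool) (x : 'cV[F]_2).
Hypothesis x0 : x != 0.

Let f (u : borelM2 val) : R := t_fun pi R T (gen a) u * g (oidx (invmx u *m x)).
Let e := oidx x.

Let f_reps b m w : w \in reps b m -> f w = tcoef a b m * g (oidx (invmx w *m x)).
Proof.
move=> wr; rewrite /f (t_fun_cell a (b := b) (m := m)) //.
by rewrite -[w]mulmx1; apply: reps_cell => //; exact: (iwahori1 HF).
Qed.

Let f_lcoset m w u : w \in reps_length m -> lcoset pi w u -> f u = f w.
Proof.
move=> /mem_reps_length[b wr] [k kI ->].
rewrite (f_reps wr) /f (t_fun_cell a (reps_cell wr kI)).
by rewrite (oidx_cosetE HF Hpi (reps_SL2 Hpi wr) kI).
Qed.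

Let f_out u : SL2 u -> (forall m w, w \in reps_length m -> ~ lcoset pi w u) -> f u = 0.
Proof.
move=> _ uN; rewrite /f t_fun_notcell ?mul0r // => b m [w [k [wr kI uE]]].
by apply: (uN _ _ (reps_length_mem wr)); exists k.
Qed.

Let sum_reps b m (h : int -> R) : \sum_(w <- reps b m) tcoef a b m * h (oidx (invmx w *m x))
  = tcoef a b m * (if matched b e then matched_sum q h m e else q ^+ m * h (e - m%:Z)).
Proof. by rewrite -mulr_sumr reps_sum. Qed.

Let z0 : 0 < q^-1. Proof. by rewrite invr_gt0. Qed.

Let zq m : (- q^-1) ^+ m * q ^+ m = (-1) ^+ m.
Proof. by rewrite -exprMn mulNr mulVf // gt_eqF. Qed.

(* alpha and beta are the factors (q + 1) * tcoef a b m / (- 1/q)^m, for m > 0, of the letters b that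
are matched with e and unmatched with e, respectively. *)
Let alpha : R := if matched a e then - q else 1.
Let beta : R := if matched a e then 1 else - q.

(* The last term corrects the case m = 0, in which the two double cosets coincide. *)
Let sum_length m : \sum_(w <- reps_length m) f w =
  (alpha * scaled_sum q g m e + beta * ((-1) ^+ m * g (e - m%:Z))
   + (m == 0)%:R * (q * g e)) / (q + 1).
Proof.
have sumf b n : \sum_(w <- reps b n) f w = tcoef a b n *
    (if matched b e then matched_sum q g n e else q ^+ n * g (e - n%:Z)).
  rewrite -sum_reps big_seq [RHS]big_seq; apply: eq_bigr => w; exact: f_reps.
case: m => [|m].
  rewrite -[reps_length 0]/(reps false 0) sumf /tcoef andbF /scaled_sum !expr0 /= subr0.
  by rewrite !mul1r if_same /alpha /beta; case: ifP => _; ring.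
rewrite -[reps_length _]/(reps false m.+1 ++ reps true m.+1) big_cat !sumf.
rewrite (_ : (m.+1 == 0) = false) // mul0r addr0 /tcoef !andbT /scaled_sum -zq /alpha /beta.
have -> : matched true e = ~~ matched false e by rewrite -matched_opp.
have -> : matched a e = (if a then ~~ matched false e else matched false e).
  by case: a; rewrite // -matched_opp.
move: (matched_sum _ _ _ _) (g _) (_ ^+ _) (q ^+ _) => J ge zm qm.
by case: a; case: (matched false e) => /=; field; rewrite gt_eqF // addr_gt0.
Qed.

Let sum_length_abs M : \sum_(m < M) \sum_(w <- reps_length m) `|f w|
  <= C * (`|e - N| + 4)%:~R + C * (`|e - N| + 1)%:~R.
Proof.
pose h e' := `|g e'|.
have hC e' : `|h e'| <= C by rewrite /h normr_id.
have hN e' : e' < N -> h e' = 0 by move=> /gN E; rewrite /h E normr0.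
have B1 := sum_scaled_le q2 hC hN M e.
have B2 := sum_past_le hC hN M e.
apply: le_trans (lerD B1 B2).
rewrite -big_split; apply: ler_sum => m _ /=.
have sumf b n : \sum_(w <- reps b n) `|f w| = `|tcoef a b n| *
    (if matched b e then matched_sum q h n e else q ^+ n * h (e - n%:Z)).
  rewrite -[in RHS](reps_sum h b n x0) mulr_sumr big_seq [RHS]big_seq.
  by apply: eq_bigr => w wr; rewrite (f_reps wr) normrM.
have h0 e' : 0 <= h e' by exact: normr_ge0.
have ms0 n e' : 0 <= matched_sum q h n e'.
  elim: n e' => [|n IHn] e' //=; rewrite addr_ge0 // !mulr_ge0 ?exprn_ge0 ?(ltW q0) //.
  by rewrite subr_ge0 (le_trans _ q2) // ler1n.
have t_le b n : `|tcoef a b n| <= q^-1 ^+ n.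
  rewrite /tcoef !normrM normrX normrN (gtr0_norm z0) normfV (gtr0_norm (addr_gt0 q0 ltr01)).
  rewrite mulrAC -[leRHS]mul1r ler_wpM2r ?exprn_ge0 ?(ltW z0) //.
  rewrite ler_pdivrMr ?addr_gt0 // mul1r; case: ifP => _.
    by rewrite normrN gtr0_norm // lerDl.
  by rewrite normr1 lerDr ltW.
have matched_le n e' : q^-1 ^+ n * matched_sum q h n e' = `|scaled_sum q h n e'|.
  by rewrite /scaled_sum normrM normrX normrN (gtr0_norm z0) ger0_norm.
have unmatched_le n e' : q^-1 ^+ n * (q ^+ n * h e') = `|h e'|.
  by rewrite mulrA -exprMn mulVf ?gt_eqF // expr1n mul1r ger0_norm.
have le_M b n : `|tcoef a b n| *
    (if matched b e then matched_sum q h n e else q ^+ n * h (e - n%:Z))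
    <= if matched b e then `|scaled_sum q h n e| else `|h (e - n%:Z)|.
  case: ifP => _; [rewrite -matched_le|rewrite -(unmatched_le n)]; apply: ler_wpM2r => //.
  by rewrite mulr_ge0 // exprn_ge0 // ltW.
case: (nat_of_ord m) => [|n].
  rewrite -[reps_length 0]/(reps false 0) sumf; apply: le_trans (le_M _ _) _.
  by case: ifP => _; rewrite ?lerDl ?lerDr.
rewrite -[reps_length _]/(reps false n.+1 ++ reps true n.+1) big_cat !sumf.
apply: le_trans (lerD (le_M _ _) (le_M _ _)) _.
have -> : matched true e = ~~ matched false e by rewrite -matched_opp.
by case: ifP => _ //=; rewrite addrC.
Qed.

Import numFieldNormedType.Exports.

Let cvg_lengths : series (fun m => \sum_(w <- reps_length m) f w) @ \oo -->
  (if matched a e then s e else s (e - 1)).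
Proof.
have -> : series (fun m => \sum_(w <- reps_length m) f w) = (fun M =>
    (alpha * series (fun m => scaled_sum q g m e) M
     + beta * series (fun m => (-1) ^+ m * g (e - m%:Z)) M
     + series (fun m => (m == 0)%:R * (q * g e)) M) / (q + 1)).
  apply/funext => M; rewrite /series /= !mulr_sumr -!big_split mulr_suml.
  by apply: eq_bigr => m _; rewrite sum_length.
have -> : (if matched a e then s e else s (e - 1))
    = (alpha * s (e - 1) + beta * s e + q * g e) / (q + 1).
  have q1 : q + 1 != 0 by rewrite gt_eqF // addr_gt0.
  by rewrite -sg /alpha /beta; case: ifP => _; field.
apply: cvgMr_tmp; apply: cvgD; first apply: cvgD; first apply: cvgMl_tmp.
- by rewrite -(lim_scaled q2 gC gN sg sN e); exact: (is_cvg_scaled q2 gC gN).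
- by apply: cvgMl_tmp; exact: cvg_alternating sg sN e.
apply: cvg_near_cst; exists 1%N => // -[//|M] _.
rewrite /series /= big_nat_recl // mul1r big1 ?addr0 // => i _.
by rewrite mul0r.
Qed.

Lemma t_integrable : mu.-integrable (@SL2 F0 val) (EFin \o f).
Proof.
apply: (@integrable_pieces _ _ _ mu _ (lcoset pi) reps_length _ f f) => //.
- exact: measurable_SL2 HF.
- by move=> m w /mem_reps_length[b /(reps_SL2 Hpi)]; exact: measurable_lcoset.
- by move=> m w /mem_reps_length[b /(reps_SL2 Hpi) Sw]; exact: (mu_lcoset HF Hpi Hmu Sw).
- exact: reps_length_uniq.
- exact: reps_length_disjoint.
Qed.

(** The unmatched double cosets contribute the alternating sum s e, and the matched ones contribute
s (e - 1) by [lim_scaled]. *)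
Lemma t_integral : Rintegral mu (@SL2 F0 val) f = if matched a e then s e else s (e - 1).
Proof.
apply: (@integral_pieces _ _ _ mu _ (lcoset pi) reps_length _ f f) => //.
- by move=> m w /mem_reps_length[b /(reps_SL2 Hpi)]; exact: measurable_lcoset.
- move=> m w /mem_reps_length[b /(reps_SL2 Hpi) Sw] u [k /iwahori_SL2 Sk ->].
  exact: SL2M.
- by move=> m w /mem_reps_length[b /(reps_SL2 Hpi) Sw]; exact: (mu_lcoset HF Hpi Hmu Sw).
- exact: reps_length_uniq.
- exact: reps_length_disjoint.
Qed.

End HeckeAction.

(** * Invariant functions on the plane *)

Section Profiles.
Variables (F0 : fieldType) (val : F0 -> int).
Local Notation F := (valued val).
Hypothesis HF : nonarchimedean_local_field val.
Variable pi : F.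
Hypothesis Hpi : uniformizer pi.
Variable R : realType.
Implicit Types (g s : int -> R[i]) (x y : 'cV[F]_2) (h : 'cV[F]_2 -> R[i]).

Definition of_profile g : punctured val R := fun x => if x == 0 then 0 else g (oidx x).

(** The profiles of the functions in C_c^oo(F^2)^I: vanishing far away corresponds to compact support,
and being constant near 0 to local constancy at 0. *)
Definition tame g : Prop := exists N M c,
  (forall e : int, e < N -> g e = 0) /\ (forall e : int, M <= e -> g e = c).

Lemma vge_oidx N x : x != 0 -> (forall i j, vge N (x i j)) <-> 2 * N <= oidx x.
Proof.
move=> x0; case: (orbitP x0) => -[n [[x0n x1n] ->]]; split=> [xN|nN].
- by have /(vgeE _ (vis_neq0 x1n)) := xN 1 0; case: x1n => _ ->; lia.
- move=> i j; rewrite (ord1 j); elim/ord2P: i; first by apply: vge_le x0n; lia.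
  by apply: vge_le (vis_vge x1n); lia.
- by have /(vgeE _ (vis_neq0 x0n)) := xN 0 0; case: x0n => _ ->; lia.
- move=> i j; rewrite (ord1 j); elim/ord2P: i; first by apply: vge_le (vis_vge x0n); lia.
  by apply: vge_le x1n; lia.
Qed.

Lemma oidx_near x : x != 0 ->
  exists N, forall y, (forall i j, vge N (y i j - x i j)) -> y != 0 /\ oidx y = oidx x.
Proof.
move=> x0; case: (orbitP x0) => -[n [[x0n x1n] ->]]; exists (n + 1) => y yx.
  have yp : in_phi n y.
    split; last by rewrite -(subrK (x 1 0) (y 1 0)); exact: (visDl HF).
    rewrite -(subrK (x 0 0) (y 0 0)); apply: (vgeD HF) => //.
    by apply: vge_le (yx 0 0); lia.
  by split; [exact: in_phi_neq0 yp|exact: in_phi_oidx].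
have yp : in_psi n y.
  split; first by rewrite -(subrK (x 0 0) (y 0 0)); exact: (visDl HF).
  by rewrite -(subrK (x 1 0) (y 1 0)); apply: (vgeD HF).
by split; [exact: in_psi_neq0 yp|exact: in_psi_oidx].
Qed.

Lemma compact_lattice N : compact [set x : 'cV[F]_2 | forall i j, vge N (x i j)].
Proof.
have -> : [set x : 'cV[F]_2 | forall i j, vge N (x i j)] =
    trmx @` [set v : 'rV[F]_2 | forall i, [set z : F | vge N z] (v ord0 i)].
  apply/seteqP; split=> [x xN|_ [v vN <-] i j] /=; last by rewrite mxE (ord1 j); exact: vN.
  by exists x^T; rewrite ?trmxK // => i; rewrite /= mxE.
apply: continuous_compact; last first.
  by apply: (@rV_compact F _ (fun=> [set z : F | vge N z])) => i; exact: (compact_vge HF Hpi).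
apply: continuous_subspaceT => v A /(nbhs_mxP HF)[M AM].
by apply/(nbhs_mxP HF); exists M => y yv; apply: AM => i j; rewrite !mxE.
Qed.

Lemma closed_lattice N : closed [set x : 'cV[F]_2 | forall i j, vge N (x i j)].
Proof.
move=> x clx i j.
have [|y /= [yN xy]] := clx [set y | forall i j, vge N (y i j - x i j)].
  by apply/(nbhs_mxP HF); exists N.
by rewrite -[x i j](subKr (y i j)); apply: (vgeB HF).
Qed.

Lemma invariant_profile (U : set 'M[F]_2) g N M c :
  (forall e : int, e < N -> g e = 0) -> (forall e : int, M <= e -> g e = c) ->
  (forall k x, U k -> x != 0 -> k *m x != 0 /\ g (oidx (k *m x)) = g (oidx x)) ->
  Ccoo_inv (R := R) U (of_profile g).
Proof.
move=> gN gM gU; pose h x := if x == 0 then c else g (oidx x).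
exists h; last by apply/funext => x; rewrite /restrict0 /of_profile /h; case: eqP.
split.
- move=> x; apply/(nbhs_mxP HF).
  have [->|x0] := eqVneq x 0.
    exists `|M| => y; rewrite /h eqxx; case: eqVneq => // y0 yN; apply: gM.
    suff : 2 * `|M| <= oidx y by lia.
    by apply/(vge_oidx _ y0) => i j; have := yN i j; rewrite mxE subr0.
  have [K yK] := oidx_near x0; exists K => y /yK[y0 yx] /=.
  by rewrite /h (negPf x0) (negPf y0) yx.
- apply: (subclosed_compact _ (@compact_lattice (- `|N|))); first exact: closed_closure.
  apply: subset_trans (@closed_lattice (- `|N|)).
  apply: closureS => x /=; have [-> _ i j|x0] := eqVneq x 0.
    by rewrite mxE; exact: vge0.
  rewrite /h (negPf x0) => gx.
  apply/(vge_oidx _ x0); rewrite leNgt; apply: contraNN gx => xN.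
  by apply/eqP/gN; lia.
- move=> k x kU; rewrite /h; have [->|x0] := eqVneq x 0; first by rewrite mulmx0 eqxx.
  by have [kx0 ->] := gU k x kU x0; rewrite (negPf kx0).
Qed.

Lemma SL2_neq0 k x : SL2 k -> x != 0 -> k *m x != 0.
Proof.
move=> Sk; apply: contraNN => /eqP kx.
by rewrite -(mulKmx (SL2_unit Sk) x) kx mulmx0.
Qed.

Lemma tame_VI g : tame g -> Ccoo_inv (R := R) (iwahori pi) (of_profile g).
Proof.
move=> [N [M [c [gN gM]]]]; apply: (invariant_profile gN gM) => k x kI x0.
rewrite (oidx_iwahori HF Hpi kI x0); split=> //.
by apply: SL2_neq0 => //; exact: iwahori_SL2 kI.
Qed.

Lemma groupK_inv (k : 'M[F]_2) : groupK k -> groupK (invmx k).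
Proof.
move=> [Sk kO]; split; first exact: SL2V.
move=> i j; rewrite -[ringO _]/(vge 0 _) (SL2_inv Sk).
by elim/ord2P: i; elim/ord2P: j; rewrite mx2_entries; try apply: (vgeN HF); exact: kO.
Qed.

Lemma groupK_lattice (k : 'M[F]_2) x N : groupK k ->
  (forall i j, vge N (x i j)) -> forall i j, vge N ((k *m x) i j).
Proof.
move=> [_ kO] xN i j; rewrite (ord1 j) mulcv2E.
by apply: (vgeD HF); apply: (vgeM HF (n := 0) (m := N)); rewrite ?add0r //; exact: kO.
Qed.

(** K permutes the two orbits 2 n and 2 n + 1. *)
Lemma tame_VK g : tame g -> (forall n, g (2 * n + 1) = g (2 * n)) ->
  Ccoo_inv (R := R) (@groupK F0 val) (of_profile g).
Proof.
move=> [N [M [c [gN gM]]]] gK; apply: (invariant_profile gN gM) => k x kK x0.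
have [Sk _] := kK; have kx0 := SL2_neq0 Sk x0; split=> //.
have le_k n : 2 * n <= oidx (k *m x) <-> 2 * n <= oidx x.
  rewrite -(vge_oidx _ kx0) -(vge_oidx _ x0); split; last exact: groupK_lattice.
  move=> kxN; rewrite -(mulKmx (SL2_unit Sk) x).
  by apply: groupK_lattice => //; exact: groupK_inv.
have gE y : y != 0 -> exists n, [/\ g (oidx y) = g (2 * n), 2 * n <= oidx y & oidx y < 2 * (n + 1)].
  by move=> /orbitP[] [n [_ ->]]; exists n; rewrite ?gK; split=> //; lia.
have [n [-> xn xn1]] := gE x x0; have [m [-> ym ym1]] := gE _ kx0.
have /(le_k n) kn := xn; have /(le_k m) km := ym.
by have -> : n = m by lia.
Qed.

Definition orbit_rep (e : int) : 'cV[F]_2 :=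
  if odd `|e| then cv2 (pi ^ (e %/ 2)%Z) 0 else cv2 0 (pi ^ (e %/ 2)%Z).

Lemma orbit_rep_even n : orbit_rep (2 * n) = cv2 0 (pi ^ n).
Proof.
rewrite /orbit_rep ifN; last by lia.
by congr (cv2 _ (_ ^ _)); lia.
Qed.

Lemma orbit_rep_odd n : orbit_rep (2 * n + 1) = cv2 (pi ^ n) 0.
Proof.
rewrite /orbit_rep ifT; last by lia.
by congr (cv2 (_ ^ _) _); lia.
Qed.

Lemma oidx_orbit_rep e : orbit_rep e != 0 /\ oidx (orbit_rep e) = e.
Proof.
have vp n := vis_piX HF Hpi n.
have [n [->|->]] : exists n, e = 2 * n \/ e = 2 * n + 1 by exists (e %/ 2)%Z; lia.
  rewrite orbit_rep_even; have xp : in_phi n (cv2 0 (pi ^ n)).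
    by split; rewrite ?cv2_0 ?cv2_1; [exact: vge0|exact: vp].
  by split; [exact: in_phi_neq0 xp|exact: in_phi_oidx].
rewrite orbit_rep_odd; have xp : in_psi n (cv2 (pi ^ n) 0).
  by split; rewrite ?cv2_0 ?cv2_1; [exact: vp|exact: vge0].
by split; [exact: in_psi_neq0 xp|exact: in_psi_oidx].
Qed.

Lemma profile_of (U : set 'M[F]_2) (f : punctured val R) :
  iwahori pi `<=` U -> Ccoo_inv (R := R) U f ->
  exists g h, [/\ tame g, f = of_profile g,
    forall e, g e = h (orbit_rep e) & forall k x, U k -> h (k *m x) = h x].
Proof.
move=> IU [h [hlc hcpt hU] <-]; exists (fun e => h (orbit_rep e)), h; split=> //; last first.
  apply/funext => x; rewrite /restrict0 /of_profile; case: eqVneq => // x0.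
  case: (orbitP x0) => -[n [xn ->]].
    rewrite orbit_rep_even; have [k kI {1}->] := in_phi_orbit HF Hpi xn.
    by apply: hU; exact: IU.
  rewrite orbit_rep_odd; have [k kI {1}->] := in_psi_orbit HF Hpi xn.
  by apply: hU; exact: IU.
have /(nbhs_mxP HF)[M hM] := hlc 0.
have [N hN] : exists N : nat, forall x, h x != 0 -> forall i j, vge (- N%:Z) (x i j).
  have [x _|N0 _ NP] := (compact_near_coveringP _).1 hcpt nat \oo
      (fun N x => forall i j, vge (- N%:Z) (x i j)) _.
    have [K xK] := mx_vge_bound x.
    exists ([set y : 'cV[F]_2 | forall i j, vge (- K%:Z) (y i j)], [set N : nat | (K <= N)%N]).
      split => /=; last by exists K.
      apply/(nbhs_mxP HF); exists (- K%:Z) => y yx i j.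
      by rewrite -(subrK (x i j) (y i j)); apply: (vgeD HF).
    by move=> [y N] /= [yK KN] i j; apply: vge_le (yK i j); lia.
  by exists N0 => x hx; apply: (NP N0 (leqnn N0)); exact: subset_closure.
exists (- (2 * N%:Z)), (2 * M), (h 0); split=> [e eN|e eM].
  have [e0 eo] := oidx_orbit_rep e; apply/eqP; apply: contraTT eN => /hN.
  by move/(vge_oidx _ e0); rewrite eo -leNgt; lia.
have [e0 eo] := oidx_orbit_rep e; apply: hM => i j; rewrite mxE subr0.
by move: i j; apply/(vge_oidx _ e0); rewrite eo.
Qed.

Lemma VI_profile (f : punctured val R) : Ccoo_inv (R := R) (iwahori pi) f ->
  exists2 g, tame g & f = of_profile g.
Proof. by move=> /(profile_of (@subset_refl _ _))[g [h [gt fg _ _]]]; exists g. Qed.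

Lemma VK_profile (f : punctured val R) : Ccoo_inv (R := R) (@groupK F0 val) f ->
  exists g, [/\ tame g, f = of_profile g & forall n, g (2 * n + 1) = g (2 * n)].
Proof.
have IK : iwahori pi `<=` @groupK F0 val by move=> k [].
move=> /(profile_of IK)[g [h [gt fg gh hK]]]; exists g; split=> // n.
rewrite !gh orbit_rep_odd orbit_rep_even.
have vpn := vis_vge (vis_piX HF Hpi n).
have wK : groupK (mx2 0 (-1) 1 0 : 'M[F]_2).
  split; first by apply/SL2E; rewrite !mx2_entries; ring.
  move=> i j; rewrite -[ringO _]/(vge 0 _).
  elim/ord2P: i; elim/ord2P: j; rewrite mx2_entries;
    by [exact: vge0|exact: vge1|apply: (vgeN HF); exact: vge1].
rewrite -(hK _ _ wK); congr h.
by apply: cV2P; rewrite mulcv2E !mx2_entries cv2_0 cv2_1 ?cv2_0 ?cv2_1; ring.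
Qed.

Lemma tame_lin (a : R[i]) g g' : tame g -> tame g' -> tame (fun e => a * g e + g' e).
Proof.
move=> [N [M [c [gN gM]]]] [N' [M' [c' [gN' gM']]]].
exists (Num.min N N'), (Num.max M M'), (a * c + c'); split=> e.
  by rewrite lt_min => /andP[/gN-> /gN'->]; rewrite mulr0 addr0.
by rewrite ge_max => /andP[/gM-> /gM'->].
Qed.

(** s e is the finite sum g e - g (e - 1) + g (e - 2) - g (e - 3) and so on. *)
Definition altsum g s : Prop :=
  (exists N, forall e : int, e < N -> s e = 0) /\ forall e, s e + s (e - 1) = g e.

Lemma altsum_exists g : tame g -> exists s, altsum g s.
Proof.
move=> [N [_ [_ [gN _]]]].
pose fix S (k : nat) : R[i] := if k is k'.+1 then g (N + k%:Z) - S k' else g N.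
exists (fun e => if e < N then 0 else S (absz (e - N))); split.
  by exists N => e ->.
move=> e; case: ltrP => eN; first by rewrite ifT ?gN ?addr0 //; lia.
have [->|eN'] := eqVneq e N; first by rewrite subrr /= ifT ?addr0 //; lia.
rewrite ifN; last by rewrite -leNgt; lia.
have -> : absz (e - N) = (absz (e - 1 - N)%R).+1 by lia.
rewrite /= subrK; congr (g _); lia.
Qed.

(** The action of t_(s_a) on profiles, in terms of their alternating sums s *)
Definition project (a : bool) s (e : int) : R[i] := if matched a e then s e else s (e - 1).

Lemma project_add s e g : (forall e, s e + s (e - 1) = g e) ->
  project false s e + project true s e = g e.
Proof.
move=> sg; rewrite /project -[true]/(~~ false) matched_opp.
by case: ifP => _ /=; rewrite -?sg // addrC.
Qed.

Variables (H : algType laurent) (T : affW -> H).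
Hypothesis HT : is_hecke_algebra T.
Variable mu : {measure set (borelM2 val) -> \bar R}.
Hypothesis Hmu : normalized_haar pi mu.

Lemma tame_bounded g : tame g -> exists C : R, forall e,
  `|complex.Re (g e)| <= C /\ `|complex.Im (g e)| <= C.
Proof.
move=> [N [M [c [gN gM]]]].
pose B (z : R[i]) : R := `|complex.Re z| + `|complex.Im z|.
exists (B c + \sum_(i < `|M - N|) B (g (N + i%:Z))) => e.
have B0 z : 0 <= B z by rewrite addr_ge0.
suff : B (g e) <= B c + \sum_(i < `|M - N|) B (g (N + i%:Z)).
  by move=> Be; split; apply: le_trans Be; rewrite /B ?lerDl ?lerDr.
have [/gN ->|Ne] := ltrP e N; first by rewrite /B /= !normr0 addr0 addr_ge0 ?sumr_ge0.
have [/gM ->|eM] := lerP M e; first by rewrite lerDl sumr_ge0.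
have ei : (`|e - N| < `|M - N|)%N by lia.
rewrite (bigD1 (Ordinal ei)) //= (_ : N + _ = e); last by lia.
by rewrite addrCA lerDl addr_ge0 ?sumr_ge0.
Qed.

(** The real and imaginary parts of the integral are both given by [t_integral]. *)
Lemma convol_profile a g s : tame g -> altsum g s ->
  convol_integrable mu (t_fun pi R T (gen a)) (of_profile g) /\
  convol mu (t_fun pi R T (gen a)) (of_profile g) = of_profile (project a s).
Proof.
move=> gt [[N' sN] sg]; have [C gC] := tame_bounded gt.
have [rs [rs_uniq rs_int rs_ex rs_inj rs_card]] := residues_exist HF Hpi.
have [N [_ [_ [gN _]]]] := gt.
have ReIm (p : R[i] -> R) (x : 'cV[F]_2) :
    (forall z w, p (z + w) = p z + p w) -> p 0 = 0 ->
    (forall (c : R) z, p (c%:C%C * z) = c * p z) ->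
    (forall e, `|p (g e)| <= C) -> x != 0 ->
  mu.-integrable (@SL2 F0 val)
     (EFin \o (fun u => p (convol_integrand (t_fun pi R T (gen a)) (of_profile g) x u))) /\
  Rintegral mu (@SL2 F0 val)
     (fun u => p (convol_integrand (t_fun pi R T (gen a)) (of_profile g) x u))
  = p (project a s (oidx x)).
Proof.
  move=> pD p0 pZ pC x0.
  pose f (u : borelM2 val) : R := t_fun pi R T (gen a) u * p (g (oidx (invmx u *m x))).
  have fE : {in @SL2 F0 val, f =1 fun u =>
      p (convol_integrand (t_fun pi R T (gen a)) (of_profile g) x u)}.
    move=> u; rewrite inE => Su; rewrite /f /convol_integrand pZ /of_profile.
    by rewrite (negPf (invmx_neq0 Su x0)).
  pose L := Num.min N N'.
  have pgN (e : int) : e < L -> p (g e) = 0.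
    by rewrite lt_min => /andP[eN _]; rewrite gN.
  have psN (e : int) : e < L -> p (s e) = 0.
    by rewrite lt_min => /andP[_ eN]; rewrite sN.
  have psg e : p (s e) + p (s (e - 1)) = p (g e) by rewrite -pD sg.
  split.
    apply: (eq_integrable (measurable_SL2 HF) (EFin \o f)).
      by move=> u uS; rewrite /= fE.
    exact: (t_integrable HF Hpi rs_uniq rs_int rs_ex rs_inj HT rs_card Hmu pC pgN a x0).
  transitivity (Rintegral mu (@SL2 F0 val) f).
    by apply: eq_Rintegral => u uS; exact: esym (fE u uS).
  rewrite (t_integral HF Hpi rs_uniq rs_int rs_ex rs_inj HT rs_card Hmu pC pgN psg psN a x0).
  by rewrite /project; case: ifP.
have [ReD ImD] : (forall z w : R[i], complex.Re (z + w) = complex.Re z + complex.Re w) /\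
    (forall z w : R[i], complex.Im (z + w) = complex.Im z + complex.Im w).
  by split=> -[? ?] [? ?].
have [ReZ ImZ] : (forall (c : R) z, complex.Re (c%:C%C * z) = c * complex.Re z) /\
    (forall (c : R) z, complex.Im (c%:C%C * z) = c * complex.Im z).
  by split=> c [z w] /=; ring.
have ReP x (x0 : x != 0) := ReIm (@complex.Re R) x ReD erefl ReZ (fun e => (gC e).1) x0.
have ImP x (x0 : x != 0) := ReIm (@complex.Im R) x ImD erefl ImZ (fun e => (gC e).2) x0.
split=> [x x0|]; first by split; [exact: (ReP x x0).1|exact: (ImP x x0).1].
apply/funext => x; rewrite /convol /restrict0 /of_profile.
have [//|x0] := eqVneq x 0.
by rewrite (ReP x x0).2 (ImP x x0).2; case: (project a s _).
Qed.

(** The profile of the indicator function of the n-th lattice of the chain *)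
Definition lattice_ind (n e : int) : R[i] := (n <= e)%R%:R.

Lemma tame_lattice_ind n : tame (lattice_ind n).
Proof.
by exists n, n, 1; split=> e; rewrite /lattice_ind; [rewrite ltNge => /negPf->|move=> ->].
Qed.

Lemma in_phiE n x : x != 0 -> in_phi n x <-> oidx x = 2 * n.
Proof. by move=> x0; split=> [/in_phi_oidx|/(oidx_even x0)]. Qed.

Lemma in_psiE n x : x != 0 -> in_psi n x <-> oidx x = 2 * n + 1.
Proof. by move=> x0; split=> [/in_psi_oidx|/(oidx_odd x0)]. Qed.

Lemma varphiE n x : varphi pi R n x = if x == 0 then 0 else (oidx x == 2 * n)%R%:R.
Proof.
rewrite /varphi indicE; have [->|x0] := eqVneq x 0.
  by rewrite memNset //= => -[_ /(piOunitsE HF Hpi)[]]; rewrite mxE eqxx.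
congr ((nat_of_bool _)%:R); apply/idP/eqP => [/set_mem[/(piOE HF Hpi) a0 /(piOunitsE HF Hpi) a1]|/(in_phiE _ x0)[a0 a1]].
  exact: in_phi_oidx.
by apply/mem_set; split; [exact/(piOE HF Hpi)|exact/(piOunitsE HF Hpi)].
Qed.

Lemma psiE n x : psi pi R n x = if x == 0 then 0 else (oidx x == 2 * n + 1)%R%:R.
Proof.
rewrite /psi indicE; have [->|x0] := eqVneq x 0.
  by rewrite memNset //= => -[/(piOunitsE HF Hpi)[]]; rewrite mxE eqxx.
congr ((nat_of_bool _)%:R); apply/idP/eqP => [/set_mem[/(piOunitsE HF Hpi) a0 /(piOE HF Hpi) a1]|/(in_psiE _ x0)[a0 a1]].
  exact: in_psi_oidx.
by apply/mem_set; split; [exact/(piOunitsE HF Hpi)|exact/(piOE HF Hpi)].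
Qed.

Lemma sum_single (m k0 : int) (f : int -> R[i]) : (forall k, k != k0 -> f k = 0) ->
  \sum_(k \in [set k : int | m <= k]) f k = if m <= k0 then f k0 else 0.
Proof.
move=> fk; rewrite fsbig_mkcond (@fsbigT_seq _ _ [:: k0]) //.
  rewrite big_seq1 /patch; case: ifP => [/set_mem/= ->//|/negbT k0m].
  by rewrite ifN //; apply: contraNN k0m => k0m; apply/mem_set.
by move=> k; rewrite inE /patch => /fk->; rewrite if_same.
Qed.

Lemma varphi_barE m : varphi_bar pi R m = of_profile (lattice_ind (2 * m)).
Proof.
apply/funext => x; rewrite /varphi_bar /of_profile /lattice_ind.
under eq_fsbigr do rewrite varphiE psiE.
have [_|x0] := eqVneq x 0; first by rewrite fsbig1 // => k _; rewrite addr0.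
have [k0 ek0] : exists k0, oidx x = 2 * k0 \/ oidx x = 2 * k0 + 1.
  by exists (oidx x %/ 2)%Z; lia.
rewrite (@sum_single m k0) => [|k kk0]; last first.
  have -> : (oidx x == 2 * k) = false by lia.
  have -> : (oidx x == 2 * k + 1) = false by lia.
  by rewrite addr0.
case: ek0 => ->; rewrite eqxx.
  have -> : (2 * k0 == 2 * k0 + 1) = false by lia.
  have -> : (2 * m <= 2 * k0) = (m <= k0) by lia.
  by rewrite addr0; case: (m <= k0).
have -> : (2 * k0 + 1 == 2 * k0) = false by lia.
have -> : (2 * m <= 2 * k0 + 1) = (m <= k0) by lia.
by rewrite add0r; case: (m <= k0).
Qed.

Lemma psi_barE m : psi_bar pi R m = of_profile (lattice_ind (2 * m + 1)).
Proof.
apply/funext => x; rewrite /psi_bar /of_profile /lattice_ind.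
under eq_fsbigr do rewrite varphiE psiE.
have [_|x0] := eqVneq x 0; first by rewrite fsbig1 // => k _; rewrite addr0.
have [k0 ek0] : exists k0, oidx x = 2 * k0 + 1 \/ oidx x = 2 * (k0 + 1).
  by exists ((oidx x - 1) %/ 2)%Z; lia.
rewrite (@sum_single m k0) => [|k kk0]; last first.
  have -> : (oidx x == 2 * k + 1) = false by lia.
  have -> : (oidx x == 2 * (k + 1)) = false by lia.
  by rewrite addr0.
case: ek0 => ->; rewrite eqxx.
  have -> : (2 * k0 + 1 == 2 * (k0 + 1)) = false by lia.
  have -> : (2 * m + 1 <= 2 * k0 + 1) = (m <= k0) by lia.
  by rewrite addr0; case: (m <= k0).
have -> : (2 * (k0 + 1) == 2 * k0 + 1) = false by lia.
have -> : (2 * m + 1 <= 2 * (k0 + 1)) = (m <= k0) by lia.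
by rewrite add0r; case: (m <= k0).
Qed.

Lemma altsum_lattice_ind n : altsum (lattice_ind n) (fun e => ((n <= e)%R && (odd `|e|%N == odd `|n|%N))%:R).
Proof.
split; first by exists n => e; rewrite ltNge => /negPf->.
move=> e; rewrite /lattice_ind -natrD; congr (_%:R).
have -> : odd `|e - 1| = ~~ odd `|e| by lia.
have [p|p] := eqVneq (odd `|e|) (odd `|n|).
  by rewrite p andbT; case: (odd _); rewrite andbF addn0.
rewrite andbF add0n (_ : (~~ odd `|e| == odd `|n|)) ?andbT; last by lia.
by congr nat_of_bool; lia.
Qed.

Lemma project_lattice_ind a n : of_profile (project a (fun e => ((n <= e)%R && (odd `|e|%N == odd `|n|%N))%:R))
  = if matched a n then of_profile (lattice_ind n) else fun=> 0.
Proof.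
apply/funext => x; transitivity (if matched a n then of_profile (lattice_ind n) x else 0); last first.
  by case: ifP.
rewrite /of_profile /project /lattice_ind; have [_|_] := eqVneq x 0; first by rewrite if_same.
move: (oidx x) => e.
have -> : odd `|e - 1| = ~~ odd `|e| by lia.
have le_pred : odd `|e| != odd `|n| -> (n <= e - 1) = (n <= e) by lia.
rewrite /matched; move: le_pred.
case: (odd `|e|); case: (odd `|n|); case: a => //= le_pred;
  by rewrite ?andbT ?andbF ?le_pred.
Qed.

(** For large e, s e + s (e - 1) is constant, so that s has period 2. *)
Lemma tame_project g s : tame g -> altsum g s -> tame (project false s).
Proof.
move=> [_ [M [c [_ gM]]]] [[N sN] sg].
exists N, (2 * `|M|), (s (2 * `|M|)); split=> e eN.
  by rewrite /project; case: ifP => _; rewrite sN //; lia.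
have s2 e' : M <= e' - 1 -> s e' = s (e' - 2).
  move=> Me; apply: (addIr (s (e' - 1))); rewrite sg gM; last by lia.
  have -> : e' - 2 = e' - 1 - 1 by lia.
  by rewrite addrC sg gM.
have sk (k : nat) : s (2 * `|M| + 2 * k%:Z) = s (2 * `|M|).
  elim: k => [|k IHk]; first by rewrite mulr0 addr0.
  by rewrite -IHk s2; [congr s|]; lia.
have [k [->|->]] : exists k : nat, e = 2 * `|M| + 2 * k%:Z \/ e = 2 * `|M| + 2 * k%:Z + 1.
  by exists `|(e - 2 * `|M|)%R|./2; lia.
  by rewrite /project ifT ?sk // /matched; lia.
by rewrite /project ifN ?addrK ?sk // /matched; lia.
Qed.

End Profiles.

(** * The action of t_(s_0) and t_(s_1) by complementary projectors *)
Theorem proposition5 (R : realType)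
  (F : fieldType) (val : F -> int) (HF : nonarchimedean_local_field val)
  (pi : valued val) (Hpi : uniformizer pi)
  (mu : {measure set (borelM2 val) -> \bar R}) (Hmu : normalized_haar pi mu)
  (H : algType laurent) (T : affW -> H) (HT : is_hecke_algebra T) :
  let t w := t_fun pi R T w in
  let VI := Ccoo_inv (R := R) (iwahori pi) in
  let VK := Ccoo_inv (R := R) (@groupK F val) in
  (forall h, VI h -> convol_integrable mu (t s0) h /\ convol_integrable mu (t s1) h) /\
  ((forall m : int,
      convol mu (t s0) (varphi_bar pi R m) = varphi_bar pi R m /\
      convol mu (t s0) (psi_bar pi R m) = (fun=> 0)) /\
   projector_onto (convol mu (t s0)) VI VK) /\
  ((forall m : int,
      convol mu (t s1) (psi_bar pi R m) = psi_bar pi R m /\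
      convol mu (t s1) (varphi_bar pi R m) = (fun=> 0)) /\
   (forall h, VI h -> convol mu (t s1) h = (fun x => h x - convol mu (t s0) h x))).
Proof.
move=> t VI VK; rewrite /t gen_s0 gen_s1.
have act a g s : tame g -> altsum g s ->
    convol mu (t_fun pi R T (gen a)) (of_profile g) = of_profile (project a s).
  by move=> gt gs; exact: (convol_profile HF Hpi HT Hmu a gt gs).2.
have act_lattice_ind a n : convol mu (t_fun pi R T (gen a)) (of_profile (lattice_ind R n))
    = if matched a n then of_profile (lattice_ind R n) else fun=> 0.
  by rewrite (act _ _ _ (tame_lattice_ind R n) (altsum_lattice_ind R n)) project_lattice_ind.
have even_matched m : matched false (2 * m) by rewrite /matched; lia.
have odd_matched m : matched true (2 * m + 1) by rewrite /matched; lia.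
have VKI f : VK f -> VI f.
  by move=> /(VK_profile HF Hpi)[g [gt -> _]]; exact: tame_VI.
(* If g takes the same value at 2 n and 2 n + 1, its alternating sum is g itself on even indices and 0
on odd ones. *)
have fixVK f : VK f -> convol mu (t_fun pi R T (gen false)) f = f.
  move=> /(VK_profile HF Hpi)[g [gt -> gK]].
  have gs : altsum g (fun e => if matched false e then g e else 0).
    have [N [_ [_ [gN _]]]] := gt; split.
      by exists N => e /gN->; rewrite if_same.
    move=> e; rewrite matchedB1; case: ifPn => ev /=; first by rewrite addr0.
    have [n ->] : exists n, e = 2 * n + 1 by exists ((e - 1) %/ 2)%Z; move: ev; rewrite /matched; lia.
    by rewrite add0r addrK gK.
  rewrite (act _ _ _ gt gs); congr of_profile; apply/funext => e.
  rewrite /project matchedB1; case: ifPn => ev //=; rewrite ?ev //.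
  have [n ->] : exists n, e = 2 * n + 1 by exists ((e - 1) %/ 2)%Z; move: ev; rewrite /matched; lia.
  by rewrite addrK gK.
split; [|split; split].
- move=> f /(VI_profile HF Hpi)[g gt ->]; have [s gs] := altsum_exists gt.
  by split; exact: (convol_profile HF Hpi HT Hmu _ gt gs).1.
- move=> m; rewrite (varphi_barE HF Hpi) (psi_barE HF Hpi) !act_lattice_ind even_matched.
  by rewrite -[false]/(~~ true) matched_opp odd_matched.
- split=> //.
  + move=> a f1 f2 /(VI_profile HF Hpi)[g1 gt1 ->] /(VI_profile HF Hpi)[g2 gt2 ->].
    have [s1 gs1] := altsum_exists gt1; have [s2 gs2] := altsum_exists gt2.
    have lin (u1 u2 : int -> R[i]) : (fun x => a * of_profile u1 x + of_profile u2 x)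
        = of_profile (val := val) (fun e => a * u1 e + u2 e).
      by apply/funext => x; rewrite /of_profile; case: ifP; rewrite ?mulr0 ?addr0.
    have gs : altsum (fun e => a * g1 e + g2 e) (fun e => a * s1 e + s2 e).
      case: gs1 gs2 => [[N1 sN1] sg1] [[N2 sN2] sg2]; split.
        exists (Num.min N1 N2) => e; rewrite lt_min => /andP[/sN1-> /sN2->].
        by rewrite mulr0 addr0.
      by move=> e; rewrite -sg1 -sg2; ring.
    rewrite lin (act _ _ _ (tame_lin a gt1 gt2) gs) (act _ _ _ gt1 gs1) (act _ _ _ gt2 gs2).
    by rewrite lin; congr of_profile; apply/funext => e; rewrite /project; case: ifP.
  + apply/seteqP; split=> [_ [f /(VI_profile HF Hpi)[g gt ->] <-]|f fK].
      have [s gs] := altsum_exists gt; rewrite (act _ _ _ gt gs).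
      apply: (tame_VK HF Hpi); first exact: tame_project gt gs.
      by move=> n; rewrite /project addrK even_matched matchedD1 even_matched.
    by exists f; [exact: VKI|exact: fixVK].
- move=> m; rewrite (varphi_barE HF Hpi) (psi_barE HF Hpi) !act_lattice_ind odd_matched.
  by rewrite -[true]/(~~ false) matched_opp even_matched.
- move=> f /(VI_profile HF Hpi)[g gt ->]; have [s gs] := altsum_exists gt.
  rewrite !(act _ _ _ gt gs); apply/funext => x; rewrite /of_profile.
  case: ifP => _; first by rewrite subr0.
  by rewrite -(project_add (oidx x) gs.2) [X in X - _]addrC addrK.
Qed.
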